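(* Let $f\in\mathbb{K}[z]$ be a polynomial with $\deg f\ge 2$ and with distinct roots, let $m$ and $k_1,\dots,k_m$ be positive integers, and let $$Z=\{xy_1^{k_1}\cdots y_m^{k_m}=f(z)\}\subseteq\mathbb{K}^{m+2}.$$ Let $X=Z\times\mathbb{K}$. Then for each $1\le n\le m$ there exists a maximal torus in $\mathrm{Aut}(X)$ of dimension $n$.
   Context: $\mathbb{K}$ is an algebraically closed field of characteristic zero. $\mathrm{Aut}(X)$ is the group of regular automorphisms of $X$. A torus in $\mathrm{Aut}(X)$ is an algebraic subgroup isomorphic to $(\mathbb{K}^\times)^d$; it is maximal if it is not properly contained in another torus in $\mathrm{Aut}(X)$. *)

(* Defs.v *)
From HB Require Import structures.
From mathcomp Require Import all_boot all_order all_algebra.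
From mathcomp Require Export mpoly.

Set Implicit Arguments.
Unset Strict Implicit.
Unset Printing Implicit Defensive.

Import GRing.Theory.
Local Open Scope ring_scope.

Section AffineVarieties.
Context {K : fieldType}.

Definition zariski_closed n (X : {pred 'rV[K]_n}) : Prop :=
  exists s : seq {mpoly K[n]},
    forall v : 'rV[K]_n, (v \in X) = all (fun p => p.@[v ord0] == 0) s.

Definition points n (X : {pred 'rV[K]_n}) : Type := {v : 'rV[K]_n | v \in X}.

Definition regular n p (X : {pred 'rV[K]_n}) (Y : {pred 'rV[K]_p})
    (phi : points X -> points Y) : Prop :=
  exists P : 'I_p -> {mpoly K[n]},
    forall u j, val (phi u) ord0 j = (P j).@[val u ord0].

(* Regularity of a map X x Y -> W, written in curried form; the coordinates on
   X x Y are those of X followed by those of Y. *)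
Definition regular2 n p q (X : {pred 'rV[K]_n}) (Y : {pred 'rV[K]_p})
    (W : {pred 'rV[K]_q}) (phi : points X -> points Y -> points W) : Prop :=
  exists P : 'I_q -> {mpoly K[n + p]},
    forall u v j,
      val (phi u v) ord0 j = (P j).@[row_mx (val u) (val v) ord0].

Definition is_aut n (X : {pred 'rV[K]_n}) (phi : points X -> points X) : Prop :=
  regular phi /\
  exists psi : points X -> points X,
    [/\ regular psi, cancel phi psi & cancel psi phi].

Definition is_subgroup_of_Aut n (X : {pred 'rV[K]_n})
    (H : (points X -> points X) -> Prop) : Prop :=
  [/\ forall phi, H phi -> is_aut phi,
      H id,
      forall phi psi, H phi -> H psi -> H (phi \o psi)
    & forall phi psi, H phi -> cancel phi psi -> cancel psi phi -> H psi].

Definition full_space n : {pred 'rV[K]_n} := predT.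

Definition product n p (X : {pred 'rV[K]_n}) (Y : {pred 'rV[K]_p}) :
    {pred 'rV[K]_(n + p)} :=
  [pred v | (lsubmx v \in X) && (rsubmx v \in Y)].

End AffineVarieties.

Arguments full_space K n : clear implicits.

Record alg_group (K : fieldType) := AlgGroup {
  ag_dim : nat;
  ag_set : {pred 'rV[K]_ag_dim};
  ag_mul : points ag_set -> points ag_set -> points ag_set;
  ag_one : points ag_set;
  ag_inv : points ag_set -> points ag_set;
  ag_closed : zariski_closed ag_set;
  ag_mul_regular : regular2 ag_mul;
  ag_inv_regular : regular ag_inv;
  ag_mulA : associative ag_mul;
  ag_mul1 : left_id ag_one ag_mul;
  ag_mulV : left_inverse ag_one ag_inv ag_mul
}.

Arguments ag_set {K} _.

Definition alg_group_isomorphic (K : fieldType) (G G' : alg_group K) : Prop :=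
  exists (phi : points (ag_set G) -> points (ag_set G'))
         (psi : points (ag_set G') -> points (ag_set G)),
    [/\ regular phi, regular psi, cancel phi psi, cancel psi phi
      & {morph phi : g h / ag_mul g h >-> ag_mul g h}].

Section MultiplicativeTorus.
Context (K : fieldType) (d : nat).

(* The d-fold power of the multiplicative group of K, embedded in K^(d + d) as
   the closed set of all (t, t^-1). *)
Definition Gm_set : {pred 'rV[K]_(d + d)} :=
  [pred v : 'rV[K]_(d + d) |
    [forall i, v ord0 (lshift d i) * v ord0 (rshift d i) == 1]].

Lemma Gm_closed : zariski_closed Gm_set.
Proof.
exists [seq 'X_(lshift d i) * 'X_(rshift d i) - 1 | i : 'I_d] => v.
rewrite all_map inE; apply/forallP/allP => [h i _ | h i] /=.
  by rewrite mevalB mevalM !mevalXU meval1 (eqP (h i)) subrr.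
have := h i (mem_enum _ _).
by rewrite /= mevalB mevalM !mevalXU meval1 subr_eq0.
Qed.

Lemma Gm_mul_in (u v : points Gm_set) :
  \row_i (val u ord0 i * val v ord0 i) \in Gm_set.
Proof.
rewrite inE; apply/forallP => i; rewrite !mxE mulrACA.
have /forallP/(_ i)/eqP -> := valP u.
by have /forallP/(_ i)/eqP -> := valP v; rewrite mulr1.
Qed.

Lemma Gm_one_in : const_mx 1 \in Gm_set.
Proof. by rewrite inE; apply/forallP => i; rewrite !mxE mulr1. Qed.

Lemma Gm_inv_in (u : points Gm_set) :
  row_mx (rsubmx (val u)) (lsubmx (val u)) \in Gm_set.
Proof.
rewrite inE; apply/forallP => i; rewrite row_mxEl row_mxEr !mxE mulrC.
by have /forallP/(_ i) := valP u.
Qed.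

Definition Gm_mul (u v : points Gm_set) : points Gm_set :=
  exist (fun v => v \in Gm_set) _ (Gm_mul_in u v).
Definition Gm_one : points Gm_set := exist (fun v => v \in Gm_set) _ Gm_one_in.
Definition Gm_inv (u : points Gm_set) : points Gm_set :=
  exist (fun v => v \in Gm_set) _ (Gm_inv_in u).

Lemma Gm_mul_regular : regular2 Gm_mul.
Proof.
exists (fun j => 'X_(lshift (d + d) j) * 'X_(rshift (d + d) j)) => u v j.
by rewrite mevalM !mevalXU row_mxEl row_mxEr mxE.
Qed.

Lemma Gm_inv_regular : regular Gm_inv.
Proof.
exists (fun j => match split j with
                 | inl i => 'X_(rshift d i)
                 | inr i => 'X_(lshift d i) end) => u j.
by rewrite /= mxE; case: split => i; rewrite mevalXU mxE.
Qed.

Lemma Gm_mulA : associative Gm_mul.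
Proof.
by move=> u v w; apply: val_inj; apply/rowP => i; rewrite /= !mxE mulrA.
Qed.

Lemma Gm_mul1 : left_id Gm_one Gm_mul.
Proof. by move=> u; apply: val_inj; apply/rowP => i; rewrite /= !mxE mul1r. Qed.

Lemma Gm_mulV : left_inverse Gm_one Gm_inv Gm_mul.
Proof.
move=> u; apply: val_inj; apply/rowP => i; rewrite /= !mxE.
rewrite -{2}(splitK i); case: split => j /=; rewrite mxE; last first.
  by have /forallP/(_ j)/eqP := valP u.
by rewrite mulrC; have /forallP/(_ j)/eqP := valP u.
Qed.

Definition Gm_power : alg_group K :=
  AlgGroup Gm_closed Gm_mul_regular Gm_inv_regular Gm_mulA Gm_mul1 Gm_mulV.

End MultiplicativeTorus.

Section Tori.
Context {K : fieldType} {n : nat} {X : {pred 'rV[K]_n}}.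
Implicit Types H : (points X -> points X) -> Prop.

(* The subgroup H of Aut(X) is the isomorphic image of the algebraic group G,
   and the resulting action G x X -> X is a morphism of varieties. *)
Definition algebraic_subgroup (G : alg_group K) H : Prop :=
  is_subgroup_of_Aut H /\
  exists rho : points (ag_set G) -> points X -> points X,
    [/\ forall g h, rho (ag_mul g h) = rho g \o rho h,
        injective rho,
        forall phi, H phi <-> exists g, rho g = phi
      & regular2 rho].

Definition torus_of_dim (d : nat) H : Prop :=
  exists G : alg_group K,
    algebraic_subgroup G H /\ alg_group_isomorphic G (Gm_power K d).

Definition is_torus H : Prop := exists d, torus_of_dim d H.

Definition maximal_torus H : Prop :=
  is_torus H /\
  forall H', is_torus H' ->
    (forall phi, H phi -> H' phi) -> forall phi, H' phi -> H phi.

End Tori.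

Definition has_distinct_roots (K : fieldType) (f : {poly K}) : Prop :=
  exists s : seq K,
    uniq s /\ f = lead_coef f *: \prod_(a <- s) ('X - a%:P).

(* The hypersurface x * y_1^k_1 * ... * y_m^k_m = f(z) in K^(m + 2), the
   coordinates being ordered as (x, y_1, ..., y_m, z). *)
Definition danielewski (K : fieldType) (f : {poly K}) (m : nat)
    (k : 'I_m -> nat) : {pred 'rV[K]_(1 + m + 1)} :=
  [pred v : 'rV[K]_(1 + m + 1) |
    let x := v ord0 (lshift 1 (lshift m ord0)) in
    let y i := v ord0 (lshift 1 (rshift 1 i)) in
    let z := v ord0 (rshift (1 + m) ord0) in
    x * \prod_(i < m) y i ^+ k i == f.[z]].

(* Main.v *)
Require Import Defs.
From mathcomp Require Import all_boot all_order all_algebra.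
From mathcomp Require Import separable ring zify.
From Stdlib Require Import FunctionalExtensionality.

(** Write f = c prod (z - a) over the roots a of f, and for polynomials M,
    C in y_1, .., y_m let D(M, C) be the variety x M(y) = c prod (z - a
    C(y)). Put Y = y_1 .. y_m. If M has the same zeros as Y and C = 1
    modulo Y, then D(M, C) is a torsor under the additive group over a
    scheme that depends on f and m only: the affine m-space with the
    divisor Y = 0 replaced by one copy for each root of f. All these
    torsors are affine varieties, so the fibre product of two of them is
    trivial over both, and the two varieties times the affine line are
    isomorphic ([danielewski_cyl_iso]). Explicitly z' = C' s(z) + M' w and
    z = C s(z') + M w', where the polynomial s lifts the roots of f modulo
    a high power of f.

    The cylinder of the theorem is therefore also the cylinder over Z' =
    D(Y^3, C) with C = 1 + Y (1 + sum of y_i for i in J). This Z' has less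
    symmetry: y -> (chi_i y_i) preserves the equation only if prod chi_i =
    1 and chi_i = 1 on J. For J with m - n elements these scalings form a
    torus of dimension n - 1, and with the scalings of w they give a torus
    T of dimension n on Z' x K.

    T is maximal. A torus that contains T is commutative and generated by
    one-parameter groups ([torus_generated]). A one-parameter group that
    commutes with the scalings of w preserves Z' x 0, where it gives a
    flow mu, and it multiplies w by an invertible function. Invertible
    functions on Z' are constant, because Z' is chain connected by affine
    lines ([invertible_constant]). It remains to see that mu belongs to
    the coordinate torus ([flow_in_torus]), in three steps.

    First, mu preserves every divisor y_i = 0 ([flow_preserves_order]). If
    not, the expansion of mu at s = 1 has poles in h along the curves y_i
    = h b. Rescale y_i by h^q, x by h^(-3q) and take the time s = 1 + t
    h^a, where a/q is the slope of the worst pole. For h -> 0 the orbits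
    converge to polynomial curves in t on the variety X Y^3 = f(Z), not
    all constant. The limit motion preserves X = 0, hence X has no zero on
    the curves that start off X = 0 and is constant there; and then X Y^3
    = f(Z) forces Y and Z to be constant, by a count of degrees in the
    spirit of the theorem of Mason and Stothers ([split_curve_constant]).

    Secondly, y_i o mu_s is then y_i times an invertible function, so mu
    multiplies y_i by a constant chi_i(s), and it maps the lines y =
    constant affinely to such lines. Thirdly, the sections x = 0, z = a
    C(y) over the ray y = h b are moved to curves that agree with sections
    up to the order h^(3m), and 3m exceeds the degree m + 1 of C on the
    ray: this reads off that chi satisfies the equations of the torus and
    leaves finitely many possibilities for the slope of the affine maps.
    The slope is a Laurent polynomial in s, hence equal to 1; the offset
    is additive on the multiplicative group, hence 0. *)

Set Implicit Arguments.
Unset Strict Implicit.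
Unset Printing Implicit Defensive.
Import Order.TTheory GRing.Theory Num.Theory.
Local Open Scope ring_scope.

(** * Algebras of functions and congruences in them *)

(** Polynomial functions on a curve, regular functions on a variety, regular
    functions of two points and Laurent families are all handled through this
    one closure property, which spares explicit polynomials in most proofs of
    regularity. *)
Definition function_algebra (K : comNzRingType) (T : Type)
    (A : (T -> K) -> Prop) : Prop :=
  [/\ forall c, A (fun=> c),
      forall f g, A f -> A g -> A (fun t => f t + g t)
    & forall f g, A f -> A g -> A (fun t => f t * g t)].

Section FunctionAlgebra.
Context (K : comNzRingType) (T : Type) (A : (T -> K) -> Prop).
Hypothesis algA : function_algebra A.

Lemma fa_cst c : A (fun=> c). Proof. by case: algA. Qed.

Lemma fa_add f g : A f -> A g -> A (fun t => f t + g t).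
Proof. by case: algA => _ h _; exact: h. Qed.

Lemma fa_mul f g : A f -> A g -> A (fun t => f t * g t).
Proof. by case: algA => _ _; exact. Qed.

Lemma fa_eq f g : A f -> f =1 g -> A g.
Proof. by move=> Af /functional_extensionality <-. Qed.

Lemma fa_opp f : A f -> A (fun t => - f t).
Proof.
move=> Af; apply: (@fa_eq (fun t => -1 * f t)) => [|t]; last by rewrite mulN1r.
by apply: fa_mul => //; exact: fa_cst.
Qed.

Lemma fa_sub f g : A f -> A g -> A (fun t => f t - g t).
Proof. by move=> Af Ag; apply: fa_add => //; exact: fa_opp. Qed.

Lemma fa_exp f n : A f -> A (fun t => f t ^+ n).
Proof.
move=> Af; elim: n => [|n IHn]; first exact: fa_cst.
by apply: (fa_eq (fa_mul Af IHn)) => t; rewrite exprS.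
Qed.

Lemma fa_sum (I : Type) (r : seq I) (P : pred I) (F : I -> T -> K) :
  (forall i, A (F i)) -> A (fun t => \sum_(i <- r | P i) F i t).
Proof.
move=> AF; elim: r => [|i r IHr].
  by apply: (fa_eq (fa_cst 0)) => t; rewrite big_nil.
case Pi: (P i); last by apply: (fa_eq IHr) => t; rewrite big_cons Pi.
by apply: (fa_eq (fa_add (AF i) IHr)) => t; rewrite big_cons Pi.
Qed.

Lemma fa_prod (I : Type) (r : seq I) (P : pred I) (F : I -> T -> K) :
  (forall i, A (F i)) -> A (fun t => \prod_(i <- r | P i) F i t).
Proof.
move=> AF; elim: r => [|i r IHr].
  by apply: (fa_eq (fa_cst 1)) => t; rewrite big_nil.
case Pi: (P i); last by apply: (fa_eq IHr) => t; rewrite big_cons Pi.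
by apply: (fa_eq (fa_mul (AF i) IHr)) => t; rewrite big_cons Pi.
Qed.

Lemma fa_horner (p : {poly K}) f : A f -> A (fun t => p.[f t]).
Proof.
move=> Af; apply: (@fa_eq (fun t => \sum_(i < size p) p`_i * f t ^+ i)).
  by apply: fa_sum => i; apply: fa_mul; [exact: fa_cst | exact: fa_exp].
by move=> t; rewrite horner_coef.
Qed.

Lemma fa_meval n (P : {mpoly K[n]}) (F : T -> 'I_n -> K) :
  (forall i, A (fun t => F t i)) -> A (fun t => P.@[F t]).
Proof.
move=> AF.
apply: (@fa_eq (fun t => \sum_(k <- msupp P) P@_k * \prod_i F t i ^+ k i)).
  apply: fa_sum => k; apply: fa_mul; first exact: fa_cst.
  by apply: fa_prod => i; apply: fa_exp.
by move=> t; rewrite mevalE.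
Qed.

(** Congruence modulo the ideal generated by [D] in the algebra [A]. Working
    with functions, not with polynomials modulo an equation, makes the
    relation of the variety available as an identity. *)
Definition fcong (D f g : T -> K) : Prop :=
  exists2 e, A e & forall t, f t = g t + D t * e t.

Lemma fcong_refl D f : fcong D f f.
Proof. by exists (fun=> 0) => [|t]; [exact: fa_cst | rewrite mulr0 addr0]. Qed.

Lemma fcong_sym D f g : fcong D f g -> fcong D g f.
Proof.
move=> [e Ae fE]; exists (fun t => - e t) => [|t]; first exact: fa_opp.
by rewrite fE mulrN addrK.
Qed.

Lemma fcong_trans D f g h : fcong D f g -> fcong D g h -> fcong D f h.
Proof.
move=> [e Ae fE] [e' Ae' gE]; exists (fun t => e' t + e t) => [|t].
  exact: fa_add.
by rewrite fE gE -addrA -mulrDr.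
Qed.

Lemma fcong_add D f f' g g' : fcong D f f' -> fcong D g g' ->
  fcong D (fun t => f t + g t) (fun t => f' t + g' t).
Proof.
move=> [e Ae fE] [e' Ae' gE]; exists (fun t => e t + e' t) => [|t].
  exact: fa_add.
by rewrite fE gE; ring.
Qed.

Lemma fcong_mul D f f' g g' : A D -> A f' -> A g' ->
  fcong D f f' -> fcong D g g' ->
  fcong D (fun t => f t * g t) (fun t => f' t * g' t).
Proof.
move=> AD Af Ag [e Ae fE] [e' Ae' gE].
exists (fun t => f' t * e' t + g' t * e t + D t * (e t * e' t)) => [|t].
  by do !apply: fa_add; do !apply: fa_mul.
by rewrite fE gE; ring.
Qed.

Lemma fcong_horner D f g (p : {poly K}) : A D -> A g -> fcong D f g ->
  fcong D (fun t => p.[f t]) (fun t => p.[g t]).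
Proof.
move=> AD Ag fg; elim/poly_ind: p => [|p c IHp].
  by exists (fun=> 0) => [|t]; [exact: fa_cst | rewrite !horner0 mulr0 addr0].
have [e Ae h] := fcong_mul AD (fa_horner p Ag) Ag IHp fg.
exists e => // t; rewrite !hornerMXaddC h; ring.
Qed.

End FunctionAlgebra.

Ltac falg H := repeat first
  [ assumption | exact: (fa_cst H) | apply: (fa_sub H) | apply: (fa_add H)
  | apply: (fa_mul H) | apply: (fa_opp H) | apply: (fa_exp H)
  | apply: (fa_horner H) ].

(** * Lifting roots, and the shift between two Danielewski equations *)

Section RootLifting.
Context (K : fieldType) (f : {poly K}).

Lemma comp_poly_taylor (p a e : {poly K}) :
  exists h, p \Po (a + e) = p \Po a + e * (p^`() \Po a) + e ^+ 2 * h.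
Proof.
elim/poly_ind: p => [|p c [h IHp]].
  by exists 0; rewrite deriv0 !comp_poly0; ring.
exists (h * (a + e) + (p^`() \Po a)).
rewrite derivMXaddC !comp_polyD !comp_polyM !comp_polyX !comp_polyC IHp.
ring.
Qed.

(** Newton iteration s - v(s) f(s): by the Bezout relation it raises the power
    of f that divides f o s, and it does not change s modulo f. The result is
    a polynomial that is constant to the order N at each root of f. *)
Lemma root_lift (u v : {poly K}) N : u * f + v * f^`() = 1 ->
  exists s phi psi, s = 'X + f * psi /\ f \Po s = f ^+ N * phi.
Proof.
move=> bezout; case: N => [|N].
  by exists 'X, f, 0; rewrite mulr0 addr0 comp_polyXr expr0 mul1r.
elim: N => [|N [s [phi [psi [sE fsE]]]]].
  by exists 'X, 1, 0; rewrite mulr0 addr0 comp_polyXr mulr1.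
pose e := - ((v \Po s) * (f \Po s)).
have [h hE] := comp_poly_taylor f s e.
have bz : (v \Po s) * (f^`() \Po s) = 1 - (u \Po s) * (f \Po s).
  have := congr1 (comp_poly s) bezout.
  rewrite comp_polyD !comp_polyM -polyC1 comp_polyC polyC1.
  by move=> /(canRL (addKr _)) ->; rewrite addrC.
exists (s + e), (f ^+ N * phi ^+ 2 * ((u \Po s) + (v \Po s) ^+ 2 * h)).
exists (psi - (v \Po s) * f ^+ N * phi); split.
  by rewrite /e fsE exprS {1}sE; ring.
rewrite hE.
have -> : f \Po s + e * (f^`() \Po s) + e ^+ 2 * h =
  f \Po s - (v \Po s) * (f^`() \Po s) * (f \Po s)
    + (f \Po s) ^+ 2 * ((v \Po s) ^+ 2 * h) by rewrite /e; ring.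
rewrite bz fsE !exprS; ring.
Qed.

End RootLifting.

Section SplitForm.
Context (K : fieldType) (lc : K) (rs : seq K).

(** The form in (z, c) that is homogeneous of degree deg f and specializes to
    f at c = 1. *)
Definition split_form (c z : K) : K := lc * \prod_(a <- rs) (z - a * c).

Definition split_poly : {poly K} := lc *: \prod_(a <- rs) ('X - a%:P).

Lemma split_form1 z : split_form 1 z = split_poly.[z].
Proof.
rewrite /split_form /split_poly hornerZ horner_prod; congr (_ * _).
by apply: eq_bigr => a _; rewrite mulr1 hornerXsubC.
Qed.

Lemma split_formM c z : split_form c (c * z) = c ^+ size rs * split_poly.[z].
Proof.
rewrite -split_form1 /split_form mulrCA; congr (_ * _).
elim: rs => [|a s IHs]; first by rewrite !big_nil mul1r.
by rewrite !big_cons IHs /= exprS; ring.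
Qed.

(** The divided difference of prod (z - q c) between a and b, as a polynomial
    in a, b and c; on the diagonal it is the derivative. *)
Fixpoint slope (s : seq K) (c a b : K) : K :=
  if s is r :: s' then
    \prod_(q <- s') (b - q * c) + (a - r * c) * slope s' c a b
  else 0.

Lemma slopeE s c a b :
  (b - a) * slope s c a b =
  \prod_(q <- s) (b - q * c) - \prod_(q <- s) (a - q * c).
Proof.
elim: s => [|r s IHs] /=; first by rewrite !big_nil mulr0 subrr.
rewrite !big_cons mulrDr (mulrCA (b - a)) IHs; ring.
Qed.

Lemma slope_diag s a :
  slope s 1 a a = (\prod_(q <- s) ('X - q%:P))^`().[a].
Proof.
elim: s => [|r s IHs] /=; first by rewrite big_nil derivC horner0.
rewrite big_cons derivM derivXsubC mul1r hornerD hornerM hornerXsubC IHs mulr1.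
rewrite horner_prod; congr (_ + _); apply: eq_bigr => q _.
by rewrite mulr1 hornerXsubC.
Qed.

Context (T : Type) (A : (T -> K) -> Prop) (algA : function_algebra A).

Lemma fa_split_form c z : A c -> A z -> A (fun t => split_form (c t) (z t)).
Proof.
move=> Ac Az; apply: (fa_mul algA); first exact: (fa_cst algA).
by apply: (fa_prod algA) => a; falg algA.
Qed.

Lemma fcong_prod D (s : seq K) c c' z z' : A D -> A c' -> A z' ->
  fcong A D c c' -> fcong A D z z' ->
  fcong A D (fun t => \prod_(a <- s) (z t - a * c t))
            (fun t => \prod_(a <- s) (z' t - a * c' t)).
Proof.
move=> AD Ac Az cc zz; elim: s => [|a s IHs].
  by exists (fun=> 0) => [|t]; [exact: (fa_cst algA)
                              | rewrite !big_nil mulr0 addr0].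
have hz : fcong A D (fun t => z t - a * c t) (fun t => z' t - a * c' t).
  have [e Ae cE] := cc; have [e' Ae' zE] := zz.
  by exists (fun t => e' t - a * e t) => [|t]; [falg algA|rewrite cE zE; ring].
have Az' : A (fun t => z' t - a * c' t) by falg algA.
have AP : A (fun t => \prod_(a <- s) (z' t - a * c' t)).
  by apply: (fa_prod algA) => b; falg algA.
have [e Ae h] := fcong_mul algA AD Az' AP hz IHs.
by exists e => // t; rewrite !big_cons h.
Qed.

Lemma fcong_split_form D c c' z z' : A D -> A c' -> A z' ->
  fcong A D c c' -> fcong A D z z' ->
  fcong A D (fun t => split_form (c t) (z t))
            (fun t => split_form (c' t) (z' t)).
Proof.
move=> AD Ac Az cc zz; have [e Ae h] := fcong_prod rs AD Ac Az cc zz.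
exists (fun t => lc * e t) => [|t]; first by falg algA.
by rewrite /split_form h; ring.
Qed.

Lemma fcong_slope D s c a b : A D -> A a ->
  fcong A D c (fun=> 1) -> fcong A D b a ->
  fcong A D (fun t => slope s (c t) (a t) (b t))
            (fun t => slope s 1 (a t) (a t)).
Proof.
move=> AD Aa cc ba; elim: s => [|r s IHs] /=; first exact: fcong_refl.
have A1 := fa_cst algA 1.
apply: (fcong_add algA); first exact: fcong_prod.
apply: (fcong_mul algA) => //; first by falg algA.
  have -> : (fun t => slope s 1 (a t) (a t)) =
            (fun t => (\prod_(q <- s) ('X - q%:P))^`().[a t]).
    by apply: functional_extensionality => t; rewrite slope_diag.
  exact: (fa_horner algA).
have [e Ae cE] := cc.
by exists (fun t => - (r * e t)) => [|t]; [falg algA | rewrite cE; ring].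
Qed.

Context (x z w m1 c1 m2 c2 Y : T -> K) (N : nat).
Hypotheses (Ax : A x) (Az : A z) (Aw : A w) (Am1 : A m1) (Ac1 : A c1)
  (Am2 : A m2) (Ac2 : A c2) (AY : A Y).
Hypotheses (Ym1 : fcong A Y m1 (fun=> 0)) (Ym2 : fcong A Y m2 (fun=> 0)).
Hypotheses (m1Y : fcong A m1 (fun t => Y t ^+ N) (fun=> 0))
  (m2Y : fcong A m2 (fun t => Y t ^+ N) (fun=> 0)).
Hypotheses (c1Y : fcong A Y c1 (fun=> 1)) (c2Y : fcong A Y c2 (fun=> 1)).
Hypothesis eq1 : forall t, x t * m1 t = split_form (c1 t) (z t).
Context (u v s phi psi : {poly K}).
Hypothesis bezout : u * split_poly + v * split_poly^`() = 1.
Hypothesis (sE : s = 'X + split_poly * psi)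
  (fsE : split_poly \Po s = split_poly ^+ N * phi).

Let A0 := fa_cst algA 0.
Let A1 := fa_cst algA 1.

Lemma fcong_root_lift a : A a ->
  fcong A Y (fun t => split_poly.[a t]) (fun=> 0) ->
  fcong A Y (fun t => s.[a t]) a.
Proof.
move=> Aa [e Ae faE]; exists (fun t => e t * psi.[a t]) => [|t].
  by falg algA.
by rewrite sE hornerD hornerX hornerM faE; ring.
Qed.

(** C s(a) is a zero of the form up to f(a)^N, since the form at (C, C s) is
    C^d f(s) = C^d f^N phi; and f(a) is divisible by Y. *)
Lemma fcong_lifted c m a : A c -> A m -> A a ->
  fcong A m (fun t => Y t ^+ N) (fun=> 0) ->
  fcong A Y (fun t => split_poly.[a t]) (fun=> 0) ->
  fcong A m (fun t => split_form (c t) (c t * s.[a t])) (fun=> 0).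
Proof.
move=> Ac Am Aa [e' Ae' YE] [e Ae faE].
exists (fun t => c t ^+ size rs * (e' t * e t ^+ N * phi.[a t])) => [|t].
  by falg algA.
rewrite split_formM -horner_comp fsE hornerM horner_exp faE add0r exprMn YE.
ring.
Qed.

(** Uniqueness in the lemma of Hensel. The roots of f are simple and C = 1
    modulo Y, so the divided difference is a unit 1 - eta modulo Y with eta
    divisible by Y; the geometric series for its inverse stops at eta^N, which
    is divisible by m. *)
Lemma fcong_simple_root c m a b : A c -> A m -> A a -> A b ->
  fcong A m (fun t => Y t ^+ N) (fun=> 0) ->
  fcong A Y c (fun=> 1) -> fcong A Y b a ->
  fcong A Y (fun t => split_poly.[a t]) (fun=> 0) ->
  fcong A m (fun t => split_form (c t) (a t)) (fun=> 0) ->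
  fcong A m (fun t => split_form (c t) (b t)) (fun=> 0) ->
  fcong A m b a.
Proof.
move=> Ac Am Aa Ab [g Ag YE] cY ba [e Ae faE] [ga Aga aE] [gb Agb bE].
pose Q t := slope rs (c t) (a t) (b t).
have AQd : A (fun t => slope rs 1 (a t) (a t)).
  have -> : (fun t => slope rs 1 (a t) (a t)) =
            (fun t => (\prod_(q <- rs) ('X - q%:P))^`().[a t]).
    by apply: functional_extensionality => t; rewrite slope_diag.
  exact: (fa_horner algA).
have [h Ah QE] := fcong_slope rs AY Aa cY ba.
have AQ : A Q.
  apply: (fa_eq (f := fun t => slope rs 1 (a t) (a t) + Y t * h t)) => //.
    by falg algA.
  by move=> t; rewrite /Q QE.
(* Y eta is the deviation from 1 of v(a) times the divided difference. *)
pose eta t := u.[a t] * e t - v.[a t] * lc * h t.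
have Aeta : A eta by rewrite /eta; falg algA.
have etaE t : v.[a t] * lc * Q t = 1 - Y t * eta t.
  rewrite /Q QE slope_diag /eta.
  have := congr1 (horner^~ (a t)) bezout.
  rewrite /= hornerD !hornerM hornerC faE derivZ hornerZ => <-.
  ring.
have dE t : (b t - a t) * (1 - Y t * eta t) =
            v.[a t] * (split_form (c t) (b t) - split_form (c t) (a t)).
  by rewrite -etaE /split_form -mulrBr -slopeE /Q; ring.
pose W t := (b t - a t) * g t * eta t ^+ N +
   (\sum_(i < N) (Y t * eta t) ^+ i) * (v.[a t] * (gb t - ga t)).
exists W => [|t]; rewrite /W {W}.
  by falg algA; apply: (fa_sum algA) => i; falg algA.
have geo : (1 - Y t * eta t) * (\sum_(i < N) (Y t * eta t) ^+ i)
           = 1 - (Y t * eta t) ^+ N.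
  by rewrite -[in RHS](opprK (1 - _)) opprB subrX1; ring.
have : b t - a t = (b t - a t) * (Y t * eta t) ^+ N +
  (b t - a t) * (1 - Y t * eta t) * (\sum_(i < N) (Y t * eta t) ^+ i).
  by rewrite -mulrA geo; ring.
rewrite dE bE aE !exprMn YE => hd; apply: (addIr (- a t)); rewrite [LHS]hd.
ring.
Qed.

(** The fibre product of the two torsors in coordinates. The functions z' = c2
    s(z) + m2 w are those congruent modulo m2 to the lifted root c2 s(z),
    which makes the second equation solvable for x'; and z is congruent to c1
    s(z') modulo m1 by the uniqueness of lifted roots, which gives w'. The two
    formulas are exchanged by the symmetry between the torsors. *)
Lemma danielewski_shift :
  exists x' w', [/\ A x', A w',
    forall t, x' t * m2 t = split_form (c2 t) (c2 t * s.[z t] + m2 t * w t)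
  & forall t, z t = c1 t * s.[c2 t * s.[z t] + m2 t * w t] + m1 t * w' t].
Proof.
pose z' t := c2 t * s.[z t] + m2 t * w t.
have Az' : A z' by rewrite /z'; falg algA.
have Asz : A (fun t => s.[z t]) by falg algA.
have Asz' : A (fun t => s.[z' t]) by falg algA.
have [e Ae m1E] := Ym1.
have m1z : fcong A m1 (fun t => split_form (c1 t) (z t)) (fun=> 0).
  by exists x => // t; rewrite add0r -eq1 mulrC.
have fz0 : fcong A Y (fun t => split_poly.[z t]) (fun=> 0).
  have [b Ab zE] := fcong_split_form AY A1 Az c1Y (fcong_refl algA Y z).
  exists (fun t => x t * e t - b t) => [|t]; first by falg algA.
  have := zE t; rewrite split_form1 -eq1 m1E => /(canLR (addrK _)) <- /=; ring.
have szz : fcong A Y (fun t => s.[z t]) z by exact: fcong_root_lift.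
have z'z : fcong A Y z' z.
  have [b Ab h1] := szz; have [b' Ab' h2] := c2Y; have [b2 Ab2 h3] := Ym2.
  exists (fun t => b t + b' t * s.[z t] + b2 t * w t) => [|t]; first by falg
    algA.
  by rewrite /z' h2 h3 mulrDl mul1r h1 /=; ring.
have fz'0 : fcong A Y (fun t => split_poly.[z' t]) (fun=> 0).
  by apply: (fcong_trans algA) fz0; exact: fcong_horner.
have [x' Ax' x'E] : fcong A m2 (fun t => split_form (c2 t) (z' t)) (fun=> 0).
  apply: (fcong_trans algA) (fcong_lifted Ac2 Am2 Az m2Y fz0).
  apply: (fcong_split_form Am2 Ac2); first by falg algA.
    exact: fcong_refl.
  by exists w.
have sz'z : fcong A Y (fun t => c1 t * s.[z' t]) z.
  have h := fcong_trans algA (fcong_root_lift Az' fz'0) z'z.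
  have [b Ab bE] := fcong_mul algA AY A1 Az c1Y h.
  by exists b => // t; rewrite bE mul1r.
have Ab : A (fun t => c1 t * s.[z' t]) by falg algA.
have := fcong_simple_root Ac1 Am1 Az Ab m1Y c1Y sz'z fz0 m1z
  (fcong_lifted Ac1 Am1 Az' m1Y fz'0).
move/(fcong_sym algA) => [w' Aw' wE].
by exists x', w'; split=> // t; rewrite mulrC -/(z' t) x'E add0r.
Qed.

End SplitForm.

(** * Coordinates, regular functions and density of Y != 0 *)

Section Coordinates.
Context {K : fieldType} {m : nat}.
Implicit Types p : 'rV[K]_(1 + m + 1).

Definition ix : 'I_(1 + m + 1) := lshift 1 (lshift m ord0).
Definition iy (i : 'I_m) : 'I_(1 + m + 1) := lshift 1 (rshift 1 i).
Definition iz : 'I_(1 + m + 1) := rshift (1 + m) ord0.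

Definition px p := p ord0 ix.
Definition py p i := p ord0 (iy i).
Definition pz p := p ord0 iz.

Definition mkp (x : K) (y : 'I_m -> K) (z : K) : 'rV[K]_(1 + m + 1) :=
  row_mx (row_mx (const_mx x) (\row_i y i)) (const_mx z).

Lemma px_mkp x y z : px (mkp x y z) = x.
Proof. by rewrite /px /mkp /ix !row_mxEl mxE. Qed.

Lemma py_mkp x y z : py (mkp x y z) = y.
Proof.
by apply: functional_extensionality => i; rewrite /py row_mxEl row_mxEr mxE.
Qed.

Lemma pz_mkp x y z : pz (mkp x y z) = z.
Proof. by rewrite /pz row_mxEr mxE. Qed.

Definition mkpE := (px_mkp, py_mkp, pz_mkp).

Lemma coord_ind (P : 'I_(1 + m + 1) -> Prop) :
  P ix -> (forall i, P (iy i)) -> P iz -> forall j, P j.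
Proof.
move=> Px Py Pz j; rewrite -(splitK j); case: split => k /=; last first.
  by rewrite (ord1 k).
rewrite -(splitK k); case: split => i /=; last exact: Py.
by rewrite (ord1 i).
Qed.

Lemma mkp_eta p : mkp (px p) (py p) (pz p) = p.
Proof.
apply/rowP; apply: coord_ind => [|i|].
- exact: px_mkp.
- by have := py_mkp (px p) (py p) (pz p); move/(congr1 (fun g => g i)).
- exact: pz_mkp.
Qed.

Lemma mkp_inj p q : px p = px q -> py p =1 py q -> pz p = pz q -> p = q.
Proof.
move=> hx /functional_extensionality hy hz.
by rewrite -(mkp_eta p) hx hy hz mkp_eta.
Qed.

Lemma fa_mkp (T : Type) (A : (T -> K) -> Prop) (x : T -> K)
    (y : T -> 'I_m -> K) (z : T -> K) :
  function_algebra A -> A x -> (forall i, A (y^~ i)) -> A z ->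
  forall j, A (fun t => mkp (x t) (y t) (z t) ord0 j).
Proof.
move=> algA Ax Ay Az; apply: coord_ind => [|i|].
- by apply: (fa_eq Ax) => t; have := px_mkp (x t) (y t) (z t).
- apply: (fa_eq (Ay i)) => t.
  by have /(congr1 (fun g => g i)) := py_mkp (x t) (y t) (z t).
- by apply: (fa_eq Az) => t; have := pz_mkp (x t) (y t) (z t).
Qed.

Definition yprod p := \prod_i py p i.

Lemma yprod_neq0 p : (yprod p != 0) = [forall i, py p i != 0].
Proof.
apply/idP/forallP => [/prodf_neq0 h i|h]; first exact: h.
by apply/prodf_neq0 => i _; exact: h.
Qed.

End Coordinates.

Definition univariate (K : comNzRingType) (f : K -> K) : Prop :=
  exists q : {poly K}, forall t, f t = q.[t].

Lemma univariate_algebra (K : comNzRingType) :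
  function_algebra (@univariate K).
Proof.
split=> [c|f g [p fE] [q gE]|f g [p fE] [q gE]].
- by exists c%:P => t; rewrite hornerC.
- by exists (p + q) => t; rewrite hornerD fE gE.
- by exists (p * q) => t; rewrite hornerM fE gE.
Qed.

Lemma univariate_id (K : comNzRingType) : univariate (fun t : K => t).
Proof. by exists 'X => t; rewrite hornerX. Qed.

Section Regular.
Context {K : fieldType} {n : nat} (X : {pred 'rV[K]_n}).

Definition regfun (h : points X -> K) : Prop :=
  exists P : {mpoly K[n]}, forall u, h u = P.@[val u ord0].

Lemma regfun_algebra : function_algebra regfun.
Proof.
split=> [c|f g [p fE] [q gE]|f g [p fE] [q gE]].
- by exists c%:MP => t; rewrite mevalC.
- by exists (p + q) => t; rewrite mevalD fE gE.
- by exists (p * q) => t; rewrite mevalM fE gE.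
Qed.

Lemma regfun_coord j : regfun (fun u => val u ord0 j).
Proof. by exists 'X_j => u; rewrite mevalXU. Qed.

Lemma regularP p (Y : {pred 'rV[K]_p}) (phi : points X -> points Y) :
  regular phi <-> forall j, regfun (fun u => val (phi u) ord0 j).
Proof.
split=> [[P PE] j|/fin_all_exists[P PE]]; first by exists (P j) => u.
by exists P => u j.
Qed.

End Regular.

Lemma regfun_comp (K : fieldType) n p (X : {pred 'rV[K]_n})
    (Y : {pred 'rV[K]_p}) (phi : points X -> points Y) h :
  regular phi -> regfun h -> regfun (h \o phi).
Proof.
move=> /regularP rphi [P hE].
apply: (fa_eq (f := fun u => P.@[val (phi u) ord0])) => [|u].
  by apply: (fa_meval (regfun_algebra X)).
by rewrite /= hE.
Qed.

Lemma regular_comp (K : fieldType) n p q (X : {pred 'rV[K]_n})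
    (Y : {pred 'rV[K]_p}) (Z : {pred 'rV[K]_q})
    (phi : points X -> points Y) (psi : points Y -> points Z) :
  regular phi -> regular psi -> regular (psi \o phi).
Proof.
move=> rphi /regularP rpsi; apply/regularP => j.
exact: (regfun_comp rphi (rpsi j)).
Qed.

Section DanielewskiVarieties.
Context (K : closedFieldType) (m : nat) (lc : K) (rs : seq K).

(** The torsor attached to (M, C) over the affine space with multiplied
    divisor; the coefficient lc and the roots rs describe the polynomial f. *)
Definition danielewski_of (M C : {mpoly K[m]}) : {pred 'rV[K]_(1 + m + 1)} :=
  [pred p | px p * M.@[py p] == split_form lc rs C.@[py p] (pz p)].

(** Weaker than regularity: it is stable under composition with automorphisms
    that are given by polynomials only on [D]. *)
Definition along_curves (D : {pred 'rV[K]_(1 + m + 1)})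
    (h : 'rV[K]_(1 + m + 1) -> K) : Prop :=
  forall g : K -> 'rV[K]_(1 + m + 1),
    (forall j, univariate (fun t => g t ord0 j)) -> (forall t, g t \in D) ->
    univariate (h \o g).

Lemma along_curves_algebra D : function_algebra (along_curves D).
Proof.
have UA := univariate_algebra K.
split=> [c|f g Uf Ug|f g Uf Ug] h hU hD; first exact: (fa_cst UA).
  exact: (fa_add UA (Uf h hU hD) (Ug h hU hD)).
exact: (fa_mul UA (Uf h hU hD) (Ug h hU hD)).
Qed.

Lemma along_curves_coord D j : along_curves D (fun p => p ord0 j).
Proof. by move=> g gU _; exact: gU. Qed.

Lemma along_curves_meval D (P : {mpoly K[1 + m + 1]}) :
  along_curves D (fun p => P.@[p ord0]).
Proof.
apply: (fa_meval (along_curves_algebra D)) => j; exact: along_curves_coord.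
Qed.

(** Identities between polynomials are proved off a finite set of parameters,
    the zeros of [e]. *)
Lemma poly_eq0_cofinite (p e : {poly K}) : e != 0 ->
  (forall t, e.[t] != 0 -> p.[t] = 0) -> p = 0.
Proof.
move=> e0 h; apply/eqP; apply: contraT => p0.
have /closed_nonrootP[t] : p * e != 0 by rewrite mulf_neq0.
by rewrite rootM negb_or => /andP[] /[swap] et; rewrite rootE h ?eqxx // -rootE.
Qed.

Lemma poly_eq_cofinite (p q e : {poly K}) : e != 0 ->
  (forall t, e.[t] != 0 -> p.[t] = q.[t]) -> p = q.
Proof.
move=> e0 h; apply/eqP; rewrite -subr_eq0; apply/eqP.
by apply: (poly_eq0_cofinite e0) => t et; rewrite hornerD hornerN h ?subrr.
Qed.

Context (M C : {mpoly K[m]}).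
Hypotheses (lc0 : lc != 0) (rs_uniq : uniq rs).
Hypothesis M_yprod : forall y, (M.@[y] == 0) = (\prod_i y i == 0).
Hypothesis C_yprod : forall y, \prod_i y i = 0 -> C.@[y] = 1.

(** At a point with Y = 0 the coordinate z is a root a of f and M vanishes, so
    the point lies on the curve y + t, z = a C + x0 M with the value of x that
    the equation dictates; the constant x0 is adjusted to meet the point at t
    = 0. Along this curve Y is not identically zero. *)
Lemma curve_through_point p : p \in danielewski_of M C ->
  exists g : K -> 'rV[K]_(1 + m + 1),
    [/\ forall j, univariate (fun t => g t ord0 j), forall t, g t \in
      danielewski_of M C,
        g 0 = p & exists2 e : {poly K}, e != 0 &
          forall t, e.[t] != 0 -> yprod (g t) != 0].
Proof.
move=> pD; have Uid := univariate_id K; have UA := univariate_algebra K.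
have [Y0|Y0] := eqVneq (yprod p) 0; last first.
  exists (fun=> p); split=> //; first by move=> j; apply: (fa_cst UA).
  by exists 1; rewrite ?oner_eq0.
have Mp0 : M.@[py p] = 0 by apply/eqP; rewrite M_yprod; apply/eqP.
have Cp1 : C.@[py p] = 1 by exact: C_yprod.
have [a ars zpE] : exists2 a, a \in rs & pz p = a.
  move: pD; rewrite inE Mp0 mulr0 Cp1 eq_sym mulf_eq0 (negPf lc0) /=.
  rewrite prodf_seq_eq0 => /hasP[a ars /=]; rewrite mulr1 subr_eq0 => /eqP.
  by exists a.
have [x0 x0E] : exists x0, x0 * (lc * \prod_(b <- rem a rs) (a - b)) = px p.
  exists (px p / (lc * \prod_(b <- rem a rs) (a - b))).
  rewrite mulfVK // mulf_neq0 // prodf_seq_neq0; apply/allP => b /=.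
  by rewrite mem_rem_uniq // !inE subr_eq0 eq_sym => /andP[].
pose y t i := py p i + t.
have Uy i : univariate (y^~ i) by rewrite /y; falg UA.
have UM : univariate (fun t => M.@[y t]) by apply: (fa_meval UA).
have UC : univariate (fun t => C.@[y t]) by apply: (fa_meval UA).
have y0E : y 0 = py p.
  by apply: functional_extensionality => i; rewrite /y addr0.
(* The factor of the root a in the equation is x0 M, so M cancels. *)
pose x t := x0 * lc * \prod_(b <- rem a rs)
  (a * C.@[y t] + x0 * M.@[y t] - b * C.@[y t]).
exists (fun t => mkp (x t) (y t) (a * C.@[y t] + x0 * M.@[y t])); split.
- apply: (fa_mkp UA) => //; last by falg UA.
  by rewrite /x; falg UA; apply: (fa_prod UA) => b; falg UA.
- move=> t; rewrite inE !mkpE /split_form (big_rem a) //= /x.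
  by apply/eqP; ring.
- rewrite y0E Mp0 Cp1 mulr0 addr0 mulr1 -zpE -[RHS]mkp_eta; congr mkp.
  rewrite /x y0E Mp0 Cp1 -x0E mulrA; congr (_ * _).
  by apply: eq_bigr => b _; rewrite mulr1 mulr0 addr0 mulr1.
- exists (\prod_(i < m) ('X + (py p i)%:P)).
    by apply/prodf_neq0 => i _; rewrite -size_poly_gt0 size_XaddC.
  move=> t; rewrite horner_prod /yprod mkpE.
  rewrite (eq_bigr (y t)) // => i _.
  by rewrite hornerD hornerX hornerC addrC.
Qed.

Lemma danielewski_of_dense h : along_curves (danielewski_of M C) h ->
  (forall p, p \in danielewski_of M C -> yprod p != 0 -> h p = 0) ->
  forall p, p \in danielewski_of M C -> h p = 0.
Proof.
move=> hU h0 p pD; have [g [gU gD <- [e e0 eY]]] := curve_through_point pD.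
have [q qE] := hU g gU gD.
have q0 : q = 0.
  apply: (poly_eq0_cofinite e0) => t et; rewrite -qE /= h0 //; exact: eY.
by have := qE 0; rewrite q0 horner0.
Qed.

Definition danielewski_cyl := product (danielewski_of M C) (full_space K 1).

Definition cbase (u : points danielewski_cyl) := lsubmx (val u).
Definition cheight (u : points danielewski_cyl) := val u ord0 (rshift _ ord0).

Lemma cbase_in u : cbase u \in danielewski_of M C.
Proof. by have /andP[] := valP u. Qed.

Lemma cbase_coord u j : cbase u ord0 j = val u ord0 (lshift 1 j).
Proof. by rewrite mxE. Qed.

Lemma mkX_in p w : p \in danielewski_of M C -> row_mx p (const_mx w) \in
  danielewski_cyl.
Proof. by move=> pD; rewrite inE /= row_mxKl pD. Qed.

Definition mkX p w (pD : p \in danielewski_of M C) : points danielewski_cyl :=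
  exist (fun v => v \in danielewski_cyl) _ (mkX_in w pD).

Lemma cbase_mkX p w (pD : p \in danielewski_of M C) : cbase (mkX w pD) = p.
Proof. by rewrite /cbase /= row_mxKl. Qed.

Lemma cheight_mkX p w (pD : p \in danielewski_of M C) : cheight (mkX w pD) = w.
Proof. by rewrite /cheight /= row_mxEr mxE. Qed.

Lemma cyl_points_eq u v : cbase u = cbase v -> cheight u = cheight v -> u = v.
Proof.
move=> hp hw; apply: val_inj; apply/rowP => j.
rewrite -(splitK j); case: split => k /=; first by rewrite -!cbase_coord hp.
by rewrite (ord1 k).
Qed.

Lemma regfun_cbase j : regfun (fun u => cbase u ord0 j).
Proof.
by apply: (fa_eq (regfun_coord _ (lshift 1 j))) => u; rewrite cbase_coord.
Qed.

Lemma regfun_cheight : regfun cheight. Proof. exact: regfun_coord. Qed.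

Lemma danielewski_cyl_dense (h : points danielewski_cyl -> K) : regfun h ->
  (forall u, yprod (cbase u) != 0 -> h u = 0) -> forall u, h u = 0.
Proof.
move=> [P hE] h0 u.
have UA := univariate_algebra K.
pose k p := P.@[row_mx p (const_mx (cheight u) : 'rV_1) ord0].
have kE p (pD : p \in danielewski_of M C) : k p = h (mkX (cheight u) pD) by
  rewrite hE.
have <- : mkX (cheight u) (cbase_in u) = u.
  by apply: cyl_points_eq; rewrite ?cbase_mkX ?cheight_mkX.
rewrite -kE; apply: danielewski_of_dense (cbase_in u) => [g gU _|p pD pY].
  apply: (fa_meval UA) => j; rewrite -(splitK j); case: split => i /=.
    by apply: (fa_eq (gU i)) => t; rewrite row_mxEl.
  by apply: (fa_eq (fa_cst UA (cheight u))) => t; rewrite row_mxEr mxE.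
by rewrite kE h0 // cbase_mkX.
Qed.

End DanielewskiVarieties.

(** * Cylinders over Danielewski varieties *)

Section Admissible.
Context (K : fieldType) (m : nat).
Implicit Types M C : {mpoly K[m]}.

Definition ymon : {mpoly K[m]} := \prod_i 'X_i.

(** M has the zeros of Y, in the scheme-theoretic form needed for congruences,
    and C is 1 on them. The exponent N bounds the multiplicities, so that one
    lift of the roots serves for several pairs. *)
Record admissible N M C : Prop := Admissible {
  adm_lower : exists e, M = ymon * e;
  adm_upper : exists e, ymon ^+ N = M * e;
  adm_unit : exists r, C = 1 + ymon * r
}.

Lemma ymonE (y : 'I_m -> K) : ymon.@[y] = \prod_i y i.
Proof. by rewrite rmorph_prod; apply: eq_bigr => i _; rewrite /= mevalXU. Qed.

Lemma admissible_eq0 N M C (y : 'I_m -> K) :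
  admissible N M C -> (M.@[y] == 0) = (\prod_i y i == 0).
Proof.
move=> [[e ME] [e' YE] _]; rewrite -ymonE; apply/eqP/eqP => [M0|Y0].
  have /eqP := congr1 (meval y) YE.
  by rewrite mevalM M0 mul0r rmorphXn /= expf_eq0 => /andP[_ /eqP].
by rewrite ME mevalM Y0 mul0r.
Qed.

Lemma admissible_eq1 N M C (y : 'I_m -> K) :
  admissible N M C -> \prod_i y i = 0 -> C.@[y] = 1.
Proof.
by move=> [_ _ [r ->]] Y0; rewrite mevalD mevalM meval1 ymonE Y0 mul0r addr0.
Qed.

Lemma meval_algebra (T : Type) (A : (T -> K) -> Prop) (y : T -> 'I_m -> K) :
  function_algebra A -> (forall i, A (y^~ i)) ->
  forall P, A (fun t => P.@[y t]).
Proof. by move=> algA Ay P; exact: (fa_meval algA). Qed.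

Lemma admissible_fcong N M C (T : Type) (A : (T -> K) -> Prop) y :
  function_algebra A -> (forall i, A (y^~ i)) -> admissible N M C ->
  [/\ fcong A (fun t => ymon.@[y t]) (fun t => M.@[y t]) (fun=> 0),
      fcong A (fun t => M.@[y t]) (fun t => ymon.@[y t] ^+ N) (fun=> 0)
    & fcong A (fun t => ymon.@[y t]) (fun t => C.@[y t]) (fun=> 1)].
Proof.
move=> algA Ay [[e ME] [e' YE] [r meval_unit_coef]].
split; [exists (fun t => e.@[y t]) | exists (fun t => e'.@[y t])
       | exists (fun t => r.@[y t])];
  try exact: meval_algebra; move=> t.
- by rewrite ME mevalM add0r.
- by rewrite -rmorphXn YE /= mevalM add0r.
- by rewrite meval_unit_coef mevalD mevalM meval1.
Qed.

End Admissible.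

Lemma split_poly_bezout (K : fieldType) (lc : K) rs : lc != 0 -> uniq rs ->
  exists u v,
    u * split_poly lc rs + v * (split_poly lc rs)^`() = 1.
Proof.
move=> lc0 urs.
have : coprimep (split_poly lc rs) (split_poly lc rs)^`().
  rewrite derivZ /split_poly coprimepZl // coprimepZr //.
  by have := separable_prod_XsubC rs; rewrite urs unlock.
move=> /Bezout_eq1_coprimepP[[u v] /= h].
by exists u, v.
Qed.

Section Isomorphism.
Context (K : closedFieldType) (m : nat) (lc : K) (rs : seq K) (N : nat).
Hypotheses (lc0 : lc != 0) (rs_uniq : uniq rs).

Section HalfMap.
Context (s phi psi u v : {poly K}).
Let f := split_poly lc rs.
Hypothesis bezout : u * f + v * f^`() = 1.
Hypothesis (sE : s = 'X + f * psi) (fsE : f \Po s = f ^+ N * phi).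

(** The relation between (z, w) and (z', w'). It is symmetric in the two
    cylinders, hence the same construction yields both directions of the
    isomorphism. *)
Definition shift_spec (M1 C1 M2 C2 : {mpoly K[m]}) (a : points (danielewski_cyl
  lc rs M1 C1))
    (b : points (danielewski_cyl lc rs M2 C2)) : Prop :=
  [/\ py (cbase a) = py (cbase b),
      pz (cbase b) = C2.@[py (cbase a)] * s.[pz (cbase a)] + M2.@[py (cbase a)]
        * cheight a
    & pz (cbase a) = C1.@[py (cbase a)] * s.[pz (cbase b)] + M1.@[py (cbase a)]
      * cheight b].

Lemma shift_exists M1 C1 M2 C2 :
  admissible N M1 C1 -> admissible N M2 C2 ->
  exists g : points (danielewski_cyl lc rs M1 C1) -> points (danielewski_cyl lc
    rs M2 C2),
    regular g /\ forall a, shift_spec a (g a).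
Proof.
move=> adm1 adm2; pose X := danielewski_cyl lc rs M1 C1.
have RA := regfun_algebra X; have Rp := @regfun_cbase K m lc rs M1 C1.
have Rw : regfun (@cheight K m lc rs M1 C1) by exact: regfun_cheight.
pose y a := py (@cbase K m lc rs M1 C1 a).
have Ry i : regfun (y^~ i) by exact: Rp.
have RM P : regfun (fun a => P.@[y a]) by exact: meval_algebra.
have [h1 h2 h3] := admissible_fcong RA Ry adm1.
have [k1 k2 k3] := admissible_fcong RA Ry adm2.
have eq1 (a : points X) :
    px (cbase a) * M1.@[y a] = split_form lc rs C1.@[y a] (pz (cbase a)).
  by apply/eqP; exact: cbase_in.
have [x' [w' [Rx' Rw' x'E w'E]]] := danielewski_shift RA (Rp ix) (Rp iz) Rw
  (RM M1) (RM C1) (RM M2) (RM C2) (RM _) h1 k1 h2 k2 h3 k3 eq1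
  bezout sE fsE.
pose z' a := C2.@[y a] * s.[pz (cbase a)] + M2.@[y a] * cheight a.
have Rz' : regfun z'.
  by rewrite /z'; falg RA; first [exact: RM | exact: (Rp iz)].
have D2 a : mkp (x' a) (y a) (z' a) \in danielewski_of lc rs M2 C2.
  by rewrite inE !mkpE x'E.
exists (fun a => mkX (w' a) (D2 a)); split; last first.
  by move=> a; split; rewrite ?cbase_mkX ?cheight_mkX ?mkpE //; exact: w'E.
apply/regularP => j; rewrite -(splitK j); case: split => i /=.
  apply: (fa_eq (fa_mkp RA Rx' Ry Rz' i)) => a.
  by rewrite /= row_mxEl.
by apply: (fa_eq Rw') => a; rewrite row_mxEr mxE.
Qed.

(** Where Y is not 0, the equations of the shift determine w and the equation
    of the variety determines x; the rest follows by density. *)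
Lemma shift_cancel M1 C1 M2 C2 :
  admissible N M1 C1 -> admissible N M2 C2 ->
  forall (g : points (danielewski_cyl lc rs M1 C1) -> points (danielewski_cyl
    lc rs M2 C2))
         (h : points (danielewski_cyl lc rs M2 C2) -> points (danielewski_cyl
           lc rs M1 C1)),
  regular g -> regular h ->
  (forall a, shift_spec a (g a)) -> (forall b, shift_spec b (h b)) ->
  cancel g h.
Proof.
move=> adm1 adm2 g h rg rh gE hE a0.
have D j : regfun (fun a => val (h (g a)) ord0 j - val a ord0 j).
  have RA := regfun_algebra (danielewski_cyl lc rs M1 C1).
  apply: (fa_sub RA); last exact: regfun_coord.
  by have /regularP := regular_comp rg rh; apply.
apply: val_inj; apply/rowP => j; apply/eqP; rewrite -subr_eq0; apply/eqP.
move: a0; apply: danielewski_cyl_dense (D j) _ => //.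
- by move=> y; exact: admissible_eq0 adm1.
- by move=> y; exact: admissible_eq1 adm1.
move=> a aY; apply/eqP; rewrite subr_eq0; apply/eqP.
have [yE z'E zE] := gE a; have [y'E z''E z'E'] := hE (g a).
have M10 : M1.@[py (cbase a)] != 0 by rewrite (admissible_eq0 _ adm1).
have M20 : M2.@[py (cbase a)] != 0 by rewrite (admissible_eq0 _ adm2).
rewrite -yE in y'E z''E z'E'.
suff -> : h (g a) = a by [].
have zEE : pz (cbase (h (g a))) = pz (cbase a) by rewrite z''E -zE.
apply: cyl_points_eq; last first.
  by move: z'E'; rewrite z'E zEE => /addrI/(mulfI M20).
apply: mkp_inj => //; last by rewrite -y'E.
apply: (mulIf M10).
have /eqP := cbase_in a; have /eqP := cbase_in (h (g a)).
by rewrite -y'E zEE => -> ->.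
Qed.

End HalfMap.

Theorem danielewski_cyl_iso (M1 C1 M2 C2 : {mpoly K[m]}) :
  admissible N M1 C1 -> admissible N M2 C2 ->
  exists (g : points (danielewski_cyl lc rs M1 C1) -> points (danielewski_cyl
    lc rs M2 C2)) h,
    [/\ regular g, regular h, cancel g h & cancel h g].
Proof.
move=> adm1 adm2; have [u [v bezout]] := split_poly_bezout lc0 rs_uniq.
have [s [phi [psi [sE fsE]]]] := root_lift N bezout.
have [g [rg gE]] := shift_exists bezout sE fsE adm1 adm2.
have [h [rh hE]] := shift_exists bezout sE fsE adm2 adm1.
exists g, h; split=> //; first exact: shift_cancel gE hE.
exact: shift_cancel hE gE.
Qed.

End Isomorphism.

(** * Limits of rational functions at the origin *)

Section AlgebraicLimits.
Context {K : closedFieldType}.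
Implicit Types (f g : K -> K) (l : K).

(** Finitely many nonzero exceptions are allowed, so that zeros of
    denominators need no separate treatment. *)
Definition near0 (P : K -> Prop) : Prop :=
  exists2 e : {poly K}, e.[0] != 0 & forall t, t != 0 -> e.[t] != 0 -> P t.

Lemma near0_and P Q : near0 P -> near0 Q -> near0 (fun t => P t /\ Q t).
Proof.
move=> [e e0 hP] [e' e0' hQ]; exists (e * e'); first by rewrite hornerM
  mulf_neq0.
move=> t t0; rewrite hornerM mulf_eq0 negb_or => /andP[et et'].
by split; [exact: hP | exact: hQ].
Qed.

Lemma near0_imp (P Q : K -> Prop) :
  (forall t, t != 0 -> P t -> Q t) -> near0 P -> near0 Q.
Proof. by move=> PQ [e e0 hP]; exists e => // t t0 et; apply/PQ/hP. Qed.

Lemma near0_all (P : K -> Prop) : (forall t, t != 0 -> P t) -> near0 P.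
Proof.
by move=> h; exists 1 => [|t t0 _]; [rewrite hornerC oner_eq0 | exact: h].
Qed.

Lemma near0_eq0 (p : {poly K}) : near0 (fun t => p.[t] = 0) -> p = 0.
Proof.
move=> [e e0 h]; apply: (@poly_eq0_cofinite _ _ ('X * e)).
  rewrite mulf_neq0 ?polyX_eq0 //.
  by apply: contraNneq e0 => ->; rewrite horner0.
by move=> t; rewrite hornerM hornerX mulf_eq0 negb_or => /andP[t0 et]; exact: h.
Qed.

(** The limit at 0 of a rational function without pole there; f need only
    agree with that rational function near 0. *)
Definition tends_to f l : Prop :=
  exists u v : {poly K}, [/\ v.[0] != 0, u.[0] = l * v.[0]
    & near0 (fun t => f t * v.[t] = u.[t])].

Lemma tends_to_poly (p : {poly K}) : tends_to (fun t => p.[t]) p.[0].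
Proof.
exists p, 1; rewrite hornerC oner_eq0 mulr1; split=> //.
by apply: near0_all => t _; rewrite hornerC mulr1.
Qed.

Lemma tends_to_cst c : tends_to (fun=> c) c.
Proof.
have := tends_to_poly c%:P; rewrite hornerC.
by congr tends_to; apply: functional_extensionality => t; rewrite hornerC.
Qed.

Lemma tends_to_id : tends_to id 0.
Proof.
have := tends_to_poly 'X; rewrite hornerX.
by congr tends_to; apply: functional_extensionality => t; rewrite hornerX.
Qed.

Lemma tends_to_near f g l :
  near0 (fun t => f t = g t) -> tends_to f l -> tends_to g l.
Proof.
move=> fg [u [v [v0 uE h]]]; exists u, v; split=> //.
by apply: near0_imp (near0_and fg h) => t _ [<-].
Qed.

Lemma tends_to_add f g l l' : tends_to f l -> tends_to g l' ->
  tends_to (fun t => f t + g t) (l + l').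
Proof.
move=> [u [v [v0 uE h]]] [u' [v' [v0' uE' h']]].
exists (u * v' + u' * v), (v * v').
rewrite hornerD !hornerM uE uE' mulf_neq0 //; split=> //; first by ring.
apply: near0_imp (near0_and h h') => t _ [hu hu'].
by rewrite hornerD !hornerM -hu -hu'; ring.
Qed.

Lemma tends_to_mul f g l l' : tends_to f l -> tends_to g l' ->
  tends_to (fun t => f t * g t) (l * l').
Proof.
move=> [u [v [v0 uE h]]] [u' [v' [v0' uE' h']]].
exists (u * u'), (v * v').
rewrite !hornerM uE uE' mulf_neq0 //; split=> //; first by ring.
apply: near0_imp (near0_and h h') => t _ [hu hu'].
by rewrite !hornerM -hu -hu'; ring.
Qed.

Lemma tends_to_neq0 f l : tends_to f l -> l != 0 -> near0 (fun t => f t != 0).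
Proof.
move=> [u [v [v0 uE [e e0 h]]]] l0; exists (u * e).
  by rewrite hornerM uE !mulf_neq0.
move=> t t0; rewrite hornerM mulf_eq0 negb_or => /andP[ut et].
by apply: contraNneq ut => ft0; rewrite -h // ft0 mul0r.
Qed.

Lemma tends_to_inv f l : tends_to f l -> l != 0 ->
  tends_to (fun t => (f t)^-1) l^-1.
Proof.
move=> fl l0; have f0 := tends_to_neq0 fl l0.
have [u [v [v0 uE h]]] := fl.
exists v, u; rewrite uE mulf_neq0 // mulKf //; split=> //.
apply: near0_imp (near0_and f0 h) => t _ [ft0 <-].
by rewrite mulKf.
Qed.

Lemma tends_to_unique f l l' : tends_to f l -> tends_to f l' -> l = l'.
Proof.
move=> [u [v [v0 uE h]]] [u' [v' [v0' uE' h']]].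
have : u * v' - u' * v = 0.
  apply: near0_eq0; apply: near0_imp (near0_and h h') => t _ [hu hu'].
  by rewrite hornerD hornerN !hornerM -hu -hu'; ring.
move/(congr1 (horner^~ 0)); rewrite /= hornerD hornerN !hornerM horner0 uE uE'.
move=> /subr0_eq e; apply: (mulIf v0); apply: (mulIf v0').
by rewrite e; ring.
Qed.

Lemma tends_to_exp f l n : tends_to f l ->
  tends_to (fun t => f t ^+ n) (l ^+ n).
Proof.
move=> fl; elim: n => [|n IHn]; first exact: tends_to_cst.
rewrite exprS; apply: tends_to_near (tends_to_mul fl IHn).
by apply: near0_all => t _; rewrite exprS.
Qed.

Lemma tends_to_sum (I : Type) (r : seq I) (P : pred I) (F : I -> K -> K)
    (L : I -> K) :
  (forall i, P i -> tends_to (F i) (L i)) ->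
  tends_to (fun t => \sum_(i <- r | P i) F i t) (\sum_(i <- r | P i) L i).
Proof.
move=> FL; elim: r => [|i r IHr].
  rewrite big_nil; apply: tends_to_near (tends_to_cst 0).
  by apply: near0_all => t _; rewrite big_nil.
rewrite big_cons; case Pi: (P i).
  apply: tends_to_near (tends_to_add (FL i Pi) IHr).
  by apply: near0_all => t _; rewrite big_cons Pi.
apply: tends_to_near IHr.
by apply: near0_all => t _; rewrite big_cons Pi.
Qed.

Lemma tends_to_prod (I : Type) (r : seq I) (P : pred I) (F : I -> K -> K)
    (L : I -> K) :
  (forall i, P i -> tends_to (F i) (L i)) ->
  tends_to (fun t => \prod_(i <- r | P i) F i t) (\prod_(i <- r | P i) L i).
Proof.
move=> FL; elim: r => [|i r IHr].
  rewrite big_nil; apply: tends_to_near (tends_to_cst 1).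
  by apply: near0_all => t _; rewrite big_nil.
rewrite big_cons; case Pi: (P i).
  apply: tends_to_near (tends_to_mul (FL i Pi) IHr).
  by apply: near0_all => t _; rewrite big_cons Pi.
apply: tends_to_near IHr.
by apply: near0_all => t _; rewrite big_cons Pi.
Qed.

Lemma tends_to_meval n (P : {mpoly K[n]}) (F : K -> 'I_n -> K) L :
  (forall i, tends_to (F^~ i) (L i)) -> tends_to (fun t => P.@[F t]) P.@[L].
Proof.
move=> FL; rewrite mevalE.
apply: (@tends_to_near
  (fun t => \sum_(k <- msupp P) P@_k * \prod_i F t i ^+ k i)).
  by apply: near0_all => t _; rewrite mevalE.
apply: tends_to_sum => k _; apply: tends_to_mul; first exact: tends_to_cst.
by apply: tends_to_prod => i _; exact: tends_to_exp.
Qed.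

Lemma tends_to_split_form lc rs c z lc' lz : tends_to c lc' -> tends_to z lz ->
  tends_to (fun t => split_form lc rs (c t) (z t)) (split_form lc rs lc' lz).
Proof.
move=> cl zl; apply: tends_to_mul; first exact: tends_to_cst.
apply: tends_to_prod => a _; apply: tends_to_add => //.
rewrite -mulNr; apply: (@tends_to_near (fun t => - a * c t)).
  by apply: near0_all => t _; rewrite mulNr.
by apply: tends_to_mul => //; exact: tends_to_cst.
Qed.

Lemma tends_to_pow (n : int) : 0 <= n ->
  tends_to (fun t => t ^ n) (if n == 0 then 1 else 0).
Proof.
case: n => // -[|n] _ //=; first exact: tends_to_cst.
by have := tends_to_exp n.+1 tends_to_id; rewrite expr0n.
Qed.

Section Weights.
Context (n : nat) (om : 'I_n -> int).

Definition mweight (k : 'X_{1..n}) : int := \sum_i om i * (k i)%:Z.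

(** When w is the least weight of S, this part governs the behaviour of S
    along a curve that is rescaled with these weights. *)
Definition initial_form (w : int) (S : {mpoly K[n]}) : {mpoly K[n]} :=
  \sum_(k <- msupp S | mweight k == w) S@_k *: 'X_[k].

Lemma weighted_monomial (t : K) (v : 'I_n -> K) (k : 'X_{1..n}) :
  t != 0 ->
  \prod_i v i ^+ k i =
  t ^ mweight k * \prod_i (t ^ (- om i) * v i) ^+ k i.
Proof.
move=> t0; rewrite /mweight.
have -> : t ^ (\sum_i om i * (k i)%:Z) = \prod_i (t ^ om i) ^+ k i.
  elim/big_rec2: _ => [|i y z _ <-]; first by [].
  by rewrite expfzDr // -exprz_exp.
rewrite -big_split /=; apply: eq_bigr => i _; rewrite -exprMn mulrA -expfzDr //.
by rewrite subrr mul1r.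
Qed.

Lemma tends_to_weighted (S : {mpoly K[n]}) w (v : K -> 'I_n -> K) V :
  (forall i, tends_to (fun t => t ^ (- om i) * v t i) (V i)) ->
  (forall k, k \in msupp S -> w <= mweight k) ->
  tends_to (fun t => t ^ (- w) * S.@[v t]) (initial_form w S).@[V].
Proof.
move=> vV Sw.
apply: (@tends_to_near (fun t => \sum_(k <- msupp S | k \in msupp S)
    S@_k * (t ^ (mweight k - w) * \prod_i (t ^ (- om i) * v t i) ^+ k i))).
  apply: near0_all => t t0; rewrite mevalE mulr_sumr [in RHS]big_seq.
  apply: eq_bigr => k _; rewrite (weighted_monomial (v t) k t0) expfzDr //.
  ring.
have -> : (initial_form w S).@[V] = \sum_(k <- msupp S | k \in msupp S)
    S@_k * ((if mweight k - w == 0 then 1 else 0) * \prod_i V i ^+ k i).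
  rewrite -big_seq /initial_form rmorph_sum big_mkcond /=.
  apply: eq_bigr => k _; rewrite subr_eq0; case: ifP => _; last first.
    by rewrite mul0r mulr0.
  by rewrite mevalZ mevalX mul1r.
apply: tends_to_sum => k kS; apply: tends_to_mul; first exact: tends_to_cst.
apply: tends_to_mul; first by apply: tends_to_pow; rewrite subr_ge0 Sw.
by apply: tends_to_prod => i _; apply: tends_to_exp.
Qed.

End Weights.
End AlgebraicLimits.

(** * Polynomial curves and initial forms on X Y^3 = f(Z) *)

Section MpolyNonvanishing.

Lemma digits_inj n B (a b : 'I_n -> nat) :
  (forall i, (a i < B)%N) -> (forall i, (b i < B)%N) ->
  (\sum_i a i * B ^ i = \sum_i b i * B ^ i)%N -> a =1 b.
Proof.
elim: n a b => [|n IHn] a b aB bB; first by move=> _ [].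
rewrite !big_ord_recl !expn0 !muln1 => h.
have shift (c : 'I_n.+1 -> nat) :
    (\sum_(i < n) c (lift ord0 i) * B ^ (lift ord0 i) =
     (\sum_(i < n) c (lift ord0 i) * B ^ i) * B)%N.
  rewrite big_distrl /=; apply: eq_bigr => i _.
  by rewrite /bump leq0n add1n expnSr mulnA.
rewrite !shift in h.
have h0 : a ord0 = b ord0.
  have := congr1 (modn^~ B) h.
  by rewrite /= ![(_ + _ * B)%N]addnC !modnMDl !modn_small.
have B0 : (0 < B)%N by apply: leq_ltn_trans (aB ord0).
have h1 : (\sum_(i < n) a (lift ord0 i) * B ^ i =
           \sum_(i < n) b (lift ord0 i) * B ^ i)%N.
  by apply/eqP; rewrite -(eqn_pmul2r B0); apply/eqP; move: h; rewrite h0 =>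
    /addnI.
have := IHn (fun i => a (lift ord0 i)) (fun i => b (lift ord0 i))
  (fun i => aB _) (fun i => bB _) h1.
move=> h2 i; case: (unliftP ord0 i) => [j ->|-> //]; exact: h2.
Qed.

(** Substituting t^(B^i) for the i-th variable sends distinct monomials to
    distinct powers of t when B exceeds all exponents. *)
Lemma mpoly_nonvanishing (K : closedFieldType) n (P : {mpoly K[n]}) :
  P != 0 -> exists v, P.@[v] != 0.
Proof.
move=> P0; pose B := msize P.
pose e (k : 'X_{1..n}) := (\sum_i k i * B ^ i)%N.
pose q : {poly K} := \sum_(k <- msupp P) P@_k *: 'X^(e k).
have qE t : q.[t] = P.@[fun i => t ^+ (B ^ i)].
  rewrite mevalE horner_sum; apply: eq_bigr => k _.
  rewrite hornerZ hornerXn; congr (_ * _).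
  rewrite /e; elim/big_rec2: _ => [|i y z _ <-]; first by rewrite expr0.
  by rewrite exprD mulnC exprM.
have lt_B k i : k \in msupp P -> (k i < B)%N.
  move=> /msize_mdeg_lt; apply: leq_ltn_trans.
  by rewrite mdegE (bigD1 i) //= leq_addr.
have q0 : q != 0.
  have kP := mlead_supp P0; apply: contraTneq kP => q0.
  rewrite mcoeff_msupp negbK; have := congr1 (fun p : {poly K} => p`_(e (mlead
    P))) q0.
  rewrite coef0 coef_sum => <-; have kP := mlead_supp P0.
  rewrite (bigD1_seq (mlead P)) ?msupp_uniq //= coefZ coefXn eqxx mulr1.
  rewrite big_seq_cond big1 ?addr0 // => k /andP[kS knP].
  rewrite coefZ coefXn; case: eqP => [h|_]; last by rewrite mulr0.
  case/eqP: knP; apply/mnmP/(digits_inj (B := B)) => [i|i|]; try exact: lt_B.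
  by rewrite -/(e k) -h.
have /closed_nonrootP[t qt] := q0.
by exists (fun i => t ^+ (B ^ i)); rewrite -qE.
Qed.

End MpolyNonvanishing.

Section CharacteristicZero.
Context (K : closedFieldType) (charK0 : [pchar K] =i pred0).

Lemma natr_neq0 n : (n.+1)%:R != 0 :> K.
Proof. by have /pcharf0P -> := charK0. Qed.

Lemma deriv_eq0 (p : {poly K}) : p^`() = 0 -> (size p <= 1)%N.
Proof.
move=> dp; rewrite leqNgt; apply/negP => sp.
have p0 : p != 0 by rewrite -size_poly_gt0; lia.
have : p^`()`_(size p).-2 == 0 by rewrite dp coef0.
rewrite coef_deriv -mulr_natr mulf_eq0 (negPf (natr_neq0 _)) orbF.
have -> : (size p).-2.+1 = (size p).-1 by lia.
by rewrite -lead_coefE lead_coef_eq0 (negPf p0).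
Qed.

Context (lc : K) (rs : seq K).
Hypotheses (lc0 : lc != 0) (rs_uniq : uniq rs) (rs_size : (2 <= size rs)%N).
Let f := split_poly lc rs.

Lemma size_split_poly : size f = (size rs).+1.
Proof. by rewrite size_scale // size_prod_XsubC. Qed.

(** A polynomial without zeros is a constant. Differentiating x eta^3 = f(z)
    and using that f and f' are coprime shows that eta^2 divides z'; if z is
    not constant, this bounds 2 deg eta by deg z - 1, while 3 deg eta = deg f
    deg z is at least 2 deg z. *)
Lemma split_curve_constant (x eta z : {poly K}) :
  (forall t, x.[t] != 0) -> eta != 0 -> x * eta ^+ 3 = f \Po z ->
  (size x <= 1)%N /\ (size z <= 1)%N /\ (size eta <= 1)%N.
Proof.
move=> x_neq0 eta0 E.
have sx : size x = 1%N.
  apply/eqP; apply: contraT => /closed_rootP[t]; rewrite rootE.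
  by rewrite (negPf (x_neq0 t)).
have [xi xiE] : exists xi, x = xi%:P by exists x`_0; rewrite -size1_polyC ?sx.
have xi0 : xi != 0 by have := x_neq0 0; rewrite xiE hornerC.
have [u [v bz]] := split_poly_bezout lc0 rs_uniq.
have dE : x * eta ^+ 2 * (eta^`() *+ 3) = (f^`() \Po z) * z^`().
  rewrite -deriv_comp -E xiE derivM derivC mul0r add0r deriv_exp /=; ring.
have dvd : eta ^+ 2 %| z^`().
  have := congr1 (comp_poly z) bz.
  rewrite comp_polyD !comp_polyM -polyC1 comp_polyC polyC1 => bz'.
  rewrite -[z^`()]mul1r -bz' mulrDl -E -[X in _ + X]mulrA -dE.
  by apply: dvdp_add; rewrite ?exprS; apply/dvdpP;
    [exists ((u \Po z) * x * eta * z^`()) | exists ((v \Po z) * x * (eta^`() *+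
      3))];
    rewrite ?expr0; ring.
have sE := congr1 (fun p : {poly K} => (size p).-1) E.
have x0 : x != 0 by rewrite -size_poly_gt0 sx.
rewrite /= size_comp_poly size_split_poly size_mul ?expf_neq0 // in sE.
rewrite sx add1n /= size_exp in sE.
have sz : (size z <= 1)%N.
  rewrite leqNgt; apply/negP => sz.
  have dz0 : z^`() != 0 by apply: contraTneq sz => /deriv_eq0; lia.
  have z0 : z != 0 by rewrite -size_poly_gt0; lia.
  have := dvdp_leq dz0 dvd; have := lt_size_deriv z0.
  have := size_exp eta 2; move: sE.
  move: (size (eta ^+ 2)) (size z^`()) (size eta) (size z) sz (size rs) rs_size.
  move=> n1 n2 n3 n4 h1 n5 h2; nia.
rewrite sx; split=> //; split=> //.
have z1 : (size z).-1 = 0%N by lia.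
by rewrite z1 muln0 in sE; case: (size eta) sE => [|[|n]].
Qed.

(** A fibre of f is reduced unless it contains a zero of f', so all but
    finitely many fibres have deg f points. *)
Lemma split_poly_fibre : exists crit : seq K, forall c, c \notin crit ->
  exists2 s : seq K, uniq s & size s = size rs /\ forall z, z \in s -> f.[z] =
    c.
Proof.
have [sd sdE] := closed_field_poly_normal f^`().
exists [seq f.[z] | z <- sd] => c cN.
have [s sE] := closed_field_poly_normal (f - c%:P).
have szf : size (f - c%:P) = (size rs).+1.
  rewrite size_polyDl ?size_split_poly // size_polyN.
  by apply: (leq_ltn_trans (size_polyC_leq1 c)); rewrite ltnS ltnW.
have fc0 : f - c%:P != 0 by rewrite -size_poly_gt0 szf.
have l0 : lead_coef (f - c%:P) != 0 by rewrite lead_coef_eq0.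
have root_s z : (z \in s) = (f.[z] == c).
  have -> : (f.[z] == c) = root (f - c%:P) z.
    by rewrite rootE hornerD hornerN hornerC subr_eq0.
  by rewrite sE rootZ // root_prod_XsubC.
have d0 : f^`() != 0.
  apply: contraTneq rs_size => /deriv_eq0; rewrite size_split_poly; lia.
have ld0 : lead_coef f^`() != 0 by rewrite lead_coef_eq0.
exists s; last first.
  split; last by move=> z; rewrite root_s => /eqP.
  by move: szf; rewrite sE size_scale // size_prod_XsubC => -[].
rewrite -separable_prod_XsubC unlock -(coprimepZl _ _ l0) -sE.
have -> : (\prod_(z <- s) ('X - z%:P))^`() = (lead_coef (f - c%:P))^-1 *: f^`().
  apply: (scalerI l0); rewrite scalerA divff // scale1r -derivZ -sE.
  by rewrite derivB derivC subr0.
rewrite coprimepZr ?invr_neq0 //.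
apply: contraT; rewrite /coprimep => /closed_rootP[z].
rewrite root_gcd => /andP[z1 z2]; case/negP: cN; apply/mapP; exists z.
  by move: z2; rewrite sdE rootZ // root_prod_XsubC.
by apply/eqP; rewrite eq_sym -root_s -root_prod_XsubC -(rootZ _ _ l0) -sE.
Qed.

End CharacteristicZero.

Section NormalForms.
Context (K : closedFieldType) (charK0 : [pchar K] =i pred0) (m : nat).
Context (lc : K) (rs : seq K).
Hypotheses (lc0 : lc != 0) (rs_uniq : uniq rs) (rs_size : (2 <= size rs)%N).
Let f := split_poly lc rs.

(** The normal forms are those with n = deg f: the equation of the variety is
    monic in z up to a constant. *)
Definition zbound n (P : {mpoly K[1 + m + 1]}) : Prop :=
  forall k, k \in msupp P -> (k iz < n)%N.

Lemma mkp_neq_iz x (y : 'I_m -> K) z z' i : i != iz ->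
  mkp x y z ord0 i = mkp x y z' ord0 i.
Proof.
move: i; apply: coord_ind => [_|j _|]; last by rewrite eqxx.
  by have := px_mkp x y z; rewrite -[RHS](px_mkp x y z').
have := py_mkp x y z; rewrite -[RHS](py_mkp x y z').
by move/(congr1 (fun g => g j)).
Qed.

Lemma zbound_horner n P (x : K) (y : 'I_m -> K) : zbound n P ->
  exists2 h : {poly K}, (size h <= n)%N & forall z, P.@[mkp x y z ord0] = h.[z].
Proof.
move=> Pn; pose c (k : 'X_{1..1 + m + 1}) :=
  P@_k * \prod_(i | i != iz) mkp x y 0 ord0 i ^+ k i.
exists (\sum_(k <- msupp P) c k *: 'X^(k iz)).
  rewrite big_seq; elim/big_rec: _ => [|k h kP IHh]; first by rewrite
    size_poly0.
  apply: leq_trans (size_polyD _ _) _; rewrite geq_max IHh andbT.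
  by apply: leq_trans (size_scale_leq _ _) _; rewrite size_polyXn Pn.
move=> z; rewrite mevalE horner_sum; apply: eq_bigr => k _.
rewrite hornerZ hornerXn (bigD1 iz) //= [mkp x y z ord0 iz](pz_mkp x y z) /c.
rewrite (eq_bigr (fun i => mkp x y 0 ord0 i ^+ k i)) => [|i ni]; first by ring.
by rewrite (mkp_neq_iz x y z 0 ni).
Qed.

(** On X Y^3 = f(Z) the functions 1, Z, .., Z^(deg f - 1) are independent over
    the polynomials in X and Y: over general (X, Y) there are deg f points,
    and a polynomial in Z of smaller degree cannot vanish at all of them. *)
Lemma zbound_nonvanishing P : P != 0 -> zbound (size rs) P ->
  exists x (y : 'I_m -> K) z, [/\ x * (\prod_i y i) ^+ 3 = f.[z],
    forall i, y i != 0, f.[z] != 0 & P.@[mkp x y z ord0] != 0].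
Proof.
move=> P0 Pd; have [crit critP] := split_poly_fibre charK0 lc0 rs_uniq rs_size.
pose X : {mpoly K[1 + m + 1]} := 'X_ix.
pose Y : {mpoly K[1 + m + 1]} := \prod_i 'X_(iy i).
have XE x y z : X.@[mkp x y z ord0] = x by rewrite mevalXU; exact: px_mkp.
have YE x y z : Y.@[mkp x y z ord0] = \prod_i y i.
  rewrite rmorph_prod; apply: eq_bigr => i _; rewrite /= mevalXU.
  by have /(congr1 (fun g => g i)) := py_mkp x y z.
pose R := P * X * Y * \prod_(v <- crit) (X * Y ^+ 3 - v%:MP).
have R0 : R != 0.
  have neq0 (S : {mpoly K[1 + m + 1]}) v : S.@[v] != 0 -> S != 0.
    by apply: contraNneq => ->; rewrite meval0.
  rewrite !mulf_neq0 //.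
  - by apply: (neq0 _ (mkp 1 (fun=> 0) 0 ord0)); rewrite XE oner_eq0.
  - by apply: (neq0 _ (mkp 0 (fun=> 1) 0 ord0)); rewrite YE big1 ?oner_eq0.
  - rewrite prodf_seq_neq0; apply/allP => v _ /=.
    apply: (neq0 _ (mkp (v + 1) (fun=> 1) 0 ord0)).
    by rewrite mevalB mevalM rmorphXn /= XE YE big1 // mevalC expr1n mulr1
      addrC addKr oner_eq0.
have [p] := mpoly_nonvanishing R0.
pose p' : 'rV[K]_(1 + m + 1) := \row_j p j.
have -> : R.@[p] = R.@[p' ord0] by apply: meval_eq => i; rewrite mxE.
rewrite -(mkp_eta p'); move: (px p') (py p') (pz p') => x y z0.
rewrite !mevalM XE YE rmorph_prod /= !mulf_eq0 !negb_or.
move=> /andP[/andP[/andP[Pp x0] Y0] cN].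
pose c := x * (\prod_i y i) ^+ 3.
have cNc : c \notin crit.
  apply/negP => cc; move: cN; rewrite prodf_seq_neq0 => /allP /(_ c cc) /=.
  by rewrite mevalB mevalM rmorphXn /= XE YE mevalC subrr eqxx.
have [s us [ss sE]] := critP c cNc.
have [h sh hE] := zbound_horner x y Pd.
have h0 : h != 0 by apply: contraNneq Pp => h0; rewrite hE h0 horner0.
have : ~~ all (root h) s.
  by apply/negP => /(max_poly_roots h0) /(_ us); rewrite ss ltnNge sh.
case/allPn => z zs hz; exists x, y, z; split.
- by rewrite (sE z zs).
- by move=> i; move: Y0 => /prodf_neq0 ->.
- by rewrite (sE z zs) mulf_neq0 // expf_neq0.
- by rewrite hE.
Qed.

End NormalForms.

(** * Reduction in z and expansion of a flow at s = 1 *)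

Section Reduction.
Context (K : closedFieldType) (m : nat) (lc : K) (rs : seq K).
Hypotheses (lc0 : lc != 0) (rs_gt0 : (0 < size rs)%N).
Context (M C : {mpoly K[m]}).
Let V := (1 + m + 1)%N.
Let D := danielewski_of lc rs M C.

Lemma zboundD n (P Q : {mpoly K[V]}) :
  zbound n P -> zbound n Q -> zbound n (P + Q).
Proof.
move=> Pn Qn k /msuppD_le; rewrite mem_cat => /orP[]; [exact: Pn | exact: Qn].
Qed.

Lemma zboundM n q (P Q : {mpoly K[V]}) :
  zbound n.+1 P -> zbound q Q -> zbound (n + q) (P * Q).
Proof.
move=> Pn Qq k /msuppM_le /allpairsP[[k1 k2] /= [/Pn h1 /Qq h2 ->]].
by rewrite mnmDE; lia.
Qed.

Lemma zboundC n c : zbound n.+1 (c%:MP : {mpoly K[V]}).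
Proof.
move=> k; rewrite msuppC; case: ifP => // _; rewrite inE => /eqP ->.
by rewrite mnm0E.
Qed.

Lemma zboundXn n q : (q < n)%N -> zbound n ('X_iz ^+ q : {mpoly K[V]}).
Proof.
move=> qn k; rewrite mpolyXn => /mem_msuppXP <-.
by rewrite mulmnE mnm1E eqxx mul1n.
Qed.

Definition zfree (h : 'rV[K]_V -> K) : Prop :=
  exists2 P : {mpoly K[V]}, zbound 1 P & forall p, h p = P.@[p ord0].

Lemma zfree_algebra : function_algebra zfree.
Proof.
split=> [c|h g [P Pb hE] [Q Qb gE]|h g [P Pb hE] [Q Qb gE]].
- by exists c%:MP => [|p]; [exact: zboundC | rewrite mevalC].
- by exists (P + Q) => [|p]; [exact: zboundD | rewrite mevalD hE gE].
- by exists (P * Q) => [|p]; [exact: (zboundM Pb Qb) | rewrite mevalM hE gE].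
Qed.

Lemma zfree_coord j : j != iz -> zfree (fun p => p ord0 j).
Proof.
move=> jz; exists 'X_j => [k|p]; last by rewrite mevalXU.
by move=> /mem_msuppXP <-; rewrite mnm1E (negPf jz).
Qed.

Lemma zfree_px : zfree px.
Proof. by apply: zfree_coord; rewrite eq_lrshift. Qed.

Lemma zfree_meval P : zfree (fun p => P.@[py p]).
Proof.
apply: (fa_meval zfree_algebra) => i.
by apply: zfree_coord; rewrite eq_lrshift.
Qed.

Let zsum n (t : nat -> 'rV[K]_V -> K) p := \sum_(i < n) pz p ^+ i * t i p.

Let shift (t : nat -> 'rV[K]_V -> K) (i : nat) : 'rV[K]_V -> K :=
  if i is j.+1 then t j else fun=> 0.

Lemma zfree_shift t : (forall i, zfree (t i)) -> forall i, zfree (shift t i).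
Proof. by move=> tz [|i] //=; exact: (fa_cst zfree_algebra 0). Qed.

Lemma zsum_shift n t p : zsum n.+1 (shift t) p = pz p * zsum n t p.
Proof.
rewrite /zsum big_ord_recl mulr0 add0r mulr_sumr; apply: eq_bigr => i _.
by rewrite /= /bump leq0n add1n exprS mulrA.
Qed.

Lemma prod_zsum (s : seq K) : exists t, [/\ forall i, zfree (t i),
  t (size s) = (fun=> 1), forall i, (size s < i)%N -> t i = (fun=> 0) &
  forall p, \prod_(a <- s) (pz p - a * C.@[py p]) = zsum (size s).+1 t p].
Proof.
have zA := zfree_algebra.
elim: s => [|a s [t [tz t1 t0 tE]]] /=.
  exists (fun i => fun=> (i == 0%N)%:R); split=> //.
  - by move=> i; exact: (fa_cst zA).
  - by move=> [|i].
  - by move=> p; rewrite /zsum big_nil big_ord1 mulr1.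
exists (fun i p => shift t i p - a * C.@[py p] * t i p); split.
- move=> i; have := zfree_meval C; have := zfree_shift tz i; have := tz i.
  by move=> h1 h2 h3; falg zA.
- apply: functional_extensionality => p.
  by rewrite /= t1 (t0 (size s).+1) // mulr0 subr0.
- move=> [|i] // si; apply: functional_extensionality => p.
  by rewrite /= !t0 ?mulr0 ?subr0 //; apply: ltnW.
move=> p; rewrite big_cons tE mulrBl -zsum_shift /zsum.
rewrite mulr_sumr [X in _ - X](_ : _ =
  \sum_(i < (size s).+2) a * C.@[py p] * (pz p ^+ i * t i p)); last first.
  by rewrite [RHS]big_ord_recr /= (t0 (size s).+1) // !mulr0 addr0.
by rewrite -sumrB; apply: eq_bigr => i _; ring.
Qed.

Definition zreduced (h : 'rV[K]_V -> K) : Prop :=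
  exists2 t, forall i, zfree (t i) &
    forall p, p \in D -> h p = zsum (size rs) t p.

(** The equation of the variety, solved for z^(deg f). *)
Lemma zpower_reduced : zreduced (fun p => pz p ^+ size rs).
Proof.
have zA := zfree_algebra.
have [t [tz t1 _ tE]] := prod_zsum rs.
exists (fun i p => (i == 0%N)%:R * (lc^-1 * (px p * M.@[py p])) - t i p).
  move=> i; have := zfree_meval M; have := tz i; have := zfree_px.
  by move=> h1 h2 h3; falg zA.
move=> p; rewrite inE /split_form tE => /eqP pD.
have : lc^-1 * (px p * M.@[py p]) = zsum (size rs).+1 t p by rewrite pD mulKf.
rewrite /zsum big_ord_recr /= t1 mulr1 => /esym/(canRL (addKr _)) ->.
move: (lc^-1 * _) => w; case: (size rs) rs_gt0 => // d _.
under [RHS]eq_bigr do rewrite mulrBr.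
rewrite sumrB addrC; congr (_ - _).
rewrite big_ord_recl /= expr0 !mul1r big1 ?addr0 // => i _.
by rewrite mul0r mulr0.
Qed.

Lemma zreduced_add h g : zreduced h -> zreduced g ->
  zreduced (fun p => h p + g p).
Proof.
move=> [t tz hE] [t' tz' gE].
exists (fun i p => t i p + t' i p) => [i|p pD].
  exact: (fa_add zfree_algebra).
rewrite hE // gE // /zsum -big_split /=.
by apply: eq_bigr => i _; rewrite mulrDr.
Qed.

Lemma zreduced_mul h g : zfree h -> zreduced g ->
  zreduced (fun p => h p * g p).
Proof.
move=> hz [t tz gE].
exists (fun i p => h p * t i p) => [i|p pD].
  exact: (fa_mul zfree_algebra).
rewrite gE // /zsum mulr_sumr.
by apply: eq_bigr => i _; rewrite mulrCA.
Qed.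

Lemma zreduced_eq h g : zreduced h -> (forall p, p \in D -> h p = g p) ->
  zreduced g.
Proof. by move=> [t tz hE] e; exists t => // p pD; rewrite -e // hE. Qed.

Lemma zreduced_zfree h : zfree h -> zreduced h.
Proof.
move=> hz; exists (fun i p => (i == 0%N)%:R * h p) => [i|p pD].
  have zA := zfree_algebra; falg zA.
rewrite /zsum; case: (size rs) rs_gt0 => // d _.
rewrite big_ord_recl expr0 !mul1r big1 ?addr0 // => i _.
by rewrite mul0r mulr0.
Qed.

Lemma zreduced_pz h : zreduced h -> zreduced (fun p => pz p * h p).
Proof.
move=> [t tz hE].
have h1 : zreduced (zsum (size rs) (shift t)).
  by exists (shift t) => //; exact: zfree_shift.
have h2 := zreduced_mul (tz (size rs).-1) zpower_reduced.
apply: (zreduced_eq (zreduced_add h1 h2)) => p pD.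
rewrite hE // -zsum_shift /zsum big_ord_recr /=; congr (_ + _).
by rewrite mulrC; case: (size rs) rs_gt0.
Qed.

Lemma zreduced_coord h j : zreduced h -> zreduced (fun p => p ord0 j * h p).
Proof.
have [-> |jz] := eqVneq j iz; first exact: zreduced_pz.
by apply: zreduced_mul; exact: zfree_coord.
Qed.

Lemma meval_zreduced P : zreduced (fun p => P.@[p ord0]).
Proof.
have c0 : zreduced (fun=> 0).
  by apply: zreduced_zfree; exact: (fa_cst zfree_algebra 0).
elim/mpolyind: P => [|c k P _ _ IHP].
  by apply: (zreduced_eq c0) => p _; rewrite meval0.
have hk : zreduced (fun p => 'X_[k].@[p ord0]).
  apply: (@zreduced_eq (fun p => \prod_(i <- enum 'I_V) p ord0 i ^+ k i)).
    elim: (enum _) => [|i s IHs].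
      apply: (@zreduced_eq (fun=> 1)) => [|p _]; last by rewrite big_nil.
      by apply: zreduced_zfree; exact: (fa_cst zfree_algebra 1).
    apply: (@zreduced_eq
      (fun p => p ord0 i ^+ k i * \prod_(j <- s) p ord0 j ^+ k j)).
      elim: (k i) => [|n IHn].
        by apply: (zreduced_eq IHs) => p _; rewrite mul1r.
      apply: (zreduced_eq (zreduced_coord i IHn)) => p _.
      by rewrite exprS mulrA.
    by move=> p _; rewrite big_cons.
  by move=> p _; rewrite mevalX big_enum.
have hc : zreduced (fun p => c * 'X_[k].@[p ord0]).
  by apply: zreduced_mul => //; exact: (fa_cst zfree_algebra c).
apply: (zreduced_eq (zreduced_add hc IHP)) => p _.
by rewrite mevalD mevalZ.
Qed.

Lemma mpoly_reduce P : exists2 Q : {mpoly K[V]}, zbound (size rs) Q &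
  forall p, p \in D -> P.@[p ord0] = Q.@[p ord0].
Proof.
have [t tz PE] := meval_zreduced P.
have /fin_all_exists[T TE] (i : 'I_(size rs)) : exists T : {mpoly K[V]},
    zbound 1 T /\ forall p, t i p = T.@[p ord0].
  by have [T Tb TE] := tz i; exists T.
exists (\sum_(i < size rs) 'X_iz ^+ i * T i) => [|p pD].
  elim/big_rec: _ => [k|i Q _ IHQ]; first by rewrite msupp0.
  apply: zboundD => //; have [Tb _] := TE i => k.
  have ib : zbound i.+1 ('X_iz ^+ i : {mpoly K[V]}) by exact: zboundXn.
  by move=> /(zboundM ib Tb); have := ltn_ord i; lia.
rewrite PE // rmorph_sum /zsum; apply: eq_bigr => i _ /=.
by have [_ ->] := TE i; rewrite mevalM rmorphXn /= mevalXU.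
Qed.

(** An action of the multiplicative group; the factor s^e clears the
    denominators of its Laurent polynomials in s. *)
Definition polynomial_flow (mu : K -> 'rV[K]_V -> 'rV[K]_V) : Prop :=
  [/\ forall (s : K) p, s != 0 -> p \in D -> mu s p \in D,
      forall p, p \in D -> mu 1 p = p,
      forall (s t : K) p, s != 0 -> t != 0 -> p \in D -> mu (s * t) p = mu s
        (mu t p)
    & exists e (R : 'I_V -> {poly {mpoly K[V]}}),
        forall (s : K) p j, s != 0 -> p \in D ->
          s ^+ e * mu s p ord0 j = (map_poly (meval (p ord0)) (R j)).[s]].

(** The Taylor expansion at s = 1. The constant term is the identity map by
    [mu 1 p = p]; the other coefficients are replaced by normal forms, so that
    their leading parts cannot vanish on the limit variety. *)
Lemma flow_expansion mu : polynomial_flow mu ->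
  exists e N (S : 'I_V -> 'I_N -> {mpoly K[V]}),
    (forall j n, zbound (size rs) (S j n)) /\
    forall (s : K) p j, s != 0 -> p \in D ->
      s ^+ e * mu s p ord0 j =
      p ord0 j + \sum_(n < N) (s - 1) ^+ n.+1 * (S j n).@[p ord0].
Proof.
move=> [muD mu1 muM [e [R RE]]].
pose R' j := R j \Po ('X + 1%:P).
pose N := \max_j size (R' j).
have /fin_all_exists2[S Sb SE] (jn : 'I_V * 'I_N) :
  exists2 Q : {mpoly K[V]}, zbound (size rs) Q &
    forall p, p \in D -> ((R' jn.1)`_(jn.2.+1)).@[p ord0] = Q.@[p ord0].
  exact: mpoly_reduce.
have R'E s p j : (map_poly (meval (p ord0)) (R j)).[s] =
    (map_poly (meval (p ord0)) (R' j)).[s - 1].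
  rewrite map_comp_poly horner_comp rmorphD /= map_polyX map_polyC /= meval1.
  by rewrite hornerD hornerX hornerC subrK.
have R'0 p j : p \in D -> ((R' j)`_0).@[p ord0] = p ord0 j.
  move=> pD; have := RE 1 p j (oner_neq0 K) pD.
  by rewrite expr1n mul1r mu1 // R'E subrr horner_coef0 coef_map => ->.
exists e, N, (fun j n => S (j, n)); split=> [j n|s p j s0 pD]; first exact: Sb.
rewrite RE // R'E (@horner_coef_wide _ N.+1); last first.
  rewrite (leq_trans (size_poly _ _)) //.
  by apply/leqW/(leq_bigmax (F := fun j => size (R' j))).
rewrite big_ord_recl coef_map expr0 mulr1 /= R'0 //; congr (_ + _).
by apply: eq_bigr => n _; rewrite coef_map /= (SE (j, n)) // mulrC.
Qed.

End Reduction.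

(** * A flow does not lower the order in y_i *)

(** The slope of the worst pole is a maximum of finitely many fractions,
    compared without division. *)
Lemma max_ratio (L : seq (nat * nat)) : L != [::] ->
  (forall u, u \in L -> (0 < u.1)%N) ->
  exists2 u, u \in L & forall v, v \in L -> (v.2 * u.1 <= u.2 * v.1)%N.
Proof.
elim: L => // u0 [|u1 L] IHL _ Lpos.
  by exists u0; rewrite ?inE // => v; rewrite inE => /eqP ->.
have [//|v vL|u uL uM] := IHL; first by apply: Lpos; rewrite inE vL orbT.
have u0p := Lpos u0 (mem_head _ _).
have up : (0 < u.1)%N by apply: Lpos; rewrite inE uL orbT.
have [le|lt] := leqP (u0.2 * u.1)%N (u.2 * u0.1)%N.
  exists u; first by rewrite inE uL orbT.
  by move=> v; rewrite inE => /orP[/eqP -> //|]; exact: uM.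
exists u0; first exact: mem_head.
move=> v; rewrite inE => /orP[/eqP -> //|vL].
have vp : (0 < v.1)%N by apply: Lpos; rewrite inE vL orbT.
have := uM v vL; move: lt up u0p vp.
case: u {uL uM} => a b; case: u0 {Lpos} => c d; case: v {vL} => e g /=.
move=> h1 h2 h3 h4 h5.
rewrite -(leq_pmul2r h2) (@leq_trans (b * e * c)%N) //; first by nia.
by nia.
Qed.

Section MonomialOrders.
Context (K : closedFieldType) (charK0 : [pchar K] =i pred0) (m : nat).
Context (lc : K) (rs : seq K) (r : {mpoly K[m]}).
Hypotheses (lc0 : lc != 0) (rs_uniq : uniq rs) (rs_size : (2 <= size rs)%N).
Let V := (1 + m + 1)%N.
Let f := split_poly lc rs.
Let C := 1 + ymon K m * r.
Let D := danielewski_of lc rs (ymon K m ^+ 3) C.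
Context (mu : K -> 'rV[K]_V -> 'rV[K]_V).
Hypotheses (muD : forall (s : K) p, s != 0 -> p \in D -> mu s p \in D)
  (mu1 : forall p, p \in D -> mu 1 p = p)
  (muM : forall (s t : K) p, s != 0 -> t != 0 -> p \in D ->
         mu (s * t) p = mu s (mu t p)).
Context (e N : nat) (S : 'I_V -> 'I_N -> {mpoly K[V]}).
Hypotheses (S_zbound : forall j n, zbound (size rs) (S j n))
  (SE : forall (s : K) p j, s != 0 -> p \in D -> s ^+ e * mu s p ord0 j =
      p ord0 j + \sum_(n < N) (s - 1) ^+ n.+1 * (S j n).@[p ord0]).
Context (i0 : 'I_m).

(** The order in h along a curve y_i0 = h b with z and the other y_j fixed and
    general; there x = c prod (z - a C) / Y^3 has a pole of order 3. *)
Definition pole_weight (j : 'I_V) : int :=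
  if j == ix then - 3%:Z else if j == iy i0 then 1 else 0.

Lemma meval_unit_coef y : C.@[y] = 1 + (\prod_i y i) * r.@[y].
Proof. by rewrite mevalD meval1 mevalM ymonE. Qed.

Lemma in_danielewski_of p : (p \in D) =
  (px p * (yprod p) ^+ 3 == split_form lc rs C.@[py p] (pz p)).
Proof. by rewrite inE rmorphXn /= ymonE. Qed.

Section Rescaling.
Context (q a : nat) (q_gt0 : (0 < q)%N) (a_gt0 : (0 < a)%N).
Let om j := q%:Z * pole_weight j.
Let cw j (n : 'I_N) := om j - a%:Z * n.+1%:Z.
Hypothesis S_weight : forall j n k, k \in msupp (S j n) ->
  cw j n <= mweight om k.

Let E (t : K) (P : 'I_V -> K) j :=
  P j + \sum_(n < N) t ^+ n.+1 * (initial_form om (cw j n) (S j n)).@[P].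

Lemma weight_x : om ix = - (3 * q)%:Z.
Proof. by rewrite /om /pole_weight eqxx; lia. Qed.

Lemma weight_y i : om (iy i) = (if i == i0 then q else 0%N)%:Z.
Proof.
rewrite /om /pole_weight (inj_eq (@lshift_inj _ _)) eq_rlshift.
by rewrite (inj_eq (@lshift_inj _ _)) (inj_eq (@rshift_inj _ _)); case: eqP =>
  _; lia.
Qed.

Lemma weight_z : om iz = 0.
Proof. by rewrite /om /pole_weight !eq_rlshift mulr0. Qed.

(** The basic limit. By the hypothesis on the weights every term of the
    expansion of mu at s = 1 + h^a tau has a limit after rescaling, and the
    terms of critical weight are those that survive. It is applied forwards to
    a family of points and then backwards to its image. *)
Lemma flow_limit (p : K -> 'rV[K]_V) (tau : K -> K) (P : 'I_V -> K) t :
  near0 (fun h => p h \in D) ->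
  (forall j, tends_to (fun h => h ^ (- om j) * p h ord0 j) (P j)) ->
  tends_to tau t -> forall j,
  tends_to (fun h => h ^ (- om j) * mu (1 + h ^+ a * tau h) (p h) ord0 j)
    (E t P j).
Proof.
move=> pD pP taut j; pose s h := 1 + h ^+ a * tau h.
have s1 : tends_to s 1.
  rewrite -[X in tends_to _ X]addr0 -[X in _ + X](mul0r t).
  apply: tends_to_add; first exact: tends_to_cst.
  apply: tends_to_mul => //.
  by have := tends_to_exp a (@tends_to_id K); rewrite expr0n gtn_eqF.
have s0 := tends_to_neq0 s1 (oner_neq0 K).
have se : tends_to (fun h => (s h ^+ e)^-1) 1.
  rewrite -[X in tends_to _ X]invr1; apply: tends_to_inv (oner_neq0 K).
  by have := tends_to_exp e s1; rewrite expr1n.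
rewrite -[X in tends_to _ X]mul1r.
apply: (@tends_to_near _ (fun h => (s h ^+ e)^-1 *
  (h ^ (- om j) * p h ord0 j + \sum_(n < N) tau h ^+ n.+1 *
     (h ^ (- cw j n) * (S j n).@[p h ord0])))).
  apply: near0_imp (near0_and s0 pD) => h h0 [sh0 phD].
  rewrite -/(s h); apply: (canLR (mulKf (expf_neq0 e sh0))).
  rewrite mulrCA SE // mulrDr; congr (_ + _).
  rewrite mulr_sumr; apply: eq_bigr => n _.
  rewrite /s addrC addKr exprMn /cw opprB expfzDr //.
  rewrite -[a%:Z * _]PoszM -exprnP exprM; ring.
apply: tends_to_mul se _; apply: tends_to_add (pP j) _.
apply: tends_to_sum => n _; apply: tends_to_mul; first exact: tends_to_exp.
by apply: tends_to_weighted => // k; exact: S_weight.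
Qed.

(** The degeneration of Z' under the rescaling: C tends to 1 because Y tends
    to 0. *)
Lemma limit_relation (p : K -> 'rV[K]_V) (P : 'I_V -> K) :
  near0 (fun h => p h \in D) ->
  (forall j, tends_to (fun h => h ^ (- om j) * p h ord0 j) (P j)) ->
  P ix * (\prod_i P (iy i)) ^+ 3 = f.[P iz].
Proof.
move=> pD pP.
have yP i : tends_to (fun h => h ^ (- om (iy i)) * py (p h) i) (P (iy i)).
  exact: pP.
have Yl := tends_to_prod (index_enum _) (P := xpredT) (fun i _ => yP i).
have YE h : h != 0 -> yprod (p h) =
    h ^+ q * \prod_i (h ^ (- om (iy i)) * py (p h) i).
  move=> h0; rewrite big_split mulrA /= -[LHS]mul1r; congr (_ * _).
  rewrite (bigD1 i0) //= weight_y eqxx big1 => [|i ii0].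
    by rewrite mulr1 -exprnN divff // expf_neq0.
  by rewrite weight_y (negPf ii0) oppr0 expr0z.
have yl i : exists l, tends_to (fun h => py (p h) i) l.
  eexists; apply: (@tends_to_near _ (fun h => h ^ om (iy i) *
      (h ^ (- om (iy i)) * py (p h) i))).
    apply: near0_all => h h0.
    by rewrite mulrA -expfzDr // subrr mul1r.
  apply: tends_to_mul (yP i); apply: tends_to_pow.
  by rewrite weight_y; case: ifP.
have [L yL] := fin_all_exists yl.
have q0 : tends_to (fun h => h ^+ q) (0 : K).
  by have := tends_to_exp q (@tends_to_id K); rewrite expr0n gtn_eqF.
have Cl : tends_to (fun h => C.@[py (p h)]) (1 : K).
  have := tends_to_meval r yL; move=> rl.
  have := tends_to_add (tends_to_cst 1) (tends_to_mul (tends_to_mul q0 Yl) rl).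
  rewrite !mul0r addr0; apply: tends_to_near; apply: near0_all => h h0.
  by rewrite -YE // meval_unit_coef.
have zl : tends_to (fun h => pz (p h)) (P iz).
  apply: tends_to_near (pP iz); apply: near0_all => h _.
  by rewrite weight_z oppr0 expr0z mul1r.
rewrite -split_form1.
apply: tends_to_unique (tends_to_split_form lc rs Cl zl).
apply: tends_to_near (tends_to_mul (pP ix) (tends_to_exp 3 Yl)).
apply: near0_imp pD => h h0; rewrite in_danielewski_of => /eqP <-.
rewrite YE // exprMn weight_x opprK -exprnP -exprM mulnC -/(px (p h)); ring.
Qed.

(** Critical monomials in the x-coordinate have negative weight, and x is the
    only variable of negative weight. *)
Lemma rescaled_x_factor (P : 'I_V -> K) t : P ix = 0 -> E t P ix = 0.
Proof.
move=> Px; rewrite /E Px add0r big1 // => n _.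
rewrite rmorph_sum /= big_seq_cond big1 ?mulr0 // => k /andP[kS /eqP kw].
rewrite mevalZ mevalX (bigD1 ix) //= Px.
have : (0 < k ix)%N.
  rewrite lt0n; apply/eqP => kx; have : 0 <= mweight om k.
    apply: sumr_ge0 => i _; have [-> |ii] := eqVneq i ix.
      by rewrite kx mulr0.
    by rewrite /om /pole_weight (negPf ii); case: ifP; lia.
  by rewrite kw /cw weight_x; lia.
by case: (k ix) => // n' _; rewrite expr0n mul0r mulr0.
Qed.

Section Orbit.
Context (x0 : K) (b : 'I_m -> K) (z0 : K).
Hypotheses (P_eq : x0 * (\prod_i b i) ^+ 3 = f.[z0])
  (b0 : forall i, b i != 0) (fz0 : f.[z0] != 0).
Let P := mkp x0 b z0 ord0.

Let y (h : K) i := if i == i0 then h ^+ q * b i else b i.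
Let x (h : K) := split_form lc rs C.@[y h] z0 / (\prod_i y h i) ^+ 3.
Let p (h : K) := mkp (x h) (y h) z0.

Lemma limit_coords : (P ix = x0) * (forall i, P (iy i) = b i) * (P iz = z0).
Proof.
split; [split|]; [exact: px_mkp | | exact: pz_mkp].
by move=> i; have /(congr1 (fun g => g i)) := py_mkp x0 b z0.
Qed.

Lemma prod_y h : \prod_i y h i = h ^+ q * \prod_i b i.
Proof.
rewrite (bigD1 i0) //= [in RHS](bigD1 i0) //= /y eqxx mulrA; congr (_ * _).
by apply: eq_bigr => i /negPf ->.
Qed.

Lemma prod_b_neq0 : \prod_i b i != 0.
Proof. by apply/prodf_neq0. Qed.

Lemma base_curve_in h : h != 0 -> p h \in D.
Proof.
move=> h0; rewrite in_danielewski_of /yprod !mkpE /x mulfVK // expf_neq0 //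
  prod_y.
by rewrite mulf_neq0 ?expf_neq0 // prod_b_neq0.
Qed.

(** Any point of the limit variety off Y = 0 is a limit of points of Z' with
    the same y (rescaled) and z. *)
Lemma base_curve_limit j : tends_to (fun h => h ^ (- om j) * p h ord0 j) (P j).
Proof.
have ml : tends_to (fun h => h ^+ q) (0 : K).
  by have := tends_to_exp q (@tends_to_id K); rewrite expr0n gtn_eqF.
have yl i : tends_to (fun h => y h i) (if i == i0 then 0 else b i).
  rewrite /y; case: eqP => _; last exact: tends_to_cst.
  rewrite -[X in tends_to _ X](mul0r (b i)).
  by apply: tends_to_mul => //; exact: tends_to_cst.
move: j; apply: coord_ind => [|i|].
- have Cl : tends_to (fun h => C.@[y h]) (1 : K).
    have := tends_to_meval r yl => rl.
    have := tends_to_add (tends_to_cst 1) (tends_to_mul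
      (tends_to_mul ml (tends_to_cst (\prod_i b i))) rl).
    rewrite !mul0r addr0; apply: tends_to_near; apply: near0_all => h h0.
    by rewrite -prod_y meval_unit_coef.
  have := tends_to_mul (tends_to_split_form lc rs Cl (tends_to_cst z0))
    (tends_to_cst (((\prod_i b i) ^+ 3)^-1)).
  rewrite split_form1 -/f -P_eq mulfK ?expf_neq0 ?prod_b_neq0 // limit_coords.
  apply: tends_to_near; apply: near0_all => h h0.
  rewrite [p h ord0 ix](px_mkp (x h)) /x prod_y weight_x opprK exprMn.
  rewrite -exprnP -exprM [(q * 3)%N]mulnC.
  move: (expf_neq0 (3 * q) h0) prod_b_neq0.
  move: (h ^+ (3 * q)) (\prod_i b i) => u v u0 v0.
  by field; rewrite u0 v0.
- rewrite limit_coords; apply: tends_to_near (tends_to_cst (b i)).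
  apply: near0_all => h h0; rewrite weight_y.
  have -> : p h ord0 (iy i) = y h i.
    by have /(congr1 (fun g => g i)) := py_mkp (x h) (y h) z0.
  rewrite /y; case: eqP => _; last by rewrite oppr0 expr0z mul1r.
  by rewrite -exprnN mulKf // expf_neq0.
- rewrite limit_coords; apply: tends_to_near (tends_to_cst z0).
  apply: near0_all => h h0; rewrite weight_z oppr0 expr0z mul1r.
  by have := pz_mkp (x h) (y h) z0.
Qed.

(** If X vanished at time t on the limit curve, the flow backwards from that
    point would have X = 0 as well by [rescaled_x_factor]; but it returns to
    the starting point, where X Y^3 = f(z0) is not 0. *)
Lemma orbit_relation t :
  E t P ix * (\prod_i E t P (iy i)) ^+ 3 = f.[E t P iz] /\ E t P ix != 0.
Proof.
pose s h := 1 + h ^+ a * t.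
have s1 : tends_to s 1.
  have := tends_to_poly (1 + 'X^a * t%:P); rewrite !hornerE /=.
  rewrite expr0n gtn_eqF // mul0r addr0; apply: tends_to_near.
  by apply: near0_all => h _; rewrite !hornerE.
have s0 := tends_to_neq0 s1 (oner_neq0 K).
have pD : near0 (fun h => p h \in D) by apply: near0_all => h; exact:
  base_curve_in.
have p'l := flow_limit pD base_curve_limit (tends_to_cst t).
have p'D : near0 (fun h => mu (s h) (p h) \in D).
  by apply: near0_imp (near0_and s0 pD) => h _ []; exact: muD.
split; first exact: limit_relation p'D p'l.
have taul : tends_to (fun h => - t * (s h)^-1) (- t).
  rewrite -[X in tends_to _ X]mulr1 -[X in _ * X]invr1.
  apply: tends_to_mul; first exact: tends_to_cst.
  exact: tends_to_inv (oner_neq0 K).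
have back := flow_limit p'D p'l taul ix.
apply/eqP => Ex0; move: fz0; rewrite -P_eq.
suff -> : x0 = 0 by rewrite mul0r eqxx.
rewrite -(rescaled_x_factor (- t) Ex0) -[LHS]limit_coords.1.1.
apply: tends_to_unique back; apply: tends_to_near (base_curve_limit ix).
apply: near0_imp (near0_and s0 pD) => h h0 [sh phD].
(* The inverse time has the same form, with tau = - t / s tending to - t. *)
have -> : 1 + h ^+ a * (- t * (s h)^-1) = (s h)^-1.
  have hE : h ^+ a * t = s h - 1 by rewrite /s addrC addKr.
  rewrite mulNr mulrN mulrA hE; move: sh; move: (s h) => u u0.
  by field.
by rewrite -muM ?invr_eq0 // mulVf // mu1.
Qed.

(** The limit orbits are polynomial curves on X Y^3 = f(Z) along which X has
    no zero, hence constant. *)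
Lemma critical_form_vanishes j n :
  (initial_form om (cw j n) (S j n)).@[P] = 0.
Proof.
pose c j (n : 'I_N) := (initial_form om (cw j n) (S j n)).@[P].
pose Q j : {poly K} := (P j)%:P + \sum_(n < N) c j n *: 'X^(n.+1).
have QE t i : (Q i).[t] = E t P i.
  rewrite hornerD hornerC horner_sum; congr (_ + _).
  by apply: eq_bigr => k _; rewrite hornerZ hornerXn mulrC.
have eta0 : \prod_i Q (iy i) != 0.
  apply/prodf_neq0 => i _; apply: contraNneq (b0 i) => Q0.
  have := QE 0 (iy i); rewrite Q0 horner0 /E big1 => [|k _].
    by rewrite addr0 limit_coords => <-.
  by rewrite expr0n mul0r.
have rel : Q ix * (\prod_i Q (iy i)) ^+ 3 = f \Po Q iz.
  apply: (poly_eq_cofinite (oner_neq0 _)) => t _.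
  rewrite hornerM horner_exp horner_prod horner_comp !QE.
  under eq_bigr do rewrite QE.
  by have [] := orbit_relation t.
have Qx t : (Q ix).[t] != 0 by rewrite QE; have [] := orbit_relation t.
have [sx [sz sy]] := split_curve_constant charK0 lc0 rs_uniq rs_size Qx eta0
  rel.
have Q1 : (size (Q j) <= 1)%N.
  move: (j); apply: coord_ind => // i.
  apply: leq_trans sy; apply: dvdp_leq => //.
  by rewrite (bigD1 i) //= dvdp_mulr.
have : (Q j)`_n.+1 = 0 by apply: nth_default; apply: leq_trans Q1 _.
rewrite coefD coefC add0r coef_sum (bigD1 n) //= coefZ coefXn eqxx mulr1.
rewrite big1 ?addr0 // => k kn.
by rewrite coefZ coefXn eqSS eq_sym (inj_eq val_inj) (negPf kn) mulr0.
Qed.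

End Orbit.

(** A critical monomial would give a nonzero critical form, and in normal form
    this cannot vanish on the whole limit variety. *)
Lemma no_critical_monomial j n k : k \in msupp (S j n) ->
  mweight om k != cw j n.
Proof.
move=> kS; apply/eqP => kw.
pose H := initial_form om (cw j n) (S j n).
have Hk k' : H@_k' = if mweight om k' == cw j n then (S j n)@_k' else 0.
  rewrite /H /initial_form raddf_sum /=.
  have [kS'|kS'] := boolP (k' \in msupp (S j n)); last first.
    rewrite (memN_msupp_eq0 kS') if_same big_seq_cond big1 // => l /andP[lS _].
    rewrite mcoeffZ mcoeffX; case: eqP => [ll|_]; last by rewrite mulr0.
    by rewrite -ll lS in kS'.
  case: ifP => kw'.
    rewrite big_mkcond (bigD1_seq k') ?msupp_uniq //= kw'.
    rewrite mcoeffZ mcoeffX eqxx mulr1 big1 ?addr0 // => l /negPf ll.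
    by case: ifP => // _; rewrite mcoeffZ mcoeffX ll mulr0.
  rewrite big1 // => l lw; rewrite mcoeffZ mcoeffX.
  by case: eqP => [ll|_]; [rewrite ll kw' in lw | rewrite mulr0].
have H0 : H != 0.
  apply: contraTneq kS => H0; rewrite mcoeff_msupp negbK.
  by have := Hk k; rewrite H0 mcoeff0 kw eqxx => <-.
have Hb : zbound (size rs) H.
  move=> k'; rewrite mcoeff_msupp Hk; case: ifP => _; last by rewrite eqxx.
  by rewrite -mcoeff_msupp; exact: S_zbound.
have [x [y [z [E1 y0 fz0 Hn]]]] :=
  zbound_nonvanishing charK0 lc0 rs_uniq rs_size H0 Hb.
by move: Hn; rewrite (critical_form_vanishes E1 y0 fz0) eqxx.
Qed.

End Rescaling.

(** If some monomial violated the bound, the worst slope a/q would satisfy the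
    weight hypothesis of the rescaling with equality for at least one
    monomial. *)
Theorem flow_preserves_order j n k : k \in msupp (S j n) ->
  pole_weight j <= mweight pole_weight k.
Proof.
move=> kS; rewrite leNgt; apply/negP => bad.
(* The order of the pole, paired below with the order of vanishing at s = 1.
   *)
pose defect j (k : 'X_{1..V}) := `|pole_weight j - mweight pole_weight k|%N.
pose L0 j (n : 'I_N) := [seq (n.+1, defect j k) |
  k <- [seq k <- msupp (S j n) | mweight pole_weight k < pole_weight j]].
pose L := flatten [seq flatten [seq L0 j n | n : 'I_N] | j : 'I_V].
have LP (j' : 'I_V) (n' : 'I_N) k' : k' \in msupp (S j' n') ->
    mweight pole_weight k' < pole_weight j' -> (n'.+1, defect j' k') \in L.
  move=> kS' kw; apply/flatten_mapP; exists j'; first by rewrite mem_enum.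
  apply/flatten_mapP; exists n'; first by rewrite mem_enum.
  by apply/mapP; exists k'; rewrite ?mem_filter ?kw.
have [|u|u uL uM] := @max_ratio L.
- by apply: contraTneq (LP _ _ _ kS bad) => ->.
- by move=> /flatten_mapP[? _ /flatten_mapP[? _ /mapP[? _ ->]]].
have [j1 _ /flatten_mapP[n1 _ /mapP[k1 + uE]]] := flatten_mapP uL.
rewrite mem_filter => /andP[kw1 kS1].
have dpos : (0 < defect j1 k1)%N by rewrite /defect; lia.
have wE k' :
    mweight (fun j => n1.+1%:Z * pole_weight j) k' = n1.+1%:Z * mweight
      pole_weight k'.
  by rewrite /mweight mulr_sumr; apply: eq_bigr => i _; rewrite mulrA.
have Sw j' n' k' : k' \in msupp (S j' n') ->
    n1.+1%:Z * pole_weight j' - (defect j1 k1)%:Z * n'.+1%:Z <=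
    mweight (fun j => n1.+1%:Z * pole_weight j) k'.
  move=> kS'; rewrite wE.
  have [le|lt] := leP (pole_weight j') (mweight pole_weight k'); first by nia.
  have := uM _ (LP _ _ _ kS' lt); rewrite uE /=.
  by rewrite {1}/defect; nia.
have nc := @no_critical_monomial n1.+1 (defect j1 k1) isT dpos Sw j1 n1 k1 kS1.
move: nc.
by rewrite wE => /negP; apply; apply/eqP; rewrite /defect; nia.
Qed.

End MonomialOrders.

(** * Flows commuting with the coordinate torus *)

Lemma poly_unit_constant (K : closedFieldType) (u v e : {poly K}) : e != 0 ->
  (forall t, e.[t] != 0 -> u.[t] * v.[t] = 1) -> exists c, u = c%:P.
Proof.
move=> e0 h; have uv : u * v = 1.
  apply: (poly_eq_cofinite e0) => t et.
  by rewrite hornerM hornerC; exact: h.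
have : u \is a GRing.unit by apply/unitrPr; exists v.
rewrite poly_unitE => /andP[/eqP su _].
by exists u`_0; rewrite -size1_polyC ?su.
Qed.

Section PowersOfX.
Context (K : closedFieldType).
Implicit Types p h c : {poly K}.

Lemma coprimep_Xn p n : p.[0] != 0 -> coprimep 'X^n p.
Proof.
move=> p0; apply: coprimep_expl; rewrite coprimep_sym.
by rewrite -['X]subr0 -polyC0 coprimep_XsubC rootE.
Qed.

Lemma dvdp_Xn_coef p n i : 'X^n %| p -> (i < n)%N -> p`_i = 0.
Proof. by move=> /dvdpP[q ->] ni; rewrite coefMXn ni. Qed.

(** At 0 the factors take the values h(0) - b with distinct b, so exactly one
    of them is divisible by X, and it takes the whole power. *)
Lemma dvdp_Xn_factor lc (rs : seq K) h c n : (0 < n)%N -> c.[0] = 1 ->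
  lc != 0 -> uniq rs -> 'X^n %| lc *: \prod_(b <- rs) (h - b *: c) ->
  exists2 a, a \in rs & 'X^n %| h - a *: c.
Proof.
move=> n0 c0 lc0 urs dvd.
have hE b : (h - b *: c).[0] = h.[0] - b.
  by rewrite hornerD hornerN hornerZ c0 mulr1.
have [a ars ha] : exists2 a, a \in rs & h.[0] = a.
  have := dvdp_Xn_coef dvd n0.
  rewrite -horner_coef0 hornerZ horner_prod => /eqP.
  rewrite mulf_eq0 (negPf lc0) prodf_seq_eq0 => /hasP[a ars /=].
  by rewrite hE subr_eq0 => /eqP; exists a.
exists a => //; move: dvd; rewrite dvdpZr // (big_rem a) //= Gauss_dvdpl //.
apply: coprimep_Xn; rewrite horner_prod prodf_seq_neq0; apply/allP => b /=.
by rewrite mem_rem_uniq // !inE hE ha subr_eq0 eq_sym => /andP[].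
Qed.

End PowersOfX.

Section LinearSum.
Context (K : closedFieldType) (m : nat) (J : pred 'I_m).

Definition twist : {mpoly K[m]} := 1 + \sum_(i | J i) 'X_i.

Lemma twistE y : twist.@[y] = 1 + \sum_(i | J i) y i.
Proof.
rewrite mevalD meval1 rmorph_sum; congr (_ + _).
by apply: eq_bigr => i _; rewrite /= mevalXU.
Qed.

(** These scalings fix Y and every variable in J, hence the coefficient C and
    the equation of Z'. *)
Definition torus_char (chi : 'I_m -> K) : Prop :=
  \prod_i chi i = 1 /\ forall i, J i -> chi i = 1.

Definition scale (chi : 'I_m -> K) (p : 'rV[K]_(1 + m + 1)) :=
  mkp (px p) (fun i => chi i * py p i) (pz p).

End LinearSum.

Section Flows.
Context (K : closedFieldType) (charK0 : [pchar K] =i pred0) (m : nat).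
Hypothesis m_gt0 : (0 < m)%N.
Context (lc : K) (rs : seq K) (J : pred 'I_m).
Hypotheses (lc0 : lc != 0) (rs_uniq : uniq rs) (rs_size : (2 <= size rs)%N).
Let V := (1 + m + 1)%N.
Let C := 1 + ymon K m * twist K J.
Let D := danielewski_of lc rs (ymon K m ^+ 3) C.

Lemma two_roots : exists a1 a2, [/\ a1 \in rs, a2 \in rs & a1 != a2].
Proof.
case: (rs) rs_size rs_uniq => [|a1 [|a2 l]] //= _ /andP[+ _].
rewrite inE negb_or => /andP[a12 _]; exists a1, a2.
by rewrite !inE !eqxx orbT.
Qed.

Lemma admissible_twisted : admissible 3 (ymon K m ^+ 3) C.
Proof.
split; first by exists (ymon K m ^+ 2); rewrite -exprS.
  by exists 1; rewrite mulr1.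
by exists (twist K J).
Qed.

Lemma meval_twisted y :
  C.@[y] = 1 + (\prod_i y i) * (1 + \sum_(i | J i) y i).
Proof. by rewrite meval_unit_coef twistE. Qed.

Lemma in_twisted p : (p \in D) =
  (px p * (yprod p) ^+ 3 == split_form lc rs C.@[py p] (pz p)).
Proof. exact: in_danielewski_of. Qed.

Lemma twisted_dense h : along_curves D h ->
  (forall p, p \in D -> yprod p != 0 -> h p = 0) ->
  forall p, p \in D -> h p = 0.
Proof.
apply: danielewski_of_dense => // y.
  exact: admissible_eq0 admissible_twisted.
exact: admissible_eq1 admissible_twisted.
Qed.

(** Over a point y with Y not 0 the fibre of Z' is the affine line with
    coordinate z. *)
Definition fibre_point (y : 'I_m -> K) (z : K) :=
  mkp (split_form lc rs C.@[y] z / (\prod_i y i) ^+ 3) y z.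

Lemma fibre_point_in y z : \prod_i y i != 0 -> fibre_point y z \in D.
Proof.
by move=> y0; rewrite in_twisted /yprod !mkpE mulfVK // expf_neq0.
Qed.

Lemma fibre_point_eta p : p \in D -> yprod p != 0 ->
  fibre_point (py p) (pz p) = p.
Proof.
move=> pD p0; rewrite -[RHS]mkp_eta; congr mkp.
by move: pD; rewrite in_twisted => /eqP <-; rewrite mulfK // expf_neq0.
Qed.

(** For each root a the variety contains the affine space x = 0, z = a C(y),
    which also meets the divisor Y = 0. *)
Definition section_point (a : K) (y : 'I_m -> K) := mkp 0 y (a * C.@[y]).

Lemma section_point_in a y : a \in rs -> section_point a y \in D.
Proof.
move=> ars; rewrite in_twisted !mkpE mul0r /split_form (big_rem a) //=.
by rewrite subrr mul0r mulr0.
Qed.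

Lemma section_fibre a y : a \in rs -> \prod_i y i != 0 ->
  section_point a y = fibre_point y (a * C.@[y]).
Proof.
move=> ars y0; have := fibre_point_eta (section_point_in y ars).
by rewrite /yprod !mkpE => ->.
Qed.

(** A second copy of the affine space, at distance Y^3 from the section of the
    root a; it measures the slope of a fibrewise affine map with a denominator
    Y^3. *)
Definition thick_section a y :=
  mkp (lc * \prod_(b <- rem a rs) (a * C.@[y] + (\prod_i y i) ^+ 3 - b *
    C.@[y]))
      y (a * C.@[y] + (\prod_i y i) ^+ 3).

Lemma thick_section_in a y : a \in rs -> thick_section a y \in D.
Proof.
move=> ars; rewrite in_twisted /yprod !mkpE /split_form (big_rem a ars) /=.
by apply/eqP; ring.
Qed.

Lemma thick_section_fibre a y : a \in rs -> \prod_i y i != 0 ->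
  thick_section a y = fibre_point y (a * C.@[y] + (\prod_i y i) ^+ 3).
Proof.
move=> ars y0; have := fibre_point_eta (thick_section_in y ars).
by rewrite /yprod !mkpE => ->.
Qed.

Lemma univariate_C (y : K -> 'I_m -> K) :
  (forall i, univariate (y^~ i)) -> univariate (fun t => C.@[y t]).
Proof. by move=> yU; apply: (fa_meval (univariate_algebra K)). Qed.

Lemma section_curve a (y : K -> 'I_m -> K) :
  (forall i, univariate (y^~ i)) ->
  forall j, univariate (fun t => section_point a (y t) ord0 j).
Proof.
move=> yU; have UA := univariate_algebra K; have UC := univariate_C yU.
by apply: (fa_mkp UA); falg UA.
Qed.

Lemma thick_section_curve a (y : K -> 'I_m -> K) :
  (forall i, univariate (y^~ i)) ->
  forall j, univariate (fun t => thick_section a (y t) ord0 j).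
Proof.
move=> yU; have UA := univariate_algebra K; have UC := univariate_C yU.
have UY : univariate (fun t => \prod_i y t i) by exact: (fa_prod UA).
apply: (fa_mkp UA) => //; last by falg UA.
apply: (fa_mul UA); first exact: (fa_cst UA).
by apply: (fa_prod UA) => b; falg UA.
Qed.

Lemma fibre_curve y j : univariate (fun z => fibre_point y z ord0 j).
Proof.
have UA := univariate_algebra K; have Uid := univariate_id K.
move: j; apply: (fa_mkp UA) => //; last by move=> i; falg UA.
apply: (fa_mul UA); last exact: (fa_cst UA).
by apply: fa_split_form; falg UA.
Qed.

(** An invertible polynomial in one variable is constant. Off Y = 0 every
    point is joined to a section by its fibre, and the points of a section are
    joined by lines; density does the rest. *)
Lemma invertible_constant (U W : 'rV[K]_V -> K) :
  along_curves D U -> along_curves D W ->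
  (forall p, p \in D -> yprod p != 0 -> U p * W p = 1) ->
  exists c, forall p, p \in D -> U p = c.
Proof.
move=> UU WU UW; have UA := univariate_algebra K; have Uid := univariate_id K.
have [a ars] : exists a, a \in rs.
  by case: (rs) rs_size => // a s _; exists a; rewrite mem_head.
have const (g : K -> 'rV[K]_V) (e : {poly K}) : e != 0 ->
    (forall j, univariate (fun t => g t ord0 j)) -> (forall t, g t \in D) ->
    (forall t, e.[t] != 0 -> yprod (g t) != 0) ->
    forall t t', U (g t) = U (g t').
  move=> e0 gU gD gY; have [u uE] := UU g gU gD; have [w wE] := WU g gU gD.
  have [c cE] : exists c, u = c%:P.
    apply: (poly_unit_constant (v := w) e0) => t et.
    by rewrite -uE -wE; apply: UW (gD t) (gY t et).
  move=> t t'; have h s : U (g s) = c.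
    by have := uE s; rewrite /= => ->; rewrite cE hornerC.
  by rewrite !h.
have UAD := along_curves_algebra D.
exists (U (section_point a (fun=> 1))) => p pD; apply/eqP; rewrite -subr_eq0.
apply/eqP; move: p pD; apply: (@twisted_dense
  (fun p => U p - U (section_point a (fun=> 1)))) => [|p pD p0].
  by falg UAD.
apply/eqP; rewrite subr_eq0; apply/eqP.
rewrite -[in LHS](fibre_point_eta pD p0).
rewrite (const (fibre_point (py p)) 1 (oner_neq0 _) _ _ _ _ (a * C.@[py p])).
- have -> : fibre_point (py p) (a * C.@[py p]) = section_point a (py p).
    by rewrite section_fibre.
  pose y t i := 1 + t * (py p i - 1).
  have -> : section_point a (py p) = section_point a (y 1).
    congr section_point; apply: functional_extensionality => i.
    by rewrite /y mul1r addrC subrK.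
  have -> : (fun=> 1) = y 0.
    by apply: functional_extensionality => i; rewrite /y mul0r addr0.
  apply: (const (fun t => section_point a (y t))
    (\prod_i (1 + 'X * (py p i - 1)%:P))) => [|||t].
  + apply/prodf_neq0 => i _; apply/eqP => h.
    by have := congr1 (horner^~ 0) h; rewrite /= !hornerE => /eqP; rewrite
      oner_eq0.
  + by apply: section_curve => i; rewrite /y; falg UA.
  + by move=> t; exact: section_point_in.
  + rewrite /yprod mkpE horner_prod (eq_bigr (y t)) // => i _.
    by rewrite !hornerE.
- by move=> j; exact: fibre_curve.
- by move=> t; exact: fibre_point_in.
- by move=> t _; rewrite /yprod mkpE.
Qed.

Context (mu : K -> 'rV[K]_V -> 'rV[K]_V).
Hypothesis mu_flow : polynomial_flow lc rs (ymon K m ^+ 3) C mu.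

Let muD (s : K) p : s != 0 -> p \in D -> mu s p \in D.
Proof. by case: mu_flow => h _ _ _; exact: h. Qed.
Let mu1 p : p \in D -> mu 1 p = p.
Proof. by case: mu_flow => _ h _ _; exact: h. Qed.
Let muM (s t : K) p : s != 0 -> t != 0 -> p \in D -> mu (s * t) p = mu s (mu t
  p).
Proof. by case: mu_flow => _ _ h _; exact: h. Qed.

Lemma flowK (s : K) p : s != 0 -> p \in D -> mu s^-1 (mu s p) = p.
Proof. by move=> s0 pD; rewrite -muM ?invr_eq0 // mulVf // mu1. Qed.

Lemma flow_along_curves (s : K) j : s != 0 ->
  along_curves D (fun p => mu s p ord0 j).
Proof.
move=> s0 g gU gD; have [_ _ _ [e [R RE]]] := mu_flow.
have UA := univariate_algebra K.
apply: (fa_eq (f := fun t => s ^- e *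
  \sum_(i < size (R j)) ((R j)`_i).@[g t ord0] * s ^+ i)).
  apply: (fa_mul UA); first exact: (fa_cst UA).
  apply: (fa_sum UA) => i; apply: (fa_mul UA); last exact: (fa_cst UA).
  by apply: (fa_meval UA).
move=> t; rewrite /=; apply: (canLR (mulKf (expf_neq0 e s0))).
rewrite RE // (@horner_coef_wide _ (size (R j))) ?size_poly //.
by apply: eq_bigr => i _; rewrite coef_map.
Qed.

Lemma along_curves_flow (s : K) h : s != 0 -> along_curves D h ->
  along_curves D (fun p => h (mu s p)).
Proof.
move=> s0 hU g gU gD; apply: (hU (fun t => mu s (g t))) => [j|t].
  exact: (@flow_along_curves s j s0 g gU gD).
exact: muD.
Qed.

(** By [flow_preserves_order] every monomial of the expansion of y_i o mu_s
    contains y_i. *)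
Lemma flow_divides_y i (s : K) : s != 0 ->
  exists2 U, along_curves D U & forall p, p \in D ->
    py (mu s p) i = py p i * U p.
Proof.
move=> s0; have rs_gt0 : (0 < size rs)%N by apply: ltnW.
have [e [N [S [Sb SE]]]] := flow_expansion lc0 rs_gt0 mu_flow.
have nopole := flow_preserves_order charK0 lc0 rs_uniq rs_size muD mu1 muM Sb
  SE.
pose Q n := \sum_(k <- msupp (S (iy i) n)) (S (iy i) n)@_k *: 'X_[k - U_(iy i)].
have QE n p : (S (iy i) n).@[p] = p (iy i) * (Q n).@[p].
  rewrite [in LHS](mpolyE (S (iy i) n)) /Q !rmorph_sum mulr_sumr big_seq
    [RHS]big_seq.
  apply: eq_bigr => k kS /=; rewrite !mevalZ mulrCA; congr (_ * _).
  have ki : (U_(iy i) <= k)%MM.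
    apply/mnm_lepP => j; rewrite mnm1E; case: eqP => // <-.
    have := nopole i (iy i) n k kS; rewrite {1}/pole_weight.
    rewrite (inj_eq (@lshift_inj _ _)) eq_rlshift eqxx /mweight.
    rewrite (bigD1 (iy i)) //= {1}/pole_weight (inj_eq (@lshift_inj _ _)).
    rewrite eq_rlshift eqxx mul1r => h.
    have : \sum_(j0 | j0 != iy i) pole_weight i j0 * (k j0)%:Z <= 0.
      apply: sumr_le0 => j0 /negPf j0i; rewrite /pole_weight j0i.
      by case: ifP; lia.
    by move=> h2; have := le_trans h (lerD (lexx _) h2); lia.
  by rewrite -{1}(submK ki) mpolyXD mevalM mevalXU mulrC.
exists (fun p => s ^- e * (1 + \sum_(n < N) (s - 1) ^+ n.+1 * (Q n).@[p ord0])).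
  have AC := along_curves_algebra D.
  apply: (fa_mul AC); first exact: (fa_cst AC).
  apply: (fa_add AC); first exact: (fa_cst AC).
  apply: (fa_sum AC) => n; apply: (fa_mul AC); first exact: (fa_cst AC).
  exact: along_curves_meval.
move=> p pD; rewrite mulrCA; apply: (canRL (mulKf (expf_neq0 e s0))).
rewrite SE // mulrDr mulr1 mulr_sumr; congr (_ + _).
by apply: eq_bigr => n _; rewrite QE mulrCA.
Qed.

(** The quotient y_i o mu_s / y_i has the inverse given by s^-1, so it is
    constant. *)
Lemma flow_scales_y (s : K) : s != 0 -> exists chi : 'I_m -> K,
  forall p, p \in D -> py (mu s p) = fun i => chi i * py p i.
Proof.
move=> s0; suff /fin_all_exists[chi chiE] i :
    exists c, forall p, p \in D -> py (mu s p) i = c * py p i.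
  exists chi => p pD; apply: functional_extensionality => i; exact: chiE.
have [U UU UE] := flow_divides_y i s0.
have s0' : s^-1 != 0 by rewrite invr_eq0.
have [W WU WE] := flow_divides_y i s0'.
have [|c cE] := invertible_constant UU (along_curves_flow s0 WU).
  move=> p pD p0; have yi : py p i != 0 by move: p0; rewrite yprod_neq0 =>
    /forallP.
  apply: (mulfI yi); rewrite mulrA -UE // -WE ?flowK ?mulr1 //; exact: muD.
by exists c => p pD; rewrite UE // cE // mulrC.
Qed.


Definition scales_y (s : K) (chi : 'I_m -> K) : Prop :=
  forall p, p \in D -> py (mu s p) = fun i => chi i * py p i.

Lemma scales_yV (s : K) chi chi' : s != 0 ->
  scales_y s chi -> scales_y s^-1 chi' -> forall i, chi' i * chi i = 1.
Proof.
move=> s0 sE s'E i.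
have [a [_ [ars _ _]]] := two_roots.
have pD := section_point_in (fun=> 1) ars.
have := s'E _ (muD s0 pD); rewrite flowK // sE // mkpE.
by move/(congr1 (fun g => g i)); rewrite mulr1.
Qed.

Lemma scales_y_neq0 (s : K) chi : s != 0 -> scales_y s chi ->
  forall i, chi i != 0.
Proof.
move=> s0 sE i; have s0' : s^-1 != 0 by rewrite invr_eq0.
have [chi' s'E] := flow_scales_y s0'.
apply/eqP => c0; have /eqP := scales_yV s0 sE s'E i.
by rewrite c0 mulr0 eq_sym oner_eq0.
Qed.

Definition slope_z (s : K) y :=
  pz (mu s (fibre_point y 1)) - pz (mu s (fibre_point y 0)).
Definition offset_z (s : K) y := pz (mu s (fibre_point y 0)).

Lemma flow_fibre (s : K) chi y z : s != 0 -> scales_y s chi ->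
  \prod_i y i != 0 -> mu s (fibre_point y z) =
  fibre_point (fun i => chi i * y i) (pz (mu s (fibre_point y z))).
Proof.
move=> s0 sE y0; have pD := fibre_point_in z y0.
have := fibre_point_eta (muD s0 pD).
rewrite /yprod sE // mkpE => <- //.
  by rewrite mkpE.
by rewrite big_split mulf_neq0 //; apply/prodf_neq0 => i _; apply:
  scales_y_neq0 sE i.
Qed.

Lemma prod_scale (chi y : 'I_m -> K) : (forall i, chi i != 0) ->
  \prod_i y i != 0 -> \prod_i (chi i * y i) != 0.
Proof.
by move=> c0 y0; rewrite big_split mulf_neq0 //; apply/prodf_neq0 => i _.
Qed.

Lemma flow_fibre_poly (s : K) y : s != 0 -> \prod_i y i != 0 ->
  exists q : {poly K}, forall z, pz (mu s (fibre_point y z)) = q.[z].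
Proof.
move=> s0 y0; apply: (@flow_along_curves s iz s0 (fibre_point y)).
  by move=> j; exact: fibre_curve.
by move=> z; exact: fibre_point_in.
Qed.

(** A polynomial bijection of the line with polynomial inverse has degree 1.
    *)
Lemma flow_fibre_affine (s : K) y z : s != 0 -> \prod_i y i != 0 ->
  pz (mu s (fibre_point y z)) = slope_z s y * z + offset_z s y.
Proof.
move=> s0 y0; have [chi sE] := flow_scales_y s0.
have cy0 := prod_scale (scales_y_neq0 s0 sE) y0.
have [q qE] := flow_fibre_poly s0 y0.
have s0' : s^-1 != 0 by rewrite invr_eq0.
have [q' q'E] := flow_fibre_poly s0' cy0.
have qq : q' \Po q = 'X.
  apply: (poly_eq_cofinite (oner_neq0 _)) => t _.
  rewrite horner_comp hornerX -qE -q'E -flow_fibre // flowK ?mkpE //.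
  exact: fibre_point_in.
have := size_comp_poly q' q; rewrite qq size_polyX /= => /esym/eqP.
rewrite muln_eq1 => /andP[_ /eqP sq].
have {}sq : size q = 2%N by case: (size q) sq => // n /= ->.
have qz t : q.[t] = q`_0 + q`_1 * t.
  by rewrite horner_coef sq big_ord_recl big_ord1 expr0 mulr1.
by rewrite /slope_z /offset_z !qE !qz; ring.
Qed.

Lemma slope_zV (s : K) chi y : s != 0 -> scales_y s chi ->
  \prod_i y i != 0 -> slope_z s^-1 (fun i => chi i * y i) * slope_z s y = 1.
Proof.
move=> s0 sE y0; have cy0 := prod_scale (scales_y_neq0 s0 sE) y0.
have s0' : s^-1 != 0 by rewrite invr_eq0.
have h z : slope_z s^-1 (fun i => chi i * y i) * (slope_z s y * z + offset_z s
  y)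
    + offset_z s^-1 (fun i => chi i * y i) = z.
  rewrite -!flow_fibre_affine // -flow_fibre // flowK ?mkpE //.
  exact: fibre_point_in.
have := congr1 (fun w => w - 0) (h 1); rewrite -[X in _ - X = _](h 0) subr0.
by move=> <-; ring.
Qed.

Definition ray (b : 'I_m -> K) (t : K) i := t * b i.

Lemma prod_ray b t : \prod_i ray b t i = t ^+ m * \prod_i b i.
Proof. by rewrite big_split prodr_const card_ord. Qed.

Lemma prod_ray_neq0 b t : t != 0 -> \prod_i b i != 0 ->
  \prod_i ray b t i != 0.
Proof. by move=> t0 b0; rewrite prod_ray mulf_neq0 // expf_neq0. Qed.

Lemma univariate_ray b i : univariate ((ray b)^~ i).
Proof.
have UA := univariate_algebra K; have Uid := univariate_id K.
by rewrite /ray; falg UA.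
Qed.

Definition ray_poly (b : 'I_m -> K) : {poly K} :=
  1 + (\prod_i b i) *: ('X^m * (1 + (\sum_(i | J i) b i) *: 'X)).

Lemma ray_polyE b t : (ray_poly b).[t] = C.@[ray b t].
Proof.
rewrite meval_twisted prod_ray /ray -mulr_sumr !hornerE.
by rewrite /=; ring.
Qed.

Lemma ray_poly0 b : (ray_poly b).[0] = 1.
Proof.
by rewrite !hornerE /= expr0n gtn_eqF // mulr0 mul0r addr0.
Qed.

Section Ray.
Context (s : K) (chi b : 'I_m -> K).
Hypotheses (s0 : s != 0) (sE : scales_y s chi) (b0 : \prod_i b i != 0).

(** The differences of two sections bound the slope times C, the thick section
    bounds the slope times Y^3, and C is coprime to h on the ray; so the slope
    has no pole at h = 0. *)
Lemma slope_z_ray_poly : exists A : {poly K},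
  forall t, t != 0 -> slope_z s (ray b t) = A.[t].
Proof.
have [a1 [a2 [a1rs a2rs a12]]] := two_roots.
have UC := @flow_along_curves s iz s0.
have sec a : a \in rs -> exists h : {poly K}, forall t,
    pz (mu s (section_point a (ray b t))) = h.[t].
  move=> ars; apply: UC => [|t]; last exact: section_point_in.
  by apply: section_curve => i; exact: univariate_ray.
have [h1 h1E] := sec _ a1rs; have [h2 h2E] := sec _ a2rs.
have [k1 k1E] : exists h : {poly K}, forall t,
    pz (mu s (thick_section a1 (ray b t))) = h.[t].
  apply: UC => [|t]; last exact: thick_section_in.
  by apply: thick_section_curve => i; exact: univariate_ray.
have hE t a : t != 0 -> a \in rs -> pz (mu s (section_point a (ray b t))) =
    slope_z s (ray b t) * (a * C.@[ray b t]) + offset_z s (ray b t).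
  by move=> t0 ars; rewrite section_fibre ?flow_fibre_affine // prod_ray_neq0.
have kE t : t != 0 -> k1.[t] - h1.[t] =
    slope_z s (ray b t) * (t ^+ m * \prod_i b i) ^+ 3.
  move=> t0; rewrite -k1E -h1E hE // thick_section_fibre ?prod_ray_neq0 //.
  by rewrite flow_fibre_affine ?prod_ray_neq0 // prod_ray; ring.
have ccE t : t != 0 -> h1.[t] - h2.[t] =
    slope_z s (ray b t) * ((a1 - a2) * (ray_poly b).[t]).
  by move=> t0; rewrite -h1E -h2E !hE // ray_polyE; ring.
have rel : (h1 - h2) * ('X^(m * 3) * ((\prod_i b i) ^+ 3)%:P) =
    (k1 - h1) * ((a1 - a2) *: ray_poly b).
  apply: (poly_eq_cofinite (negbT (polyX_eq0 K))) => t; rewrite hornerX => t0.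
  rewrite !(hornerM, hornerD, hornerN) hornerXn hornerC hornerZ kE // ccE //.
  by rewrite exprM; ring.
have a120 : a1 - a2 != 0 by rewrite subr_eq0.
have : 'X^(m * 3) %| k1 - h1.
  rewrite -(@Gauss_dvdpl _ _ ((a1 - a2) *: ray_poly b)).
    by rewrite -rel mulrA mulrAC dvdp_mull.
  by apply: coprimep_Xn; rewrite hornerZ ray_poly0 mulr1.
case/dvdpP => A AE; exists (((\prod_i b i) ^+ 3)^-1 *: A) => t t0.
have := kE t t0; rewrite -hornerN -hornerD AE hornerM hornerXn hornerZ exprM
  exprMn.
have b30 : (\prod_i b i) ^+ 3 != 0 by rewrite expf_neq0.
have t30 : (t ^+ m) ^+ 3 != 0 by rewrite !expf_neq0.
move: b30 t30; move: ((\prod_i b i) ^+ 3) ((t ^+ m) ^+ 3) => u v u0 v0.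
move=> h; have -> : A.[t] = slope_z s (ray b t) * u.
  by apply: (mulIf v0); rewrite h; ring.
by rewrite mulrC mulfK.
Qed.

End Ray.


Lemma ray_scale (chi b : 'I_m -> K) t :
  ray (fun i => chi i * b i) t = fun i => chi i * ray b t i.
Proof. by apply: functional_extensionality => i; rewrite /ray mulrCA. Qed.

Lemma slope_z_ray (s : K) chi b t : s != 0 -> scales_y s chi ->
  \prod_i b i != 0 -> t != 0 -> slope_z s (ray b t) = slope_z s b.
Proof.
move=> s0 sE b0 t0; have cb0 := prod_scale (scales_y_neq0 s0 sE) b0.
have s0' : s^-1 != 0 by rewrite invr_eq0.
have [A AE] := slope_z_ray_poly s0 b0.
have [A' A'E] := slope_z_ray_poly s0' cb0.
have [c cE] : exists c, A = c%:P.
  apply: (@poly_unit_constant _ _ A' _ (negbT (polyX_eq0 K))) => u.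
  rewrite hornerX => u0; rewrite -AE // -A'E // mulrC ray_scale slope_zV //.
  exact: prod_ray_neq0.
have -> : b = ray b 1.
  by apply: functional_extensionality => i; rewrite /ray mul1r.
rewrite {1}/ray (_ : (fun i => t * ray b 1 i) = ray b t); last first.
  by apply: functional_extensionality => i; rewrite /ray mul1r.
by rewrite !AE ?oner_neq0 // cE !hornerC.
Qed.

Lemma ray_poly_coef b : ((ray_poly b)`_m = \prod_i b i) *
  ((ray_poly b)`_m.+1 = (\prod_i b i) * \sum_(i | J i) b i).
Proof.
rewrite /ray_poly !coefD !coef1 !coefZ !coefXnM ltnn ltnNge leqnSn /=.
rewrite subnn subSnn !coefD !coefZ !coef1 !coefX /= gtn_eqF //.
by split; rewrite !(mulr0, mulr1, addr0, add0r).
Qed.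

(** The image of a section satisfies the equation of Z', in which x is
    regular: therefore h^(3m) divides the product over the roots, hence one
    factor of it. *)
Lemma ray_section (s : K) chi b a : s != 0 -> scales_y s chi ->
  \prod_i b i != 0 -> a \in rs ->
  exists h a', [/\ a' \in rs,
    forall t, pz (mu s (section_point a (ray b t))) = h.[t]
    & 'X^(m * 3) %| h - a' *: ray_poly (fun i => chi i * b i)].
Proof.
move=> s0 sE b0 ars; have cb0 := prod_scale (scales_y_neq0 s0 sE) b0.
have curve j : univariate (fun t => mu s (section_point a (ray b t)) ord0 j).
  apply: (@flow_along_curves s j s0 (fun t => section_point a (ray b t))).
    by apply: section_curve => i; exact: univariate_ray.
  by move=> t; exact: section_point_in.
have [h hE] := curve iz; have [x xE] := curve ix.
have N0 : (0 < m * 3)%N by rewrite muln_gt0 m_gt0.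
have [|a' a'rs dvd] :=
    dvdp_Xn_factor N0 (ray_poly0 (fun i => chi i * b i)) lc0 rs_uniq (h := h).
  apply/dvdpP; exists (x * ((\prod_i (chi i * b i)) ^+ 3)%:P).
  apply: (poly_eq_cofinite (oner_neq0 _)) => t _.
  have := muD s0 (section_point_in (ray b t) ars).
  have yE : py (mu s (section_point a (ray b t))) =
      ray (fun i => chi i * b i) t.
    by rewrite sE ?section_point_in // mkpE -ray_scale.
  rewrite in_twisted /yprod yE prod_ray -ray_polyE => /eqP.
  rewrite [px _]xE [pz _]hE hornerZ horner_prod !hornerM hornerXn hornerC exprM.
  rewrite exprMn mulrA [X in X = _]mulrAC => ->; congr (_ * _).
  by apply: eq_bigr => c _; rewrite hornerD hornerN hornerZ.
by exists h, a'.
Qed.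

(** Subtracting the congruences of two sections gives a congruence modulo
    h^(3m) between multiples of C(h b) and C(h chi b). The coefficients in the
    degrees 0, m and m + 1 are compared; 3m is larger than m + 1. *)
Lemma ray_slope (s : K) chi b a1 a2 : s != 0 -> scales_y s chi ->
  \prod_i b i != 0 -> a1 \in rs -> a2 \in rs -> a1 != a2 ->
  [/\ exists a1' a2', [/\ a1' \in rs, a2' \in rs &
         slope_z s b * (a1 - a2) = a1' - a2'],
      \prod_i chi i = 1 & \sum_(i | J i) chi i * b i = \sum_(i | J i) b i].
Proof.
move=> s0 sE b0 a1rs a2rs a12.
have [h1 [c1 [c1rs h1E dvd1]]] := ray_section s0 sE b0 a1rs.
have [h2 [c2 [c2rs h2E dvd2]]] := ray_section s0 sE b0 a2rs.
set cb := fun i => chi i * b i in dvd1 dvd2.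
have cb0 : \prod_i cb i != 0 := prod_scale (scales_y_neq0 s0 sE) b0.
have hh : h1 - h2 = (slope_z s b * (a1 - a2)) *: ray_poly b.
  apply: (poly_eq_cofinite (negbT (polyX_eq0 K))) => t; rewrite hornerX => t0.
  have y0 := prod_ray_neq0 t0 b0.
  rewrite hornerZ hornerD hornerN -h1E -h2E !section_fibre // ray_polyE.
  by rewrite !flow_fibre_affine // (slope_z_ray s0 sE) //; ring.
have dvd : 'X^(m * 3) %| (slope_z s b * (a1 - a2)) *: ray_poly b
                         - (c1 - c2) *: ray_poly cb.
  have -> : (slope_z s b * (a1 - a2)) *: ray_poly b - (c1 - c2) *: ray_poly cb
      = (h1 - c1 *: ray_poly cb) - (h2 - c2 *: ray_poly cb).
    by rewrite -hh scalerBl; ring.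
  by rewrite dvdp_sub.
have co i : (i < m * 3)%N -> slope_z s b * (a1 - a2) * (ray_poly b)`_i
    = (c1 - c2) * (ray_poly cb)`_i.
  move=> iN; have /eqP := dvdp_Xn_coef dvd iN.
  by rewrite coefB !coefZ subr_eq0 => /eqP.
have e0 : slope_z s b * (a1 - a2) = c1 - c2.
  have := co 0%N; rewrite -!horner_coef0 !ray_poly0 !mulr1; apply.
  by rewrite muln_gt0 m_gt0.
have k0 : slope_z s b * (a1 - a2) != 0.
  apply: mulf_neq0; last by rewrite subr_eq0.
  apply/eqP => z0.
  by have /eqP := slope_zV s0 sE b0; rewrite z0 mulr0 eq_sym oner_eq0.
have mN : (m < m * 3)%N by clear -m_gt0; lia.
have m1N : (m.+1 < m * 3)%N by clear -m_gt0; lia.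
have em : slope_z s b * (a1 - a2) * (\prod_i b i) =
          slope_z s b * (a1 - a2) * (\prod_i cb i).
  by have := co m mN; rewrite -e0 !ray_poly_coef.
have em1 : slope_z s b * (a1 - a2) * ((\prod_i b i) * \sum_(i | J i) b i) =
           slope_z s b * (a1 - a2) * ((\prod_i cb i) * \sum_(i | J i) cb i).
  by have := co m.+1 m1N; rewrite -e0 !ray_poly_coef.
have pcb : \prod_i cb i = \prod_i b i by rewrite (mulfI k0 em).
have pc : \prod_i chi i = 1.
  by apply: (mulIf b0); rewrite mul1r -[RHS]pcb -big_split.
split=> //; first by exists c1, c2.
have := mulfI k0 em1; rewrite pcb => /(mulfI b0) e.
by rewrite e.
Qed.

(** The relation sum chi_i b_i = sum b_i over J holds for all b with nonzero
    entries; b = (1, .., 1) and the same with one entry 2 separate the chi_i.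
    *)
Lemma flow_torus_char (s : K) chi : s != 0 -> scales_y s chi -> torus_char J
  chi.
Proof.
move=> s0 sE; have [a1 [a2 [a1rs a2rs a12]]] := two_roots.
have one0 : \prod_(i < m) (1 : K) != 0 by rewrite big1 ?oner_eq0.
have [_ pc sc] := ray_slope s0 sE one0 a1rs a2rs a12.
(* The vector with the entry 2 at i and 1 elsewhere. *)
split=> // i Ji; pose b j : K := 1 + (j == i)%:R.
have two0 : 2 != 0 :> K by exact: (natr_neq0 charK0 1).
have b0 : \prod_j b j != 0.
  apply/prodf_neq0 => j _; rewrite /b; case: (j =P i) => _ //=.
  by rewrite addr0 oner_eq0.
have [_ _] := ray_slope s0 sE b0 a1rs a2rs a12.
rewrite (bigD1 i) //= [in RHS](bigD1 i) //= /b eqxx.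
rewrite (eq_bigr (fun j => chi j * 1)) => [|j /andP[_ /negPf ->]]; last first.
  by rewrite /= ?mulr0n addr0.
rewrite [in RHS](eq_bigr (fun j => 1)) => [|j /andP[_ /negPf ->]]; last first.
  by rewrite /= ?mulr0n addr0.
move: sc; rewrite (bigD1 i) //= [in RHS](bigD1 i) //= => sc.
rewrite /=; move: sc => /=.
move: (\sum_(_ < _ | _) chi _ * 1) (\sum_(_ < _ | _) 1) => u v h1 h2.
have -> : chi i = (chi i * (1 + 1) + u) - (chi i * 1 + u) by ring.
by rewrite h1 h2; ring.
Qed.

Lemma slope_z_finite : exists L : seq K,
  forall (s : K) y, s != 0 -> \prod_i y i != 0 -> slope_z s y \in L.
Proof.
have [a1 [a2 [a1rs a2rs a12]]] := two_roots.
exists [seq (c1 - c2) / (a1 - a2) | c1 <- rs, c2 <- rs] => s y s0 y0.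
have [chi sE] := flow_scales_y s0.
have [[c1 [c2 [c1rs c2rs e]]] _ _] := ray_slope s0 sE y0 a1rs a2rs a12.
apply/allpairsP; exists (c1, c2); split=> //=.
by rewrite -e mulfK // subr_eq0.
Qed.

Hypothesis mu_scale : forall chi (s : K) p, torus_char J chi -> s != 0 -> p \in
  D ->
  mu s (scale chi p) = scale chi (mu s p).

Lemma torus_char_twisted chi (y : 'I_m -> K) : torus_char J chi ->
  (\prod_i (chi i * y i) = \prod_i y i) *
  (C.@[fun i => chi i * y i] = C.@[y]).
Proof.
move=> [pc Jc]; have pcy : \prod_i (chi i * y i) = \prod_i y i.
  by rewrite big_split /= pc mul1r.
split=> //; rewrite !meval_twisted pcy; congr (1 + _ * (1 + _)).
by apply: eq_bigr => i /Jc ->; rewrite mul1r.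
Qed.

Lemma scale_in chi p : torus_char J chi -> p \in D -> scale chi p \in D.
Proof.
move=> tc; rewrite !in_twisted /yprod /scale !mkpE.
by rewrite !(torus_char_twisted _ tc).
Qed.

Lemma scale_fibre chi y z : torus_char J chi ->
  scale chi (fibre_point y z) = fibre_point (fun i => chi i * y i) z.
Proof.
move=> tc; rewrite /scale /fibre_point !mkpE.
by rewrite !(torus_char_twisted _ tc).
Qed.

Lemma torus_char_neq0 (chi : 'I_m -> K) : torus_char J chi -> forall i, chi i
  != 0.
Proof.
move=> [pc _] i; apply/eqP => ci0; have /eqP := pc.
by rewrite (bigD1 i) //= ci0 mul0r eq_sym oner_eq0.
Qed.

Lemma flow_fibre_scaled chi (s : K) y z : torus_char J chi -> s != 0 ->
  \prod_i y i != 0 ->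
  pz (mu s (fibre_point (fun i => chi i * y i) z)) = pz (mu s (fibre_point y
    z)).
Proof.
move=> tc s0 y0; rewrite -scale_fibre // mu_scale ?fibre_point_in //.
by rewrite mkpE.
Qed.

Lemma flow_fibre_comp (s t : K) y z : s != 0 -> t != 0 -> \prod_i y i != 0 ->
  pz (mu (s * t) (fibre_point y z)) =
  slope_z s y * pz (mu t (fibre_point y z)) + offset_z s y.
Proof.
move=> s0 t0 y0; have [chi tE] := flow_scales_y t0.
have tc := flow_torus_char t0 tE.
rewrite muM ?fibre_point_in // (flow_fibre _ t0 tE y0) flow_fibre_scaled //.
by rewrite [in RHS]pz_mkp flow_fibre_affine.
Qed.

(** A Laurent polynomial in s with finitely many values is constant; at s = 1
    the slope is 1. *)
Lemma slope_z_one (s : K) y : s != 0 -> \prod_i y i != 0 -> slope_z s y = 1.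
Proof.
move=> s0 y0; have [L LE] := slope_z_finite.
have [_ _ _ [e [R RE]]] := mu_flow.
pose A z := map_poly (meval (fibre_point y z ord0)) (R iz).
have AE t : t != 0 -> t ^+ e * slope_z t y = (A 1 - A 0).[t].
  move=> t0; rewrite /slope_z mulrBr hornerD hornerN /A.
  by rewrite -!RE ?fibre_point_in.
have P0 : \prod_(l <- L) (A 1 - A 0 - l *: 'X^e) = 0.
  apply: (poly_eq0_cofinite (negbT (polyX_eq0 K))) => t; rewrite hornerX => t0.
  apply/eqP; rewrite horner_prod prodf_seq_eq0; apply/hasP.
  exists (slope_z t y); first exact: LE.
  by rewrite /= hornerD hornerN -AE // hornerZ hornerXn mulrC subrr.
move/eqP: P0; rewrite prodf_seq_eq0 => /hasP[l lL /= /eqP lE].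
have slope_l t : t != 0 -> slope_z t y = l.
  move=> t0; apply: (mulfI (expf_neq0 e t0)); rewrite AE //.
  by move/eqP: lE; rewrite subr_eq0 => /eqP ->; rewrite hornerZ hornerXn mulrC.
rewrite slope_l // -(slope_l 1 (oner_neq0 K)) /slope_z !mu1 ?fibre_point_in //.
by rewrite !mkpE subr0.
Qed.

(** With slope 1 the offset g satisfies g(s^2) = 2 g(s). Comparing leading
    coefficients of the Laurent polynomials on both sides gives 0. *)
Lemma offset_z_zero (s : K) y : s != 0 -> \prod_i y i != 0 ->
  offset_z s y = 0.
Proof.
move=> s0 y0; have [_ _ _ [e [R RE]]] := mu_flow.
pose G := map_poly (meval (fibre_point y 0 ord0)) (R iz).
have GE t : t != 0 -> t ^+ e * offset_z t y = G.[t].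
  by move=> t0; rewrite /G -RE ?fibre_point_in.
(* G(s^2) = s^(2e) g(s^2) = 2 s^(2e) g(s) = 2 s^e G(s). *)
have rel : G \Po 'X^2 = 2 *: (G * 'X^e).
  apply: (poly_eq_cofinite (negbT (polyX_eq0 K))) => t; rewrite hornerX => t0.
  rewrite horner_comp hornerXn hornerZ hornerM hornerXn -!GE ?expf_neq0 //.
  rewrite expr2 {1}/offset_z flow_fibre_comp // slope_z_one // -/(offset_z t y).
  by rewrite exprMn; ring.
have G0 : G = 0.
  apply/eqP; rewrite -lead_coef_eq0; apply/eqP.
  have := congr1 lead_coef rel.
  rewrite lead_coef_comp ?size_polyXn // lead_coefXn expr1n mulr1.
  rewrite lead_coefZ lead_coefM lead_coefXn mulr1 mulrC mulr2n mulrDr mulr1.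
  by move=> /eqP; rewrite -subr_eq0 opprD addNKr oppr_eq0 => /eqP.
by apply: (mulfI (expf_neq0 e s0)); rewrite GE // G0 horner0 mulr0.
Qed.

(** On Y != 0 the flow scales y and fixes z, and x is determined by the
    equation. *)
Theorem flow_in_torus (s : K) : s != 0 ->
  exists chi, torus_char J chi /\ forall p, p \in D -> mu s p = scale chi p.
Proof.
move=> s0; have [chi sE] := flow_scales_y s0; have tc := flow_torus_char s0 sE.
exists chi; split=> // p0 p0D; apply/rowP => j; apply/eqP; rewrite -subr_eq0.
apply/eqP; move: p0 p0D; apply: (@twisted_dense
  (fun p => mu s p ord0 j - scale chi p ord0 j)) => [|p pD pY].
  have AC := along_curves_algebra D.
  apply: (fa_sub AC); first exact: flow_along_curves.
  apply: (fa_mkp AC); try exact: along_curves_coord.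
  move=> i; apply: (fa_mul AC); first exact: (fa_cst AC).
  exact: along_curves_coord.
apply/eqP; rewrite subr_eq0; apply/eqP.
rewrite -(fibre_point_eta pD pY) scale_fibre // (flow_fibre _ s0 sE) //.
by rewrite flow_fibre_affine // slope_z_one // offset_z_zero // mul1r addr0.
Qed.

End Flows.

(** * One-parameter groups on the cylinder *)

Section LaurentFamilies.
Context (K : fieldType) n (X : {pred 'rV[K]_n}).

Definition laurent_family (h : K * points X -> K) : Prop :=
  exists e (R : {poly {mpoly K[n]}}), forall s u, s != 0 ->
    s ^+ e * h (s, u) = (map_poly (meval (val u ord0)) R).[s].

Lemma laurent_family_algebra : function_algebra laurent_family.
Proof.
split=> [c|f g [e [R fE]] [e' [R' gE]]|f g [e [R fE]] [e' [R' gE]]].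
- exists 0%N, (c%:MP)%:P => s u _.
  by rewrite map_polyC /= hornerC mevalC mul1r.
- exists (e + e')%N, ('X^e' * R + 'X^e * R') => s u s0.
  rewrite rmorphD !rmorphM /= !map_polyXn hornerD !hornerM !hornerXn.
  by rewrite -fE // -gE // exprD; ring.
- exists (e + e')%N, (R * R') => s u s0.
  by rewrite rmorphM hornerM -fE // -gE // exprD /=; ring.
Qed.

Lemma laurent_family_param : laurent_family fst.
Proof.
by exists 0%N, 'X => s u _; rewrite map_polyX hornerX mul1r.
Qed.

Lemma laurent_family_paramV : laurent_family (fun su => su.1^-1).
Proof.
by exists 1%N, 1 => s u s0; rewrite rmorph1 hornerC expr1 divff.
Qed.

Lemma laurent_family_coord j : laurent_family (fun su => val su.2 ord0 j).
Proof.
exists 0%N, ('X_j)%:P => s u _.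
by rewrite map_polyC /= hornerC mevalXU mul1r.
Qed.

Lemma laurent_family_regfun (h : K * points X -> K) s : s != 0 ->
  laurent_family h -> regfun (fun u => h (s, u)).
Proof.
move=> s0 [e [R hE]].
exists ((s ^- e) *: \sum_(i < size R) R`_i * (s ^+ i)%:MP) => u.
rewrite mevalZ; apply: (canRL (mulKf (expf_neq0 e s0))); rewrite hE //.
rewrite (@horner_coef_wide _ (size R)) ?size_poly // rmorph_sum.
by apply: eq_bigr => i _; rewrite /= coef_map mevalM mevalC.
Qed.

End LaurentFamilies.

Section CommutingFlows.
Context (K : closedFieldType) (charK0 : [pchar K] =i pred0) (m : nat).
Hypothesis m_gt0 : (0 < m)%N.
Context (lc : K) (rs : seq K) (J : pred 'I_m).
Hypotheses (lc0 : lc != 0) (rs_uniq : uniq rs) (rs_size : (2 <= size rs)%N).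
Let V := (1 + m + 1)%N.
Let C := 1 + ymon K m * twist K J.
Let D := danielewski_of lc rs (ymon K m ^+ 3) C.
Let X := danielewski_cyl lc rs (ymon K m ^+ 3) C.

Definition diagonal (chi : 'I_m -> K) (t : K) (phi : points X -> points X) :=
  forall u, cbase (phi u) = scale chi (cbase u) /\ cheight (phi u) = t *
    cheight u.

Definition diagonal_torus (phi : points X -> points X) : Prop :=
  exists chi t, [/\ torus_char J chi, t != 0 & diagonal chi t phi].

Definition dilation chi (tc : torus_char J chi) t (u : points X) : points X :=
  mkX (t * cheight u) (scale_in tc (cbase_in u)).

Lemma dilation_diagonal chi (tc : torus_char J chi) t : diagonal chi t
  (dilation tc t).
Proof. by move=> u; rewrite cbase_mkX cheight_mkX. Qed.

Lemma diagonal_unique chi t phi psi :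
  diagonal chi t phi -> diagonal chi t psi -> phi = psi.
Proof.
move=> h1 h2; apply: functional_extensionality => u.
have [a1 b1] := h1 u; have [a2 b2] := h2 u.
by apply: cyl_points_eq; rewrite ?a1 ?b1.
Qed.

Lemma torus_char1 : torus_char J (fun=> 1 : K).
Proof. by split=> //; rewrite big1. Qed.

Lemma scale1 p : scale (fun=> 1) p = p :> 'rV[K]_V.
Proof.
rewrite -[RHS]mkp_eta /scale; congr mkp.
by apply: functional_extensionality => i; rewrite mul1r.
Qed.

Context (lam : K -> points X -> points X).
Hypotheses (lam1 : lam 1 = id)
  (lamM : forall s t : K, s != 0 -> t != 0 -> lam (s * t) = lam s \o lam t)
  (lam_laurent : forall j, laurent_family (fun su => val (lam su.1 su.2) ord0
    j))
  (lam_comm : forall phi (s : K), diagonal_torus phi -> s != 0 ->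
     lam s \o phi = phi \o lam s).

Let stretch t := dilation torus_char1 t.

Lemma stretch_mkX t w p (pD : p \in D) : stretch t (mkX w pD) = mkX (t * w) pD.
Proof.
have [h1 h2] := dilation_diagonal torus_char1 t (mkX w pD).
by rewrite /stretch; apply: cyl_points_eq; rewrite ?h1 ?h2 ?cbase_mkX
  ?cheight_mkX ?scale1.
Qed.

Lemma lam_stretch (s t : K) u : s != 0 -> t != 0 ->
  lam s (stretch t u) = stretch t (lam s u).
Proof.
move=> s0 t0; have tT : diagonal_torus (stretch t).
  by exists (fun=> 1), t; split=> //; [exact: torus_char1 | exact:
    dilation_diagonal].
by have := congr1 (fun h => h u) (lam_comm tT s0).
Qed.

Lemma mkX_eq w p q (pD : p \in D) (qD : q \in D) : p = q -> mkX w pD = mkX w qD.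
Proof. by move=> e; apply: cyl_points_eq; rewrite ?cbase_mkX ?cheight_mkX. Qed.

(** The scaling of w by 2 fixes the points with w = 0, so it fixes their
    images, whose height equals twice itself. *)
Lemma cheight_lam0 (s : K) p (pD : p \in D) : s != 0 -> cheight (lam s (mkX 0
  pD)) = 0.
Proof.
move=> s0; have two0 : 2 != 0 :> K by exact: (natr_neq0 charK0 1).
have := congr1 (@cheight _ _ _ _ _ _) (lam_stretch (mkX 0 pD) s0 two0).
rewrite stretch_mkX mulr0 (dilation_diagonal torus_char1 2 (lam s (mkX 0
  pD))).2.
by rewrite mulr2n mulrDl mul1r => /eqP; rewrite -subr_eq0 opprD addNKr oppr_eq0
  => /eqP.
Qed.

(** The value 0 off Z' is a default: the flow matters on Z' only. *)
Definition zero_section_flow (s : K) (p : 'rV[K]_V) : 'rV[K]_V :=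
  match (p \in D) =P true with
  | ReflectT pD => cbase (lam s (mkX 0 pD))
  | ReflectF _ => 0
  end.

Lemma zero_section_flowE s p (pD : p \in D) :
  zero_section_flow s p = cbase (lam s (mkX 0 pD)).
Proof.
rewrite /zero_section_flow; case: eqP => [pD'|//].
by rewrite (mkX_eq 0 pD' pD).
Qed.

Lemma zero_section_polynomial_flow :
  polynomial_flow lc rs (ymon K m ^+ 3) C zero_section_flow.
Proof.
split=> [s p s0 pD|p pD|s t p s0 t0 pD|].
- by rewrite (zero_section_flowE s pD); exact: cbase_in.
- by rewrite (zero_section_flowE 1 pD) lam1 cbase_mkX.
- rewrite (zero_section_flowE (s * t) pD) (zero_section_flowE t pD) lamM //=.
  have qD := cbase_in (lam t (mkX 0 pD)).
  rewrite (zero_section_flowE s qD); congr (cbase (lam s _)).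
  by apply: cyl_points_eq; rewrite ?cbase_mkX ?cheight_mkX ?cheight_lam0.
have /fin_all_exists[e /fin_all_exists[R RE]] := fun j : 'I_V => lam_laurent
  (lshift 1 j).
(* Substitution of w = 0 in the polynomials of the action. *)
pose lq : (V + 1)%N.-tuple {mpoly K[V]} :=
  [tuple (match split i with inl j => 'X_j | inr _ => 0 end) | i < (V + 1)%N].
(* A common denominator for all coordinates. *)
exists (\sum_j e j)%N, (fun j => 'X^(\sum_(i | i != j) e i) *
  map_poly (comp_mpoly lq) (R j)) => s p j s0 pD.
have -> : map_poly (meval (p ord0)) ('X^(\sum_(i | i != j) e i) *
    map_poly (comp_mpoly lq) (R j)) = 'X^(\sum_(i | i != j) e i) *
    map_poly (meval (val (mkX 0 pD) ord0)) (R j).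
  rewrite rmorphM /= map_polyXn; congr (_ * _).
  apply/polyP => i; rewrite !coef_map /= comp_mpoly_meval.
  apply: meval_eq => k; rewrite tnth_mktuple -{2}(splitK k).
  by case: split => l /=; rewrite ?row_mxEl ?row_mxEr ?mxE ?mevalXU ?meval0.
rewrite hornerM hornerXn -RE // (bigD1 j) //= exprD (zero_section_flowE s pD).
rewrite cbase_coord.
by ring.
Qed.

Lemma zero_section_scale chi (s : K) p : torus_char J chi -> s != 0 -> p \in D
  ->
  zero_section_flow s (scale chi p) = scale chi (zero_section_flow s p).
Proof.
move=> tc s0 pD; have cD := scale_in tc pD.
have dT : diagonal_torus (dilation tc 1).
  by exists chi, 1; rewrite oner_eq0; split=> //; exact: dilation_diagonal.
rewrite (zero_section_flowE s pD) (zero_section_flowE s cD).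
have := congr1 (fun h => cbase (h (mkX 0 pD))) (lam_comm dT s0).
rewrite /= (dilation_diagonal tc 1 (lam s _)).1 => <-; congr (cbase (lam s _)).
have [h1 h2] := dilation_diagonal tc 1 (mkX 0 pD).
by apply: cyl_points_eq; rewrite ?h1 ?h2 ?cbase_mkX ?cheight_mkX ?mulr0.
Qed.

Lemma regfun_vertical (h : points X -> K) p (pD : p \in D) :
  regfun h -> univariate (fun w => h (mkX w pD)).
Proof.
have UA := univariate_algebra K; have Uid := univariate_id K.
move=> [P hE]; apply: (fa_eq (f := fun w =>
  P.@[row_mx p (const_mx w : 'rV_1) ord0])) => [|w]; last by rewrite hE.
apply: (fa_meval UA) => j; rewrite -(splitK j); case: split => i /=.
  by apply: (fa_eq (fa_cst UA (p ord0 i))) => w; rewrite row_mxEl.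
by apply: (fa_eq Uid) => w; rewrite row_mxEr mxE.
Qed.

Lemma regfun_lam (s : K) j : s != 0 -> regfun (fun u => val (lam s u) ord0 j).
Proof. by move=> s0; exact: (laurent_family_regfun s0 (lam_laurent j)). Qed.

(** The base coordinates of the image are polynomials in w that do not change
    when w is scaled, hence constant in w. *)
Lemma cbase_lam (s : K) w p (pD : p \in D) : s != 0 ->
  cbase (lam s (mkX w pD)) = zero_section_flow s p.
Proof.
move=> s0; rewrite (zero_section_flowE s pD); apply/rowP => j; rewrite
  !cbase_coord.
have [q qE] := regfun_vertical pD (regfun_lam (lshift 1 j) s0).
have q1 : q = (q.[1])%:P.
  apply: (poly_eq_cofinite (negbT (polyX_eq0 K))) => t; rewrite hornerX => t0.
  rewrite hornerC -!qE -!cbase_coord -[t]mulr1 -stretch_mkX lam_stretch //.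
  by rewrite (dilation_diagonal torus_char1 t (lam s _)).1 scale1.
by rewrite !qE q1 !hornerC.
Qed.

Lemma cheight_lam (s : K) w p (pD : p \in D) : s != 0 ->
  cheight (lam s (mkX w pD)) = w * cheight (lam s (mkX 1 pD)).
Proof.
move=> s0; have [->|w0] := eqVneq w 0; first by rewrite cheight_lam0 // mul0r.
rewrite -{1}[w]mulr1 -stretch_mkX lam_stretch //.
by rewrite (dilation_diagonal torus_char1 w (lam s _)).2.
Qed.

(** On the base the one-parameter group acts through the coordinate torus. It
    multiplies w by a function on Z' whose inverse comes from s^-1; such a
    function is constant. *)
Theorem commuting_flow_diagonal (s : K) : s != 0 -> diagonal_torus (lam s).
Proof.
move=> s0; have s0' : s^-1 != 0 by rewrite invr_eq0.
have mf := zero_section_polynomial_flow.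
have [chi [tc chiE]] := flow_in_torus charK0 m_gt0 lc0 rs_uniq rs_size mf
  (fun chi s p => @zero_section_scale chi s p) s0.
have UA := univariate_algebra K.
have height (t : K) : t != 0 -> exists2 U, along_curves D U &
    forall p (pD : p \in D), cheight (lam t (mkX 1 pD)) = U p.
  move=> t0; have [P PE] := regfun_lam (rshift V ord0) t0.
  exists (fun p => P.@[row_mx p (const_mx 1 : 'rV_1) ord0]); last first.
    by move=> p pD; rewrite -[LHS]/(val (lam t (mkX 1 pD)) ord0 (rshift V
      ord0)) PE.
  move=> g gU _; apply: (fa_meval UA) => j; rewrite -(splitK j).
  case: split => i /=; first by apply: (fa_eq (gU i)) => w; rewrite row_mxEl.
  by apply: (fa_eq (fa_cst UA 1)) => w; rewrite row_mxEr mxE.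
have [U UU UE] := height s s0; have [W WU WE] := height s^-1 s0'.
have back p (pD : p \in D) : U p * W (zero_section_flow s p) = 1.
  have qD : zero_section_flow s p \in D by case: mf => h _ _ _; exact: h.
  have e : lam s (mkX 1 pD) = mkX (U p) qD.
    by apply: cyl_points_eq; rewrite ?cbase_mkX ?cheight_mkX ?cbase_lam ?UE.
  have : cheight (lam s^-1 (lam s (mkX 1 pD))) = 1.
    have := congr1 (fun h => h (mkX 1 pD)) (lamM s0' s0).
    by rewrite mulVf // lam1 /= => <-; rewrite cheight_mkX.
  by rewrite e cheight_lam // WE.
have [c cE] := invertible_constant lc0 rs_uniq rs_size UU
  (along_curves_flow mf s0 WU) (fun p pD _ => back p pD).
exists chi, c; split=> // [|u].
  have [a [_ [ars _ _]]] := two_roots rs_uniq rs_size.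
  have pD := section_point_in lc J (fun=> 1) ars.
  apply: contraTneq (oner_neq0 K) => c0.
  by rewrite -(back _ pD) cE // c0 mul0r eqxx.
have <- : mkX (cheight u) (cbase_in u) = u by apply: cyl_points_eq; rewrite
  ?cbase_mkX ?cheight_mkX.
rewrite cbase_lam // chiE ?cbase_in // cheight_lam // UE cE ?cbase_in //
  cbase_mkX cheight_mkX.
by rewrite mulrC.
Qed.

End CommutingFlows.

(** * Transport of tori, and tori as products of one-parameter groups *)

Section TwoVariableRegular.
Context (K : fieldType) n p (X : {pred 'rV[K]_n}) (Y : {pred 'rV[K]_p}).

Definition regfun2 (h : points X * points Y -> K) : Prop :=
  exists P : {mpoly K[n + p]},
    forall u v, h (u, v) = P.@[row_mx (val u) (val v) ord0].

Lemma regfun2_algebra : function_algebra regfun2.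
Proof.
split=> [c|f g [P fE] [Q gE]|f g [P fE] [Q gE]].
- by exists c%:MP => u v; rewrite mevalC.
- by exists (P + Q) => u v; rewrite mevalD fE gE.
- by exists (P * Q) => u v; rewrite mevalM fE gE.
Qed.

Lemma regfun2_fst j : regfun2 (fun uv => val uv.1 ord0 j).
Proof. by exists 'X_(lshift p j) => u v; rewrite mevalXU row_mxEl. Qed.

Lemma regfun2_snd j : regfun2 (fun uv => val uv.2 ord0 j).
Proof. by exists 'X_(rshift n j) => u v; rewrite mevalXU row_mxEr. Qed.

Lemma regular2P q (W : {pred 'rV[K]_q}) (phi : points X -> points Y -> points
  W) :
  regular2 phi <-> forall j, regfun2 (fun uv => val (phi uv.1 uv.2) ord0 j).
Proof.
split=> [[P PE] j|/fin_all_exists[P PE]].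
  by exists (P j) => u v; rewrite PE.
by exists P => u v j; rewrite -PE.
Qed.

End TwoVariableRegular.

Lemma regular2_comp (K : fieldType) n p q n' p' q'
    (X : {pred 'rV[K]_n}) (Y : {pred 'rV[K]_p}) (W : {pred 'rV[K]_q})
    (X' : {pred 'rV[K]_n'}) (Y' : {pred 'rV[K]_p'}) (W' : {pred 'rV[K]_q'})
    (phi : points X -> points Y -> points W)
    (a : points X' -> points X) (b : points Y' -> points Y)
    (c : points W -> points W') :
  regular a -> regular b -> regular c -> regular2 phi ->
  regular2 (fun u v => c (phi (a u) (b v))).
Proof.
move=> [A AE] [B BE] [E EE] [P PE]; apply/regular2P => j.
have RA := regfun2_algebra X' Y'.
apply: (fa_eq (f := fun uv : points X' * points Y' => (E j).@[val (phi (a uv.1)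
  (b uv.2)) ord0])).
  apply: (fa_meval RA) => i.
  apply: (fa_eq (f := fun uv : points X' * points Y' =>
    (P i).@[row_mx (val (a uv.1)) (val (b uv.2)) ord0])); last by case=> u v;
      rewrite PE.
  apply: (fa_meval RA) => k; rewrite -(splitK k); case: split => l /=.
    apply: (fa_eq (f := fun uv : points X' * points Y' => (A l).@[val uv.1
      ord0])) => [|[u v]].
      by apply: (fa_meval RA) => ?; exact: regfun2_fst.
    by rewrite row_mxEl AE.
  apply: (fa_eq (f := fun uv : points X' * points Y' => (B l).@[val uv.2
    ord0])) => [|[u v]].
    by apply: (fa_meval RA) => ?; exact: regfun2_snd.
  by rewrite row_mxEr BE.
by case=> u v; rewrite EE.
Qed.

Lemma regular_id (K : fieldType) n (X : {pred 'rV[K]_n}) : regular (@id (points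
  X)).
Proof. by apply/regularP => j; exact: regfun_coord. Qed.

Section Transport.
Context (K : fieldType) n1 n2 (X1 : {pred 'rV[K]_n1}) (X2 : {pred 'rV[K]_n2}).
Context (phi : points X1 -> points X2) (psi : points X2 -> points X1).
Hypotheses (rphi : regular phi) (rpsi : regular psi)
  (phiK : cancel phi psi) (psiK : cancel psi phi).

Definition transport (H : (points X2 -> points X2) -> Prop)
    (h : points X1 -> points X1) : Prop := H (phi \o h \o psi).

Lemma transport_is_aut h : is_aut (phi \o h \o psi) -> is_aut h.
Proof.
have conjE (g : points X1 -> points X1) : psi \o (phi \o g \o psi) \o phi = g.
  by apply: functional_extensionality => u; rewrite /= !phiK.
have conj_reg g : regular (phi \o g \o psi) -> regular g.
  move=> rg; rewrite -(conjE g).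
  exact: regular_comp rphi (regular_comp rg rpsi).
move=> [/conj_reg rh [k [rk hk kh]]]; split=> //.
exists (psi \o k \o phi); split.
- exact: regular_comp rphi (regular_comp rk rpsi).
- move=> u; rewrite /=; have := hk (phi u); rewrite /= phiK => ->; exact: phiK.
- move=> u /=; apply: (can_inj phiK); have := kh (phi u).
  by rewrite /= => ->.
Qed.

Lemma transport_algebraic_subgroup G H :
  algebraic_subgroup G H -> algebraic_subgroup G (transport H).
Proof.
move=> [[Haut H1 HM HV] [rho [rhoM rhoI rhoE rhoR]]]; split.
  split.
  - by move=> h /Haut /transport_is_aut.
  - rewrite /transport (_ : phi \o id \o psi = id) //.
    by apply: functional_extensionality => u /=; rewrite psiK.
  - move=> g h Hg Hh; have := HM _ _ Hg Hh; rewrite /transport.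
    by congr H; apply: functional_extensionality => u /=; rewrite phiK.
  - move=> g h Hg gh hg; apply: HV Hg _ _ => u /=.
      by rewrite phiK gh psiK.
    by rewrite phiK hg psiK.
exists (fun g => psi \o rho g \o phi); split.
- move=> g h; rewrite rhoM; apply: functional_extensionality => u /=.
  by rewrite psiK.
- move=> g h e; apply: rhoI; apply: functional_extensionality => u.
  have := congr1 (fun k => phi (k (psi u))) e.
  by rewrite /= !psiK.
- move=> h; rewrite /transport rhoE; split=> [[g gE]|[g <-]].
    exists g; rewrite gE; apply: functional_extensionality => u /=.
    by rewrite !phiK.
  by exists g; apply: functional_extensionality => u /=; rewrite !psiK.
- exact: (regular2_comp (@regular_id _ _ _) rphi rpsi rhoR).
Qed.

Lemma transport_torus d H : torus_of_dim d H -> torus_of_dim d (transport H).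
Proof.
by move=> [G [GH iso]]; exists G; split=> //; exact:
  transport_algebraic_subgroup.
Qed.

End Transport.

Lemma transport_maximal_torus (K : fieldType) n1 n2
    (X1 : {pred 'rV[K]_n1}) (X2 : {pred 'rV[K]_n2})
    (phi : points X1 -> points X2) (psi : points X2 -> points X1) H :
  regular phi -> regular psi -> cancel phi psi -> cancel psi phi ->
  maximal_torus H -> maximal_torus (transport phi psi H).
Proof.
move=> rphi rpsi phiK psiK [[d Hd] Hmax]; split.
  by exists d; exact: transport_torus.
move=> H' [d' H'd] HH' h H'h.
have back : is_torus (transport psi phi H').
  by exists d'; exact: transport_torus.
apply: (Hmax _ back) => [g Hg|]; last first.
  rewrite /transport (_ : psi \o _ \o phi = h) //.
  by apply: functional_extensionality => u /=; rewrite !phiK.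
apply: HH'; rewrite /transport (_ : phi \o _ \o psi = g) //.
by apply: functional_extensionality => u /=; rewrite !psiK.
Qed.

Section OneParameterSubgroups.
Context (K : fieldType) (d : nat).

Definition torus_point (t : 'I_d -> K) : points (@Gm_set K d) :=
  insubd (Gm_one K d) (row_mx (\row_j t j) (\row_j (t j)^-1)).

Lemma val_torus_point t : (forall j, t j != 0) ->
  val (torus_point t) = row_mx (\row_j t j) (\row_j (t j)^-1).
Proof.
move=> t0; rewrite val_insubd; case: ifP => // /negP[].
by rewrite inE; apply/forallP => i; rewrite row_mxEl row_mxEr !mxE divff.
Qed.

Lemma torus_coordK (g : points (@Gm_set K d)) i :
  val g ord0 (lshift d i) * val g ord0 (rshift d i) = 1.
Proof. by have /forallP/(_ i)/eqP := valP g. Qed.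

Lemma torus_coord_neq0 (g : points (@Gm_set K d)) i :
  val g ord0 (lshift d i) != 0.
Proof.
apply: contraTneq (oner_neq0 K) => g0.
by rewrite -(torus_coordK g i) g0 mul0r eqxx.
Qed.

Lemma torus_point_eq (g h : points (@Gm_set K d)) :
  (forall i, val g ord0 (lshift d i) = val h ord0 (lshift d i)) -> g = h.
Proof.
move=> e; apply: val_inj; apply/rowP => j; rewrite -(splitK j).
case: split => i //=; apply: (mulfI (torus_coord_neq0 g i)).
by rewrite torus_coordK e torus_coordK.
Qed.

Lemma torus_point_coord t i : (forall j, t j != 0) ->
  val (torus_point t) ord0 (lshift d i) = t i.
Proof. by move=> t0; rewrite val_torus_point // row_mxEl mxE. Qed.

Lemma torus_pointM t t' : (forall j, t j != 0) -> (forall j, t' j != 0) ->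
  torus_point (fun j => t j * t' j) = Gm_mul (torus_point t) (torus_point t').
Proof.
move=> t0 t0'; apply: torus_point_eq => i.
rewrite torus_point_coord => [|j]; last by rewrite mulf_neq0.
by rewrite /= mxE !torus_point_coord.
Qed.

Definition one_parameter (i : 'I_d) (s : K) : points (@Gm_set K d) :=
  torus_point (fun j => if j == i then s else 1).

Lemma one_parameter_neq0 i (s : K) : s != 0 -> forall j : 'I_d,
  (if j == i then s else 1) != 0.
Proof. by move=> s0 j; case: ifP => _ //; exact: oner_neq0. Qed.

Lemma one_parameterM i (s t : K) : s != 0 -> t != 0 ->
  one_parameter i (s * t) = Gm_mul (one_parameter i s) (one_parameter i t).
Proof.
move=> s0 t0; rewrite -torus_pointM; try exact: one_parameter_neq0.
congr torus_point; apply: functional_extensionality => j.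
by case: eqP => _; rewrite ?mulr1.
Qed.

Lemma one_parameter1 i : one_parameter i 1 = Gm_one K d.
Proof.
apply: torus_point_eq => j.
rewrite torus_point_coord; first by rewrite if_same /= mxE.
by move=> k; rewrite if_same oner_eq0.
Qed.

(** A point of the torus is the product of its coordinates, each placed in its
    own one-parameter group. *)
Lemma torus_generated (P : points (@Gm_set K d) -> Prop) :
  P (Gm_one K d) -> (forall g h, P g -> P h -> P (Gm_mul g h)) ->
  (forall i s, s != 0 -> P (one_parameter i s)) -> forall g, P g.
Proof.
move=> P1 PM Pi g; pose u i := val g ord0 (lshift d i).
have u0 i : u i != 0 by exact: torus_coord_neq0.
(* The partial products of the coordinates of g. *)
pose cut k (i : 'I_d) := if (i < k)%N then u i else 1.
have cut0 k j : cut k j != 0 by rewrite /cut; case: ifP => _ //; exact: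
  oner_neq0.
suff cutP k : (k <= d)%N -> P (torus_point (cut k)).
  have -> : g = torus_point (cut d).
    by apply: torus_point_eq => i; rewrite torus_point_coord // /cut ltn_ord.
  exact: cutP.
elim: k => [|k IHk] kd.
  have -> // : torus_point (cut 0%N) = Gm_one K d.
  by apply: torus_point_eq => i; rewrite torus_point_coord //= mxE.
pose i := Ordinal kd.
have -> : torus_point (cut k.+1) = Gm_mul (torus_point (cut k)) (one_parameter
  i (u i)).
  rewrite -torus_pointM //; last exact: one_parameter_neq0.
  congr torus_point; apply: functional_extensionality => j.
  rewrite /cut ltnS -val_eqE /=.
  case: (ltngtP (nat_of_ord j) k) => jk; rewrite ?mulr1 ?mul1r //.
  by congr u; exact: val_inj.
by apply: PM; [apply: IHk; apply: ltnW | exact: Pi].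
Qed.

End OneParameterSubgroups.

(** * The torus of dimension n *)

Lemma alg_group_isomorphic_refl (K : fieldType) (G : alg_group K) :
  alg_group_isomorphic G G.
Proof. by exists id, id; split=> //; exact: regular_id. Qed.

Lemma algebraic_action_one (K : fieldType) n (X : {pred 'rV[K]_n}) (G :
  alg_group K)
    H (rho : points (ag_set G) -> points X -> points X) :
  is_subgroup_of_Aut H ->
  (forall g h, rho (ag_mul g h) = rho g \o rho h) ->
  (forall phi, H phi <-> exists g, rho g = phi) -> rho (ag_one G) = id.
Proof.
move=> [_ H1 _ _] rhoM rhoE; have [g gE] := (rhoE id).1 H1.
by rewrite -gE -[in RHS](ag_mul1 g) rhoM gE.
Qed.

(** The isomorphism with the standard torus is absorbed in the action. *)
Lemma torus_parametrization (K : fieldType) n (X : {pred 'rV[K]_n}) d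
    (H : (points X -> points X) -> Prop) : torus_of_dim d H ->
  is_subgroup_of_Aut H /\
  exists rho : points (@Gm_set K d) -> points X -> points X,
    [/\ forall g h, rho (Gm_mul g h) = rho g \o rho h, rho (Gm_one K d) = id,
        forall phi, H phi <-> exists g, rho g = phi & regular2 rho].
Proof.
move=> [G [[Hs [rho [rhoM rhoI rhoE rhoR]]] [a [b [ra rb ab ba aM]]]]].
split=> //; pose G' := Gm_power K d.
have bM : {morph b : g h / Gm_mul g h >-> ag_mul g h}.
  move=> g h; apply: (can_inj ab); rewrite ba aM !ba; exact: erefl.
have rho'M g h : rho (b (Gm_mul g h)) = rho (b g) \o rho (b h).
  by rewrite bM rhoM.
have rho'E phi : H phi <-> exists g, rho (b g) = phi.
  rewrite rhoE; split=> [[g <-]|[g <-]]; last by exists (b g).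
  by exists (a g); rewrite ab.
exists (rho \o b); split=> //.
  exact: (@algebraic_action_one _ _ _ G' H (rho \o b)).
exact: (regular2_comp rb (@regular_id _ _ _) (@regular_id _ _ _) rhoR).
Qed.

Section StandardTorus.
Context (K : closedFieldType) (charK0 : [pchar K] =i pred0) (q n0 : nat).
Let N := n0.+1.
Let m := (q + N)%N.
Context (lc : K) (rs : seq K).
Hypotheses (lc0 : lc != 0) (rs_uniq : uniq rs) (rs_size : (2 <= size rs)%N).

(** The first variable is excluded because its character is determined by prod
    chi = 1; the free variables are the last n - 1, which the index k != 0 of
    the second block enumerates. *)
Definition fixed_var (i : 'I_m) : bool :=
  (nat_of_ord i != 0%N) && (if split i is inr k then k == ord0 else true).

Let J : pred 'I_m := fixed_var.
Let C := 1 + ymon K m * twist K J.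
Let D := danielewski_of lc rs (ymon K m ^+ 3) C.
Let X := danielewski_cyl lc rs (ymon K m ^+ 3) C.
Let T : (points X -> points X) -> Prop := @diagonal_torus K m lc rs J.

(** The coordinates k != 0 of the n-dimensional torus scale the free
    variables, and the inverse of their product scales the first variable; the
    coordinate 0 is left for w. *)
Definition char_of (g : 'rV[K]_(N + N)) (i : 'I_m) : K :=
  (if nat_of_ord i == 0%N
   then \prod_(k < N | k != ord0) g ord0 (rshift N k) else 1) *
  (if split i is inr k then if k == ord0 then 1 else g ord0 (lshift N k) else
    1).

Let i00 : 'I_m := cast_ord (esym (addnS q n0)) ord0.

Lemma char_of_free g k : k != ord0 ->
  char_of g (rshift q k) = g ord0 (lshift N k).
Proof.
move=> k0; rewrite /char_of (_ : split _ = inr k) ?(negPf k0).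
  have -> : (nat_of_ord (rshift q k) == 0%N) = false.
    apply/negbTE; rewrite /= addn_eq0 negb_and; apply/orP; right.
    by apply: contraNneq k0 => kk; apply/eqP/val_inj.
  by rewrite mul1r.
by have := unsplitK (inr k : 'I_q + 'I_N).
Qed.

Lemma char_of_torus_char (g : points (@Gm_set K N)) : torus_char J (char_of
  (val g)).
Proof.
split; last first.
  move=> i /andP[/negPf i0]; rewrite /char_of i0.
  by case: split => [a _|k ->]; rewrite mulr1.
rewrite /char_of big_split /= (bigD1 i00) //= [X in _ * X * _]big1 => [|i ii];
  last first.
  by rewrite ifN //; apply: contraNneq ii => i0; apply/eqP/val_inj.
rewrite mulr1 big_split_ord /= [X in _ * (X * _)]big1 => [|i _]; last first.
  by rewrite (_ : split _ = inl i) //; have := unsplitK (inl i : 'I_q + 'I_N).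
rewrite mul1r [X in _ * X](bigD1 ord0) //=.
rewrite (_ : split _ = inr ord0); last by have := unsplitK (inr ord0 : 'I_q +
  'I_N).
rewrite mul1r -big_split big1 // => k k0 /=.
rewrite (_ : split _ = inr k); last by have := unsplitK (inr k : 'I_q + 'I_N).
by rewrite (negPf k0) mulrC torus_coordK.
Qed.

(** Both characters agree off the first variable and have product 1, so they
    agree there too. *)
Lemma char_of_surj (chi : 'I_m -> K) (t : K) : torus_char J chi -> t != 0 ->
  exists g : points (@Gm_set K N),
    char_of (val g) = chi /\ val g ord0 (lshift N ord0) = t.
Proof.
move=> tc t0; have chi0 := torus_char_neq0 tc.
pose u (k : 'I_N) := if k == ord0 then t else chi (rshift q k).
have u0 k : u k != 0 by rewrite /u; case: ifP.
exists (torus_point u); rewrite torus_point_coord //; split=> //.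
set g := torus_point u; have tg := char_of_torus_char g.
have off i : i != i00 -> char_of (val g) i = chi i.
  move=> ii; have [Ji|] := boolP (J i); first by rewrite tg.2 // tc.2.
  rewrite /J /fixed_var negb_and negbK => /orP[/eqP i0|].
    by case/eqP: ii; exact: val_inj.
  rewrite -[in X in _ -> X](splitK i); case: split => //= k k0.
  by rewrite char_of_free // torus_point_coord // /u (negPf k0).
apply: functional_extensionality => i; have [->|] := eqVneq i i00; last exact:
  off.
have : \prod_i char_of (val g) i = \prod_i chi i by rewrite tg.1 tc.1.
rewrite (bigD1 i00) //= [in RHS](bigD1 i00) //=.
rewrite (eq_bigr _ off) => /mulIf; apply.
by apply/prodf_neq0 => j _; exact: chi0.
Qed.

Definition torus_action (g : points (@Gm_set K N)) : points X -> points X :=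
  dilation (char_of_torus_char g) (val g ord0 (lshift N ord0)).

Lemma torus_action_diagonal g :
  diagonal (char_of (val g)) (val g ord0 (lshift N ord0)) (torus_action g).
Proof. exact: dilation_diagonal. Qed.

Lemma torus_action_char g h : torus_action g = torus_action h ->
  char_of (val g) = char_of (val h) /\
  val g ord0 (lshift N ord0) = val h ord0 (lshift N ord0).
Proof.
move=> e; have [a [_ [ars _ _]]] := two_roots rs_uniq rs_size.
pose u : points X := mkX 1 (section_point_in lc J (fun=> 1) ars).
have [g1 g2] := torus_action_diagonal g u.
have [h1 h2] := torus_action_diagonal h u.
rewrite e h1 cbase_mkX /scale !mkpE in g1.
rewrite e h2 cheight_mkX !mulr1 in g2.
split=> //; have := congr1 py g1; rewrite !mkpE => e1.
apply: functional_extensionality => i.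
by have := congr1 (fun k => k i) e1; rewrite !mulr1.
Qed.

Lemma torus_action_inj : injective torus_action.
Proof.
move=> g h /torus_action_char[ec et]; apply: torus_point_eq => k.
have [->|k0] := eqVneq k ord0; first exact: et.
by rewrite -!char_of_free // ec.
Qed.

Lemma diagonal_comp chi chi' t t' (phi psi : points X -> points X) :
  diagonal chi t phi -> diagonal chi' t' psi ->
  diagonal (fun i => chi i * chi' i) (t * t') (phi \o psi).
Proof.
move=> h h' u; have [a b] := h (psi u); have [a' b'] := h' u.
rewrite /= a a' b b' mulrA /scale !mkpE; split=> //; congr mkp.
by apply: functional_extensionality => i; rewrite mulrA.
Qed.

Lemma torus_actionM g h :
  torus_action (Gm_mul g h) = torus_action g \o torus_action h.
Proof.
apply: diagonal_unique (torus_action_diagonal _) _.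
have := diagonal_comp (torus_action_diagonal g) (torus_action_diagonal h).
congr diagonal; last by rewrite /= mxE.
have e k : val (Gm_mul g h) ord0 k = val g ord0 k * val h ord0 k by rewrite /=
  mxE.
apply: functional_extensionality => i; rewrite /char_of.
case: (nat_of_ord i == 0%N); case: split => [j|k].
- by rewrite (eq_bigr _ (fun k _ => e (rshift N k))) big_split /=; ring.
- rewrite (eq_bigr _ (fun k _ => e (rshift N k))) big_split.
  by case: (k == ord0); rewrite ?e /=; ring.
- by ring.
- by case: (k == ord0); rewrite ?e /=; ring.
Qed.

Lemma torus_action_regular : regular2 torus_action.
Proof.
apply/regular2P => j; have RA := regfun2_algebra (@Gm_set K N) X.
have Rg k : regfun2 (fun gu : points (@Gm_set K N) * points X => val gu.1 ord0
  k).
  exact: regfun2_fst.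
have Ru k : regfun2 (fun gu : points (@Gm_set K N) * points X => cbase gu.2
  ord0 k).
  by apply: (fa_eq (regfun2_snd _ _ (lshift 1 k))) => gu; rewrite cbase_coord.
have Rc i : regfun2 (fun gu : points (@Gm_set K N) * points X =>
    char_of (val gu.1) i).
  rewrite /char_of; apply: (fa_mul RA).
    case: (nat_of_ord i == 0%N); last exact: (fa_cst RA).
    by apply: (fa_prod RA) => k; exact: Rg.
  case: (split i) => [a|k]; first exact: (fa_cst RA).
  by case: (k == ord0); [exact: (fa_cst RA) | exact: Rg].
rewrite -(splitK j); case: split => k /=; last first.
  apply: (fa_eq (fa_mul RA (Rg (lshift N ord0)) (regfun2_snd _ _ (rshift _
    ord0)))).
  by move=> gu; rewrite row_mxEr mxE.
apply: (fa_eq (f := fun gu : points (@Gm_set K N) * points X =>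
    scale (char_of (val gu.1)) (cbase gu.2) ord0 k)).
  apply: (fa_mkp RA) => //; [exact: Ru | | exact: Ru].
  by move=> i; apply: (fa_mul RA); [exact: Rc | exact: Ru].
by move=> gu; rewrite row_mxEl.
Qed.

Lemma torus_actionE phi : T phi <-> exists g, torus_action g = phi.
Proof.
split=> [[chi [t [tc t0 phiE]]]|[g <-]]; last first.
  exists (char_of (val g)), (val g ord0 (lshift N ord0)).
  by split; [exact: char_of_torus_char | exact: torus_coord_neq0
            | exact: torus_action_diagonal].
have [g [gc gt]] := char_of_surj tc t0; exists g.
by apply: diagonal_unique (torus_action_diagonal g) _; rewrite gc gt.
Qed.

Lemma torus_action_one : torus_action (Gm_one K N) = id.
Proof.
apply: diagonal_unique (torus_action_diagonal _) _ => u.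
have e k : val (Gm_one K N) ord0 k = 1 by rewrite /= mxE.
rewrite e mul1r; split=> //.
rewrite (_ : char_of _ = fun=> 1) ?scale1 //.
apply: functional_extensionality => i; rewrite /char_of big1 => [|k _]; last
  exact: e.
by rewrite if_same mul1r; case: split => // k; rewrite e if_same.
Qed.

Lemma torus_actionV g : cancel (torus_action g) (torus_action (Gm_inv g)).
Proof.
move=> u; have := congr1 (fun h => h u) (torus_actionM (Gm_inv g) g).
by rewrite /= Gm_mulV torus_action_one => <-.
Qed.

Lemma Gm_invK (g : points (@Gm_set K N)) : Gm_inv (Gm_inv g) = g.
Proof. by apply: torus_point_eq => i; rewrite /= row_mxEl mxE row_mxEr mxE. Qed.

Lemma torus_dimension : torus_of_dim N T.
Proof.
exists (Gm_power K N); split; last exact: alg_group_isomorphic_refl.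
have Vr g : cancel (torus_action (Gm_inv g)) (torus_action g).
  by have := torus_actionV (Gm_inv g); rewrite Gm_invK.
split; last first.
  exists torus_action; split.
  - exact: torus_actionM.
  - exact: torus_action_inj.
  - exact: torus_actionE.
  - exact: torus_action_regular.
have regG g : regular (torus_action g).
  have [P PE] := torus_action_regular.
  apply/regularP => j; have RA := regfun_algebra X.
  apply: (fa_eq (f := fun u : points X =>
    (P j).@[row_mx (val g) (val u) ord0])) => [|u]; last by rewrite PE.
  apply: (fa_meval RA) => k; rewrite -(splitK k); case: split => i /=.
    by apply: (fa_eq (fa_cst RA (val g ord0 i))) => u; rewrite row_mxEl.
  by apply: (fa_eq (regfun_coord _ i)) => u; rewrite row_mxEr.
split.
- move=> phi /torus_actionE[g <-]; split; first exact: regG.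
  by exists (torus_action (Gm_inv g)); split=> //; exact: torus_actionV.
- by apply/torus_actionE; exists (Gm_one K N); exact: torus_action_one.
- move=> phi psi /torus_actionE[g <-] /torus_actionE[h <-].
  by apply/torus_actionE; exists (Gm_mul g h); exact: torus_actionM.
- move=> phi psi /torus_actionE[g <-] gp pg; apply/torus_actionE.
  exists (Gm_inv g); apply: functional_extensionality => u.
  by rewrite -{1}(pg u) torus_actionV.
Qed.

(** The standard torus contains the scalings of w and the coordinate torus, so
    every one-parameter group of a larger torus commutes with them. *)
Theorem standard_torus_maximal : maximal_torus T.
Proof.
split; first by exists N; exact: torus_dimension.
move=> H' [d /torus_parametrization[H's [rho [rhoM rho1 rhoE rhoR]]]] TH'.
have [_ T1 TM _] : is_subgroup_of_Aut T by have [G [[]]] := torus_dimension.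
suff all_T g : T (rho g) by move=> phi /rhoE[g <-].
move: g; apply: torus_generated => [|g h Tg Th|i s s0].
- by rewrite rho1.
- by rewrite rhoM; exact: TM.
have m_gt0 : (0 < m)%N by rewrite /m addnS.
apply: (commuting_flow_diagonal charK0 m_gt0 lc0 rs_uniq rs_size
  (lam := fun s => rho (one_parameter i s))) s0.
- by rewrite one_parameter1.
- by move=> s' t s0' t0; rewrite one_parameterM // rhoM.
- move=> j; have LA := laurent_family_algebra X; have [P PE] := rhoR.
  pose F (su : K * points X) :=
    row_mx (row_mx (\row_j (if j == i then su.1 else 1))
                   (\row_j (if j == i then su.1^-1 else 1))) (val su.2) ord0.
  have [e [R RE]] : laurent_family (fun su => (P j).@[F su]).
    apply: (fa_meval LA) => k; rewrite /F -(splitK k); case: split => l /=.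
      rewrite -(splitK l); case: split => l' /=.
        have [ll|/negPf ll] := eqVneq l' i.
          apply: (fa_eq (laurent_family_param X)) => su.
          by rewrite !row_mxEl mxE ll eqxx.
        by apply: (fa_eq (fa_cst LA 1)) => su; rewrite !row_mxEl mxE ll.
      have [ll|/negPf ll] := eqVneq l' i.
        apply: (fa_eq (laurent_family_paramV X)) => su.
        by rewrite row_mxEl row_mxEr mxE ll eqxx.
      by apply: (fa_eq (fa_cst LA 1)) => su; rewrite row_mxEl row_mxEr mxE ll.
    by apply: (fa_eq (laurent_family_coord X l)) => su; rewrite row_mxEr.
  exists e, R => s' u s0'; rewrite -RE //= PE; congr (_ * meval _ _).
  rewrite /F /one_parameter val_torus_point; last exact: one_parameter_neq0.
  congr (fun_of_matrix (row_mx (row_mx _ _) _) ord0).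
  by apply/rowP => k; rewrite !mxE; case: ifP; rewrite ?invr1.
- move=> phi s' /TH' /rhoE[g <-] _; rewrite -!rhoM; congr rho.
  by apply: torus_point_eq => k; rewrite /= !mxE mulrC.
Qed.

End StandardTorus.

Section Exponents.
Context (K : closedFieldType) (m : nat).

Lemma admissible_monomial N (k : 'I_m -> nat) :
  (forall i, 0 < k i <= N)%N ->
  admissible N (\prod_i 'X_i ^+ k i) (1 : {mpoly K[m]}).
Proof.
move=> kN; split.
- exists (\prod_i 'X_i ^+ (k i).-1); rewrite /ymon -big_split /=.
  apply: eq_bigr => i _; rewrite -exprS prednK //.
  by have /andP[] := kN i.
- exists (\prod_i 'X_i ^+ (N - k i)); rewrite /ymon -prodrXl -big_split /=.
  apply: eq_bigr => i _; rewrite -exprD subnKC //.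
  by have /andP[] := kN i.
- by exists 0; rewrite mulr0 addr0.
Qed.

Lemma admissible_leq N N' (M C : {mpoly K[m]}) : (N <= N')%N ->
  admissible N M C -> admissible N' M C.
Proof.
move=> le [h [e eE] h']; split=> //.
by exists (e * ymon K m ^+ (N' - N)); rewrite mulrA -eE -exprD subnKC.
Qed.

End Exponents.

Lemma danielewskiE (K : closedFieldType) (f : {poly K}) lc rs m k :
  f = split_poly lc rs ->
  danielewski f k = danielewski_of lc rs (\prod_i 'X_i ^+ k i) (1 : {mpoly
    K[m]}).
Proof.
move=> fE; apply: functional_extensionality => v.
rewrite /danielewski /danielewski_of /= meval1 split_form1 -fE rmorph_prod /=.
congr (_ * _ == _); apply: eq_bigr => i _.
by rewrite rmorphXn /= mevalXU.
Qed.

Theorem theorem6p4 (K : closedFieldType) (charK0 : [pchar K] =i pred0)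
    (f : {poly K}) (deg_f : (2 <= (size f).-1)%N)
    (roots_f : has_distinct_roots f)
    (m : nat) (m_gt0 : (0 < m)%N)
    (k : 'I_m -> nat) (k_gt0 : forall i, (0 < k i)%N)
    (n : nat) (n_bounds : (1 <= n <= m)%N) :
  let X := product (danielewski f k) (full_space K 1) in
  exists T : (points X -> points X) -> Prop,
    maximal_torus T /\ torus_of_dim n T.
Proof.
have [rs [rs_uniq fE]] := roots_f; set lc := lead_coef f in fE.
have lc0 : lc != 0.
  by rewrite lead_coef_eq0 -size_poly_gt0; case: (size f) deg_f.
have rs_size : (2 <= size rs)%N.
  by move: deg_f; rewrite fE size_scale // size_prod_XsubC.
have [q mE] : exists q, m = (q + n.-1.+1)%N by exists (m - n)%N; lia.
have nE : n = n.-1.+1 by lia.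
move: {n_bounds} (n.-1) nE mE => n0 nE mE; rewrite {}nE {n}.
subst m; rewrite (danielewskiE k fE) /=.
pose C := 1 + ymon K (q + n0.+1) * twist K (@fixed_var q n0).
(* A bound for the exponent 3 and for all k_i. *)
pose N := (3 + \sum_i k i)%N.
have adm1 : admissible N (\prod_i 'X_i ^+ k i) (1 : {mpoly K[q + n0.+1]}).
  apply: admissible_monomial => i; rewrite k_gt0 /N (bigD1 i) //=.
  by rewrite addnCA leq_addr.
have adm2 : admissible N (ymon K (q + n0.+1) ^+ 3) C.
  by apply: admissible_leq (@admissible_twisted _ _ _); rewrite leq_addr.
have [g [h [rg rh gh hg]]] := danielewski_cyl_iso lc0 rs_uniq adm1 adm2.
exists (transport g h (@diagonal_torus K _ lc rs (@fixed_var q n0))); split.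
  by apply: transport_maximal_torus => //; exact: standard_torus_maximal.
by apply: transport_torus => //; exact: torus_dimension.
Qed.
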